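(* Let $M\subset\mathbb{R}^{2n}$ be a real analytic hypersurface with $0\in M$ and let $J$ be a real analytic almost complex structure on $\mathbb{R}^{2n}$. Let $\mathbb{L}$ be a subbundle of $T^JM$ such that the following property is true: if $X\in\mathbb{L}$ commutes at order $k$ at the point $0$, then for all $X_1,\ldots,X_{k+1}\in\{X,JX\}$, $[X_1,[\ldots,[X_k,X_{k+1}]\ldots]](0)$ belongs to $\mathbb{L}_0$. Then for all $X\in\mathbb{L}$ there exists a germ of $J$-holomorphic disc $\gamma$ such that $\gamma(0)=0$, $\frac{\partial^k\gamma}{\partial x^k}(0)=D_X^{k-1,0}X(0)$ for all integers $k\ge1$, and $\gamma$ is included in $M$.
   Context: A real analytic hypersurface is $M=\{\varphi=0\}$ with $\varphi$ real valued, real analytic, and $d\varphi$ nowhere vanishing on $M$. An almost complex structure is a field $J$ of endomorphisms of the tangent spaces with $J^2=-\mathrm{Id}$; without restriction $J(0)=J_0$, the standard complex structure of $\mathbb{R}^{2n}=\mathbb{C}^n$, and $J$ is as close to $J_0$ as needed. $T^JM=TM\cap J\,TM$. Subbundles of $T^JM$ are understood to be complex ($J$-invariant) and real analytic; ''$X\in\mathbb{L}$'' means that $X$ is a real analytic vector field near $0$ which is a section of $\mathbb{L}$; $\mathbb{L}_0$ is the fibre at $0$. The property assumed of $\mathbb{L}$ is required for every $k$. A vector field $X$ commutes at order $k$ at a point $p$ if for all $2\le l\le k$ and all $X_1,\ldots,X_l\in\{X,JX\}$, $[X_1,[\ldots,[X_{l-1},X_l]\ldots]](p)=0$. A symmetric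 connection $\nabla$ is fixed; $X\cdot Y$ denotes $\nabla_XY$, and $D_X^{k,0}Y=X\cdot(X\cdots(X\cdot Y)\cdots)$ with $k$ occurrences of $X$. A $J$-holomorphic disc is a $C^1$ map $\gamma$ from the unit disc of $\mathbb{C}$ to $\mathbb{R}^{2n}$ with $d\gamma(\zeta)\circ J_0=J(\gamma(\zeta))\circ d\gamma(\zeta)$ for all $\zeta=x+iy$ ($J_0$ being here the standard structure of $\mathbb{C}$); a germ of $J$-holomorphic disc is such a map defined on some disc $\{|\zeta|<\varepsilon\}$, $\varepsilon>0$. It is included in $M$ if the image of this disc lies in $M$.
   Formalization: For a non-flat symmetric connection, ∂^kγ/∂x^k is read as the (k−1)-st covariant x-derivative of ∂γ/∂x along γ, since with ordinary derivatives the claim can fail; for the flat connection it is the ordinary derivative. *)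

(* Defs.v *)
From HB Require Import structures.
From mathcomp Require Import all_boot all_order all_algebra.
From mathcomp Require Import all_classical all_reals all_analysis.

Set Implicit Arguments.
Unset Strict Implicit.
Unset Printing Implicit Defensive.

Import Order.TTheory GRing.Theory Num.Theory numFieldNormedType.Exports.
Local Open Scope classical_set_scope.
Local Open Scope ring_scope.

(* Points and tangent vectors of R^m are row vectors; an endomorphism of the
   tangent space is a matrix acting on the right, so J v is [v *m J p]. *)

Section RealAnalytic.
Context {R : realType} {m : nat}.

(* The part of degree k of the power series \sum_a c_a h^a, a ranging over the
   multi-indices in N^m; a multi-index of degree k has entries in 'I_k.+1. *)
Definition homogeneous_part (c : {ffun 'I_m -> nat} -> R) (h : 'rV[R]_m)
    (k : nat) : R :=
  \sum_(a : {ffun 'I_m -> 'I_k.+1} | (\sum_i a i == k)%N)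
     c [ffun i => a i : nat] * \prod_i h ord0 i ^+ a i.

(* Absolute convergence is that of the multi-indexed family: the first series
   is the one of the terms |c_a h^a|, grouped by degree. *)
Definition analytic_at (f : 'rV[R]_m -> R) (p : 'rV[R]_m) : Prop :=
  exists (c : {ffun 'I_m -> nat} -> R) (r : R), 0 < r /\
    forall h : 'rV[R]_m, `|h| < r ->
      cvgn (series (homogeneous_part (fun a => `|c a|) (map_mx Num.norm h))) /\
      series (homogeneous_part c h) @ \oo --> f (p + h).

Definition analytic_field_at (X : 'rV[R]_m -> 'rV[R]_m) (p : 'rV[R]_m) : Prop :=
  forall j, analytic_at (fun q => X q ord0 j) p.

Definition smooth (X : 'rV[R]_m -> 'rV[R]_m) : Prop :=
  forall (vs : seq 'rV[R]_m) (p : 'rV[R]_m),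
    differentiable (foldr (fun v Y q => 'D_v Y q) X vs) p.

End RealAnalytic.

Section Geometry.
Context {R : realType} {m : nat}.
Notation V := 'rV[R]_m.

Definition hypersurface (U : set V) (phi : V -> R) : set V :=
  [set p | U p /\ phi p = 0].

Definition analytic_defining_function (U : set V) (phi : V -> R) : Prop :=
  [/\ open U,
      forall p, U p -> analytic_at phi p &
      forall p, hypersurface U phi p -> exists v, 'd phi p v != 0].

(* T_p M, for p in M = hypersurface U phi *)
Definition tangent (phi : V -> R) (p : V) : set V := [set v | 'd phi p v = 0].

Definition analytic_almost_complex (J : V -> 'M[R]_m) : Prop :=
  (forall p, J p *m J p = - 1%:M) /\
  (forall i j p, analytic_at (fun q => J q i j) p).

Definition complex_tangent (phi : V -> R) (J : V -> 'M[R]_m) (p : V) : set V :=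
  tangent phi p `&` [set v *m J p | v in tangent phi p].

(* L is a family of fibres; only those over M matter. *)
Definition complex_analytic_subbundle (U : set V) (phi : V -> R)
    (J : V -> 'M[R]_m) (L : V -> {vspace V}) : Prop :=
  forall p, hypersurface U phi p ->
    [/\ forall v, v \in L p -> complex_tangent phi J p v,
        forall v, v \in L p -> v *m J p \in L p &
        exists (d : nat) (e : 'I_d -> V -> V),
          \forall q \near p,
            (forall i, analytic_field_at (e i) q) /\
            (hypersurface U phi q -> basis_of (L q) [tuple e i q | i < d])].

(* A section over M near 0 is given by an analytic extension to a neighbourhood
   of 0 in R^m. As it is tangent to M, its brackets and its covariant
   derivatives at points of M do not depend on the extension. *)
Definition section_near0 (U : set V) (phi : V -> R) (L : V -> {vspace V})
    (X : V -> V) : Prop :=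
  \forall p \near (0 : V),
    analytic_field_at X p /\ (hypersurface U phi p -> X p \in L p).

Definition lie_bracket (X Y : V -> V) : V -> V :=
  fun p => 'D_(X p) Y p - 'D_(Y p) X p.

(* [:: X_1; ...; X_l] is mapped to [X_1, [ ..., [X_(l-1), X_l] ... ]] *)
Fixpoint nested_bracket (s : seq (V -> V)) : V -> V :=
  match s with
  | [::] => fun=> 0
  | [:: X] => X
  | X :: s' => lie_bracket X (nested_bracket s')
  end.

(* A choice of X_1, ..., X_l in {X, JX} is encoded by a word w of l booleans,
   [true] standing for JX. *)
Definition word_bracket (J : V -> 'M[R]_m) (X : V -> V) (w : seq bool) : V -> V :=
  nested_bracket
    [seq (if b then (fun p => X p *m J p) else X) | b : bool <- w].

Definition commutes_at_order (J : V -> 'M[R]_m) (X : V -> V) (k : nat) (p : V)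
    : Prop :=
  forall w : seq bool, (2 <= size w <= k)%N -> word_bracket J X w p = 0.

(* A symmetric connection on R^m, through its Christoffel form Gamma:
   nabla_X Y = D_X Y + Gamma(X, Y). *)
Definition symmetric_connection (Gamma : V -> V -> V -> V) : Prop :=
  [/\ forall p u, linear (Gamma p u),
      forall p u v, Gamma p u v = Gamma p v u &
      forall u v, smooth (fun p => Gamma p u v)].

Definition nabla (Gamma : V -> V -> V -> V) (X Y : V -> V) : V -> V :=
  fun p => 'D_(X p) Y p + Gamma p (X p) (Y p).

Definition nabla_pow (Gamma : V -> V -> V -> V) (k : nat) (X Y : V -> V)
    : V -> V :=
  iter k (nabla Gamma X) Y.

End Geometry.

(* The source C of the discs is R * R, zeta = x + iy being (x, y). *)
Section Discs.
Context {R : realType} {m : nat}.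
Notation V := 'rV[R]_m.

Definition disc (eps : R) : set (R * R) :=
  [set z | z.1 ^+ 2 + z.2 ^+ 2 < eps ^+ 2].

Definition mul_i (v : R * R) : R * R := (- v.2, v.1).

Definition holomorphic_disc (J : V -> 'M[R]_m) (eps : R) (gamma : R * R -> V)
    : Prop :=
  forall z, disc eps z ->
    [/\ differentiable gamma z,
        forall v, {for z, continuous (fun z' => 'd gamma z' v)} &
        forall v, 'd gamma z (mul_i v) = 'd gamma z v *m J (gamma z)].

Definition dx (W : R * R -> V) : R * R -> V :=
  fun z => 'D_((1, 0) : R * R) W z.

(* Covariant derivative in the direction x of a vector field W along gamma *)
Definition cov_dx (Gamma : V -> V -> V -> V) (gamma W : R * R -> V)
    : R * R -> V :=
  fun z => dx W z + Gamma (gamma z) (dx gamma z) (W z).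

(* The k-th derivative of gamma in x, for k >= 1, taken with respect to the
   connection: this is what compares with nabla_X^(k-1) X. For the flat
   connection it is the ordinary k-th derivative (cov_partial_x_flat). *)
Definition cov_partial_x (Gamma : V -> V -> V -> V) (k : nat)
    (gamma : R * R -> V) : R * R -> V :=
  iter k.-1 (cov_dx Gamma gamma) (dx gamma).

Lemma cov_partial_x_flat (k : nat) (gamma : R * R -> V) : (0 < k)%N ->
  cov_partial_x (fun _ _ _ => 0) k gamma = iter k dx gamma.
Proof.
case: k => // k _; rewrite /cov_partial_x /=.
by elim: k => //= k ->; apply/funext => z; rewrite /cov_dx addr0.
Qed.

Definition x_smooth (eps : R) (gamma : R * R -> V) : Prop :=
  forall (k : nat) z, disc eps z ->
    derivable (iter k dx gamma) z ((1, 0) : R * R).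

End Discs.

(* Main.v *)
Require Import Defs.
From HB Require Import structures.
From mathcomp Require Import all_boot all_order all_algebra.
From mathcomp Require Import all_classical all_reals all_analysis.
From mathcomp Require Import ring lra zify.

(* Solving the Cauchy problem d_y gamma = J d_x gamma, d_x gamma = X(gamma) on the
   x-axis, with gamma(0) = 0, gives an analytic J-holomorphic disc whose
   covariant x-derivatives on the axis are those of X (the formal solution is
   majorized by the solution of F = al (x + K y) + be F^2). It remains to see
   that phi o gamma = 0; when X(0) = 0 one takes gamma = 0 instead.

   For every k there is a section Z = X + sum g_i e_i of L whose error
   d_x gamma - Z(gamma) vanishes at order k at 0. Indeed, given such a Z, the
   derivatives of F o gamma agree with the brackets of Z and JZ with F up to
   the error, whence Z commutes at order k at 0; the hypothesis then puts the
   next brackets in L_0, the k-jet of the error takes its values in L_0, and a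
   polynomial modification of the g_i removes it.

   As Z and JZ are tangent to M, |dphi(Z)| and |dphi(JZ)| are at most C |phi|
   near 0, so along a ray u(t) = phi(gamma(t z)) satisfies
   |u'| <= C |u| + O(t^k). Hence u = O(t^k) for all k, and u vanishes because it
   is the sum of a power series. *)

Set Implicit Arguments.
Unset Strict Implicit.
Unset Printing Implicit Defensive.

Import Order.TTheory GRing.Theory Num.Theory numFieldNormedType.Exports.
Local Open Scope classical_set_scope.
Local Open Scope ring_scope.

(** While the disc is being studied it is not known to lie in [M], whereas being a section of [L]
    means something only over [M]. All comparisons between the disc and [Z] are therefore made in
    the ambient space. [M] acts through the hypothesis at 0 and through the bound on |dphi(Z)|,
    which holds because dphi(Z) vanishes where phi does and dphi is not zero at 0.

    The link with brackets is that the error E = d_x gamma - Z(gamma) satisfies d_y E - J(0) d_x E =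
    [Z, JZ](gamma) up to order k. Orders of vanishing are measured by words of directional
    derivatives because these match words of brackets. A matrix killing [L 0] removes the right-hand
    side at the critical order, and the system stays closed because [L 0] is stable under J(0).

    Removing a jet in (x, y) by functions defined on the target requires X(0) and JX(0) to be
    independent; this is what the case X(0) = 0 lacks.

    The constants and the neighbourhoods depend on k, so the estimates alone never reach a fixed t >
    0: only the power series in t does. *)

Lemma cvg_bigsum (R : realType) (V : normedModType R) (T I : Type)
    (F : set_system T) (FF : Filter F) (r : seq I) (P : pred I)
    (f : I -> T -> V) (l : I -> V) :
  (forall i, P i -> f i @ F --> l i) ->
  (fun x => \sum_(i <- r | P i) f i x) @ F --> \sum_(i <- r | P i) l i.
Proof.
move=> fl; elim: r => [|i r IH].
  rewrite big_nil; under eq_fun do rewrite big_nil; exact: cvg_cst.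
rewrite big_cons; under eq_fun do rewrite big_cons.
by case: ifP => [Pi|//]; apply: cvgD => //; exact: fl.
Qed.

(** * Sums of power series *)

Section Seq.
Context {R : realType}.
Implicit Types (p q b : nat -> R).

Lemma bounded_series_cvg b (C : R) : (forall k, 0 <= b k) ->
  (forall N, series b N <= C) -> cvgn (series b).
Proof.
move=> b0 bC; apply: nondecreasing_is_cvgn.
  by apply: nondecreasing_series => n _ _; exact: b0.
by exists C => _ [N _ <-]; exact: bC.
Qed.

Lemma abs_series_cvg p b : (forall k, `|p k| <= b k) -> cvgn (series b) ->
  cvgn (series p).
Proof.
move=> pb cb; apply: normed_cvg; apply: series_le_cvg cb => //= n.
exact: le_trans (pb n).
Qed.

(** Dominated convergence when the number of terms grows with the parameter: past an index [K] the
    terms are controlled by the tail of [b] and the limit series by its own convergence, while the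
    finitely many terms before [K] converge one by one. It yields Cauchy products and, in
    [fcomp_eval], the substitution of series. *)
Lemma tannery (a : nat -> nat -> R) (A b : nat -> R) :
  (forall N k, `|a N k| <= b k) -> cvgn (series b) ->
  (forall k, a ^~ k @ \oo --> A k) ->
  cvgn (series A) /\
  (fun N => \sum_(0 <= k < N) a N k) @ \oo --> limn (series A).
Proof.
move=> ab cb aA.
have Ab k : `|A k| <= b k.
  have : (fun N => `|a N k|) @ \oo --> `|A k| by apply: cvg_norm; exact: aA.
  move=> /cvg_lim <- //; apply: limr_le; last by near=> N; exact: ab.
  by apply: is_cvg_norm; apply/cvg_ex; exists (A k); exact: aA.
have cA : cvgn (series A) by exact: abs_series_cvg Ab cb.
split=> //; apply/cvgrPdist_le => /= e e0.
have e4 : 0 < e / 4 by lra.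
have [M _ HM] : \forall M \near \oo, `|limn (series A) - series A M| <= e / 4.
  by move/cvgrPdist_le : cA; exact.
have /cauchy_cvgP/cauchy_seriesP/(_ _ e4) [[U V] /= [[P _ HP] [Q _ HQ]] HU] := cb.
pose K := maxn M (maxn P Q).
have tail N : (K <= N)%N -> \sum_(K <= k < N) b k <= e / 4.
  move=> KN; apply: (le_trans (ler_norm _)); apply: ltW.
  by apply: (HU (K, N)); split => /=; [apply: HP | apply: HQ];
    rewrite /= ?(leq_trans _ KN) // /K !leq_max leqnn ?orbT.
have head : \forall N \near \oo,
    `|\sum_(0 <= k < K) (A k - a N k)| <= e / 4.
  have : (fun N => \sum_(0 <= k < K) (A k - a N k)) @ \oo --> (0 : R).
    rewrite [X in _ --> X](_ : 0 = \sum_(0 <= k < K) (A k - A k)); last first.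
      by rewrite big1 // => k _; rewrite subrr.
    apply: cvg_bigsum => k _; apply: cvgB; [exact: cvg_cst|exact: aA].
  move=> /cvgrPdist_le/(_ _ e4); apply: filterS => N.
  by rewrite sub0r normrN.
near=> N.
have KN : (K <= N)%N by near: N; exists K.
have -> : limn (series A) - \sum_(0 <= k < N) a N k =
  (limn (series A) - series A K) + \sum_(0 <= k < K) (A k - a N k)
  - \sum_(K <= k < N) a N k.
  rewrite (big_cat_nat _ KN) //= /series /= sumrB; ring.
apply: (le_trans (ler_normB _ _)).
have h1 : `|limn (series A) - series A K| <= e / 4.
  by apply: HM; rewrite /= /K leq_max leqnn.
have h2 : `|\sum_(0 <= k < K) (A k - a N k)| <= e / 4 by near: N.
have h3 : `|\sum_(K <= k < N) a N k| <= e / 4.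
  apply: (le_trans (ler_norm_sum _ _ _)); apply: le_trans (tail N KN).
  by apply: ler_sum => k _; exact: ab.
have := ler_normD (limn (series A) - series A K)
  (\sum_(0 <= k < K) (A k - a N k)).
lra.
Unshelve. all: by end_near.
Qed.

Definition conv p q n : R := \sum_(l < n.+1) p l * q (n - l)%N.

(** Summation by columns of the triangle. The partial sums of [q] get shorter as [l] grows, which is
    the shape that [tannery] handles. *)
Lemma series_conv p q N :
  series (conv p q) N = \sum_(0 <= l < N) p l * series q (N - l)%N.
Proof.
elim: N => [|N IH]; first by rewrite /series /= !big_geq.
rewrite seriesSr IH [in RHS]big_nat_recr //= subSn // subnn.
rewrite /conv -(big_mkord xpredT (fun l => p l * q (N - l)%N)).
rewrite [X in _ + X]big_nat_recr //= subnn addrA; congr (_ + _).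
  rewrite -big_split /=; apply: eq_big_nat => l /andP[_ lN].
  by rewrite subSn ?(ltnW lN) // seriesSr mulrDr.
by rewrite /series /= big_nat1.
Qed.

Lemma abs_conv p q n :
  `|conv p q n| <= conv (fun k => `|p k|) (fun k => `|q k|) n.
Proof.
apply: (le_trans (ler_norm_sum _ _ _)); apply: ler_sum => l _.
by rewrite normrM.
Qed.

Lemma series_abs_conv p q (s t : R) N :
  (forall N, series (fun k => `|p k|) N <= s) ->
  (forall N, series (fun k => `|q k|) N <= t) ->
  series (fun k => `|conv p q k|) N <= s * t.
Proof.
move=> ps qt.
have t0 : 0 <= t by have := qt 0%N; rewrite /series /= big_geq.
apply: (@le_trans _ _ (series (conv (fun k => `|p k|) (fun k => `|q k|)) N)).
  by apply: ler_sum => l _; exact: abs_conv.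
rewrite series_conv; apply: (@le_trans _ _ (\sum_(0 <= l < N) `|p l| * t)).
  by apply: ler_sum => l _; apply: ler_wpM2l.
by rewrite -mulr_suml; apply: ler_wpM2r => //; exact: ps.
Qed.

Lemma cvg_conv p q (s t A B : R) :
  (forall N, series (fun k => `|p k|) N <= s) ->
  (forall N, series (fun k => `|q k|) N <= t) ->
  series p @ \oo --> A -> series q @ \oo --> B ->
  series (conv p q) @ \oo --> A * B.
Proof.
move=> ps qt pA qB.
have cp : cvgn (series (fun k => `|p k|)) by exact: bounded_series_cvg ps.
pose a N k := p k * series q (N - k)%N.
have [|||cA] := @tannery a (fun k => p k * B) (fun k => t *: `|p k|).
- move=> N k; rewrite /a normrM mulrC; apply: ler_wpM2r => //.
  by apply: le_trans (qt (N - k)%N); exact: ler_norm_sum.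
- have := @is_cvg_seriesZ _ _ t cp; congr (cvgn (series _)).
- move=> k; apply: cvgM; first exact: cvg_cst.
  by rewrite cvg_centern.
have -> : limn (series (fun k => p k * B)) = A * B.
  apply: cvg_lim => //.
  rewrite (_ : series _ = fun N => series p N * B); last first.
    by apply/funext => N; rewrite /series /= mulr_suml.
  by apply: cvgM => //; exact: cvg_cst.
apply: cvg_trans; apply: near_eq_cvg; near=> N.
by rewrite series_conv.
Unshelve. all: by end_near.
Qed.

End Seq.

Lemma quadratic_differentiable (R : realType) (W U : normedModType R)
    (f : W -> U) (L : {linear W -> U}) (x : W) (C d : R) : 0 < d ->
  (forall s, `|L s| <= C * `|s|) ->
  (forall s, `|s| < d -> `|f (x + s) - f x - L s| <= C * `|s| ^+ 2) ->
  differentiable f x /\ 'd f x = L :> (W -> U).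
Proof.
move=> d0 LC fC.
have Lc : continuous L.
  apply: bounded_linear_continuous; apply/linear_boundedP.
  exists C; split; first exact: num_real.
  move=> M CM y; apply: (le_trans (LC y)).
  by apply: ler_wpM2r => //; exact: ltW.
have E : f \o shift x = cst (f x) + L +o_ 0 id.
  apply/eqaddoP => e e0; near=> s.
  rewrite /= [X in `|X|](_ : _ = f (x + s) - f x - L s); last first.
    by rewrite !fctE /= opprD addrA [s + x]addrC.
  have sd : `|s| < d by near: s; apply: nbhs0_lt.
  apply: (le_trans (fC _ sd)); rewrite expr2 mulrA; apply: ler_wpM2r => //.
  have sC : `|s| <= e / (`|C| + 1).
    by near: s; apply: nbhs0_le; rewrite divr_gt0 // ltr_wpDl.
  apply: (@le_trans _ _ ((`|C| + 1) * (e / (`|C| + 1)))); last first.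
    by rewrite mulrCA divff ?mulr1 // gt_eqF // ltr_wpDl.
  apply: (@le_trans _ _ ((`|C| + 1) * `|s|)).
    by apply: ler_wpM2r => //; apply: (le_trans (ler_norm C)); rewrite lerDl.
  by apply: ler_wpM2l => //; rewrite addr_ge0.
have dE := diff_unique Lc E.
split=> //; apply/diff_locallyP; rewrite dE; split=> //.
Unshelve. all: by end_near. Qed.

(** * Homogeneous polynomials on a normed space *)

Section Hom.
Context {R : realType} {W : normedModType R}.

Definition unit_form (l : W -> R) : Prop :=
  (forall a u v, l (a *: u + v) = a * l u + l v) /\ forall h, `|l h| <= `|h|.

Lemma unit_form_diff (l : W -> R) x : unit_form l ->
  differentiable l x /\ forall v, 'D_v l x = l v.
Proof.
move=> [ll lb].
pose L : {linear W -> R} := HB.pack l (GRing.isLinear.Build R W R _ l ll).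
have [s|s _|df de] := @quadratic_differentiable R W R l L x 1 1 ltr01.
- by rewrite mul1r; exact: lb.
- have -> : l (x + s) = l x + l s by rewrite -[x]scale1r ll scale1r mul1r.
  by rewrite mul1r [l x + _]addrC addrK subrr normr0 exprn_ge0.
- by split=> // v; rewrite deriveE // de.
Qed.

(** Degree, bound on the sum of the absolute values of the coefficients, polynomial function.
    Generation by sums and products with linear forms of norm at most 1 makes every estimate an
    induction, valid both on row vectors and on [R * R]. *)
Inductive hom : nat -> R -> (W -> R) -> Prop :=
| HomC c : hom 0 `|c| (fun=> c)
| Hom0 k : hom k 0 (fun=> 0)
| HomL k N l f : unit_form l -> hom k N f -> hom k.+1 N (fun h => l h * f h)
| HomD k N N' f g : hom k N f -> hom k N' g -> hom k (N + N') (fun h => f h + g h)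
| HomW k N N' f : hom k N f -> N <= N' -> hom k N' f.

Lemma hom_ge0 k N f : hom k N f -> 0 <= N.
Proof. by elim=> // {}k *; [apply: addr_ge0|apply: le_trans; eassumption]. Qed.

Lemma hom_scale c k N f : hom k N f -> hom k (`|c| * N) (fun h => c * f h).
Proof.
elim=> {k N f} [d|k|k N l f ul _ IH|k N N' f g _ IH1 _ IH2|k N N' f _ IH NN'].
- by rewrite -normrM; exact: HomC.
- by rewrite mulr0; under eq_fun do rewrite mulr0; exact: Hom0.
- by under eq_fun do rewrite mulrCA; exact: HomL.
- by rewrite mulrDr; under eq_fun do rewrite mulrDr; exact: HomD.
- by apply: HomW IH _; exact: ler_wpM2l.
Qed.

Lemma hom_sum (I : Type) (r : seq I) k (N : I -> R) (f : I -> W -> R) :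
  (forall i, hom k (N i) (f i)) ->
  hom k (\sum_(i <- r) N i) (fun h => \sum_(i <- r) f i h).
Proof.
move=> H; elim: r => [|i r IH].
  by rewrite big_nil; under eq_fun do rewrite big_nil; exact: Hom0.
rewrite big_cons (_ : (fun h => _) = fun h => f i h + \sum_(j <- r) f j h).
  exact: HomD.
by apply/funext => h; rewrite big_cons.
Qed.

Lemma hom_diff k N f : hom k N f -> forall x, differentiable f x.
Proof.
elim=> {k N f} [d|k|k N l f ul _ IH|k N N' f g _ IH1 _ IH2|k N N' f _ IH NN'] x //.
- by apply: differentiableM; [have [] := unit_form_diff x ul|].
- exact: differentiableD.
Qed.

(** The second conjunct supplies what [k.-1] hides in degree 0: a constant has zero derivative, not
    merely a constant one. *)
Lemma hom_derive k N f v : hom k N f ->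
  hom k.-1 (k%:R * N * `|v|) ('D_v f) /\ (k = 0%N -> forall x, 'D_v f x = 0).
Proof.
elim=> {k N f} [d|k|k N l f ul Hf [IH IH0]|k N N' f g Hf [IH1 IH10] Hg [IH2 IH20]
    |k N N' f Hf [IH IH0] NN'].
- have -> : 'D_v (fun=> d) = (fun=> 0) :> (W -> R).
    by apply/funext => x; rewrite derive_cst.
  by rewrite mul0r mul0r; split; [exact: Hom0|move=> _ x; exact: derive_cst].
- have -> : 'D_v (fun=> 0) = (fun=> 0) :> (W -> R).
    by apply/funext => x; rewrite derive_cst.
  by rewrite mulr0 mul0r; split; [exact: Hom0|move=> _ x; exact: derive_cst].
- split=> //=; have -> : 'D_v (fun h => l h * f h) =
      (fun h => l v * f h + l h * 'D_v f h).
    apply/funext => x; have [dl Dl] := unit_form_diff x ul.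
    rewrite (_ : (fun h => l h * f h) = l * f) // deriveM; last first.
      exact/diff_derivable/(hom_diff Hf).
      exact/diff_derivable.
    by rewrite Dl addrC mulrC.
  have -> : k.+1%:R * N * `|v| = `|v| * N + k%:R * N * `|v|.
    by rewrite -natr1; ring.
  apply: HomD.
    apply: HomW (hom_scale (l v) Hf) _; apply: ler_wpM2r; first exact: hom_ge0 Hf.
    by case: ul.
  case: k Hf IH IH0 => [|k] Hf IH IH0; last exact: HomL.
  rewrite !mul0r; under eq_fun do rewrite IH0 // mulr0.
  exact: Hom0.
- have E : 'D_v (fun h => f h + g h) = (fun h => 'D_v f h + 'D_v g h).
    apply/funext => x; rewrite (_ : (fun h => f h + g h) = f + g) // deriveD //.
      exact/diff_derivable/(hom_diff Hf).
    exact/diff_derivable/(hom_diff Hg).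
  split; last first.
    move=> k0 x; have /= -> := congr1 (fun F => F x) E.
    by rewrite IH10 // IH20 // addr0.
  rewrite E.
  by rewrite mulrDr mulrDl; exact: HomD.
- split=> //; apply: HomW IH _.
  by apply: ler_wpM2r => //; apply: ler_wpM2l.
Qed.

Lemma hom_bound k N f (rho : R) h : hom k N f -> `|h| <= rho ->
  `|f h| <= N * rho ^+ k.
Proof.
move=> H hr; have rho0 : 0 <= rho by exact: le_trans hr.
elim: H => {k N f} [d|k|k N l f ul Hf IH|k N N' f g _ IH1 _ IH2|k N N' f _ IH NN'].
- by rewrite mulr1.
- by rewrite normr0 mul0r.
- rewrite normrM exprS mulrCA; apply: ler_pM => //.
  by apply: le_trans hr; case: ul.
- by rewrite mulrDl; apply: (le_trans (ler_normD _ _)); exact: lerD.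
- by apply: (le_trans IH); apply: ler_wpM2r => //; exact: exprn_ge0.
Qed.

(** The factor [rho] on the left keeps the exponent [k] on the right and avoids a truncated [k - 1];
    [rho ^+ 2] does the same at second order. *)
Lemma hom_rem1 k N f (rho : R) h s : hom k N f -> `|h| <= rho ->
  `|h + s| <= rho -> rho * `|f (h + s) - f h| <= k%:R * N * rho ^+ k * `|s|.
Proof.
move=> H hr hsr; have rho0 : 0 <= rho by exact: le_trans hr.
elim: H => {k N f} [d|k|k N l f ul Hf IH|k N N' f g _ IH1 _ IH2|k N N' f _ IH NN'].
- by rewrite subrr normr0 mulr0 !mul0r.
- by rewrite subrr normr0 !mulr0 !mul0r.
- have -> : l (h + s) * f (h + s) - l h * f h =
      l (h + s) * (f (h + s) - f h) + l s * f h.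
    have -> : l (h + s) = l h + l s.
      by case: ul => ll _; rewrite -[h]scale1r ll scale1r mul1r.
    ring.
  apply: (le_trans (ler_wpM2l rho0 (ler_normD _ _))); rewrite mulrDr !normrM.
  have -> : k.+1%:R * N * rho ^+ k.+1 * `|s| =
      rho * (k%:R * N * rho ^+ k * `|s|) + rho * (`|s| * (N * rho ^+ k)).
    by rewrite -natr1 exprS; ring.
  apply: lerD.
    rewrite mulrCA; apply: ler_pM => //; first by rewrite mulr_ge0.
    by apply: le_trans hsr; case: ul.
  apply: ler_wpM2l => //; apply: ler_pM => //; first by case: ul.
  exact: hom_bound Hf hr.
- rewrite opprD addrACA; apply: (le_trans (ler_wpM2l rho0 (ler_normD _ _))).
  by rewrite !mulrDr !mulrDl; exact: lerD.
- apply: (le_trans IH); apply: ler_wpM2r => //; apply: ler_wpM2r.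
    exact: exprn_ge0.
  exact: ler_wpM2l.
Qed.

Lemma hom_rem2 k N f (rho : R) h s : hom k N f -> `|h| <= rho ->
  `|h + s| <= rho ->
  rho ^+ 2 * `|f (h + s) - f h - 'D_s f h| <=
    k%:R ^+ 2 * N * rho ^+ k * `|s| ^+ 2.
Proof.
move=> H hr hsr; have rho0 : 0 <= rho by exact: le_trans hr.
elim: H => {k N f} [d|k|k N l f ul Hf IH|k N N' f g Hf IH1 Hg IH2|k N N' f _ IH NN'].
- by rewrite derive_cst subrr subr0 normr0 mulr0 expr0n !mul0r.
- by rewrite derive_cst subrr subr0 normr0 !mulr0 !mul0r.
- have [dl Dl] := unit_form_diff h ul.
  rewrite (_ : (fun h => l h * f h) = l * f) // deriveM; last first.
    exact/diff_derivable/(hom_diff Hf).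
    exact/diff_derivable.
  rewrite Dl -[X in `|X|]/(l (h + s) * f (h + s) - l h * f h - (l h * 'D_s f h + f h * l s)).
  have -> : l (h + s) = l h + l s.
    by case: ul => ll _; rewrite -[h]scale1r ll scale1r mul1r.
  have -> : (l h + l s) * f (h + s) - l h * f h - (l h * 'D_s f h + f h * l s) =
      l h * (f (h + s) - f h - 'D_s f h) + l s * (f (h + s) - f h).
    ring.
  have r20 : 0 <= rho ^+ 2 by rewrite exprn_ge0.
  apply: (le_trans (ler_wpM2l r20 (ler_normD _ _))); rewrite mulrDr !normrM.
  apply: (@le_trans _ _ (rho * (k%:R ^+ 2 * N * rho ^+ k * `|s| ^+ 2)
     + (rho * `|s|) * (k%:R * N * rho ^+ k * `|s|))).
    apply: lerD.
      rewrite mulrCA; apply: ler_pM => //; first by rewrite mulr_ge0.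
      by apply: le_trans hr; case: ul.
    rewrite expr2 [X in X <= _](_ : _ =
      (rho * `|l s|) * (rho * `|f (h + s) - f h|)); last by ring.
    apply: ler_pM; rewrite ?mulr_ge0 //; last exact: hom_rem1 Hf hr hsr.
    by apply: ler_wpM2l => //; case: ul.
  (* The slack in the induction is (k + 1)^2 - k^2 - k = k + 1. *)
  rewrite -subr_ge0.
  rewrite [X in 0 <= X](_ : _ = k.+1%:R * N * rho ^+ k.+1 * `|s| ^+ 2); last first.
    by rewrite -natr1 [rho ^+ k.+1]exprS; ring.
  by rewrite !mulr_ge0 ?exprn_ge0 //; exact: hom_ge0 Hf.
- rewrite (_ : (fun h => f h + g h) = f + g) // deriveD; last first.
    exact/diff_derivable/(hom_diff Hg).
    exact/diff_derivable/(hom_diff Hf).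
  rewrite -[X in `|X|]/(f (h + s) + g (h + s) - (f h + g h) - ('D_s f h + 'D_s g h)).
  rewrite [X in `|X|](_ : _ = (f (h + s) - f h - 'D_s f h)
     + (g (h + s) - g h - 'D_s g h)); last by ring.
  have r20 : 0 <= rho ^+ 2 by rewrite exprn_ge0.
  apply: (le_trans (ler_wpM2l r20 (ler_normD _ _))).
  by rewrite !mulrDr !mulrDl; exact: lerD.
- apply: (le_trans IH); apply: ler_wpM2r => //; rewrite ?exprn_ge0 //.
  by apply: ler_wpM2r; rewrite ?exprn_ge0 //; apply: ler_wpM2l; rewrite ?exprn_ge0.
Qed.

End Hom.

Lemma cvg_norm_le (R : realType) (u : nat -> R) (l C : R) :
  u @ \oo --> l -> (forall n, `|u n| <= C) -> `|l| <= C.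
Proof.
move=> ul uC; have : (fun n => `|u n|) @ \oo --> `|l| by exact: cvg_norm.
move=> /[dup] H /cvg_lim <- //; apply: limr_le; last by near=> n; exact: uC.
by apply/cvg_ex; exists `|l|.
Unshelve. all: by end_near. Qed.

(** * Termwise differentiation of power series *)

Section PowerSeries.
Context {R : realType}.
Implicit Types (N : nat -> R) (r rho : R).

(** Boundedness at every smaller radius, in the manner of Cauchy and Hadamard. It is easier to
    transport than summability and implies it after a slight loss of radius ([radius_ge_series]). *)
Definition radius_ge N r : Prop :=
  forall rho, 0 < rho < r -> exists C, forall k, N k * rho ^+ k <= C.

Lemma natr_expr_le (q : R) k : 0 < q < 1 -> k%:R * q ^+ k <= (1 - q)^-1.
Proof.
move=> /andP[q0 q1]; rewrite -[leRHS]mul1r ler_pdivlMr ?subr_gt0 //.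
(* This form is inductive: it says that k q^k is at most 1 + q + ... + q^(k-1), each term of which
   is at least q^k. *)
suff: k%:R * q ^+ k * (1 - q) <= 1 - q ^+ k.
  by move=> /le_trans; apply; rewrite gerBl exprn_ge0 // ltW.
elim: k => [|k IH]; first by rewrite !mul0r expr0 subrr.
have qk : 0 <= q ^+ k.+1 <= 1.
  by rewrite exprn_ge0 ?(ltW q0) // exprn_ile1 // ltW.
have : q * (k%:R * q ^+ k * (1 - q)) <= q * (1 - q ^+ k).
  by apply: ler_wpM2l => //; exact: ltW.
have -> : k.+1%:R * q ^+ k.+1 * (1 - q) =
  q * (k%:R * q ^+ k * (1 - q)) + q ^+ k.+1 * (1 - q).
  by rewrite -natr1 exprS; ring.
rewrite [q * (1 - q ^+ k)]mulrBr -exprS mulr1.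
have : 0 <= (1 - q) * (1 - q ^+ k.+1).
  by rewrite mulr_ge0 // subr_ge0; [exact: ltW|case/andP: qk].
lra.
Qed.

(** Pass from [rho] to the midpoint [rho'] of [rho] and [r]: the factor k is absorbed by the
    geometric decay of [(rho / rho') ^+ k]. *)
Lemma radius_geM N r : (forall k, 0 <= N k) -> radius_ge N r ->
  radius_ge (fun k => k%:R * N k) r.
Proof.
move=> N0 H rho /andP[rho0 rhor]; pose rho' := (rho + r) / 2.
have rr' : rho < rho' by rewrite /rho'; lra.
have r'r : rho' < r by rewrite /rho'; lra.
have r'0 : 0 < rho' by lra.
have [C HC] := H rho' (introT andP (conj r'0 r'r)).
have q01 : 0 < rho / rho' < 1 by rewrite divr_gt0 //= ltr_pdivrMr // mul1r.
exists ((1 - rho / rho')^-1 * C) => k.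
have -> : k%:R * N k * rho ^+ k = (k%:R * (rho / rho') ^+ k) * (N k * rho' ^+ k).
  by rewrite expr_div_n; field; rewrite expf_neq0 // gt_eqF.
apply: ler_pM.
- by rewrite mulr_ge0 // exprn_ge0 // divr_ge0 // ltW.
- by rewrite mulr_ge0 // exprn_ge0 // ltW.
- exact: natr_expr_le.
- exact: HC.
Qed.

Lemma radius_ge_series N r rho : (forall k, 0 <= N k) -> radius_ge N r ->
  0 < rho < r -> exists2 C, 0 <= C & forall n, series (fun k => N k * rho ^+ k) n <= C.
Proof.
move=> N0 H /andP[rho0 rhor]; pose rho' := (rho + r) / 2.
have rr' : rho < rho' by rewrite /rho'; lra.
have r'r : rho' < r by rewrite /rho'; lra.
have r'0 : 0 < rho' by lra.
have [C HC] := H rho' (introT andP (conj r'0 r'r)).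
have C0 : 0 <= C by apply: le_trans (HC 0%N); rewrite expr0 mulr1.
have q0 : 0 <= rho / rho' by rewrite divr_ge0 // ltW.
have q1 : rho / rho' < 1 by rewrite ltr_pdivrMr // mul1r.
exists (C / (1 - rho / rho')) => [|n].
  by rewrite divr_ge0 // subr_ge0 ltW.
apply: (@le_trans _ _ (series (geometric C (rho / rho')) n)).
  apply: ler_sum => k _; rewrite /geometric /= expr_div_n mulrA.
  rewrite ler_pdivlMr ?exprn_gt0 // mulrAC; apply: ler_wpM2r => //.
  by rewrite exprn_ge0 // ltW.
rewrite geometric_seriesE; last by rewrite lt_eqF.
rewrite ler_pdivlMr ?subr_gt0 // divfK ?gt_eqF ?subr_gt0 //.
by rewrite ler_piMr // gerBl exprn_ge0.
Qed.

Context {W : normedModType R}.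
Implicit Types (F : nat -> W -> R) (f : W -> R).

Definition power_series F N r f : Prop :=
  [/\ forall k, hom k (N k) (F k), radius_ge N r &
      forall h, `|h| < r -> series (F ^~ h) @ \oo --> f h].

(** At a radius [rho] strictly between |h| and r, the termwise derivatives are bounded by k N_k
    rho^k and the termwise quadratic remainders by k^2 N_k rho^k. Both series have bounded sums, so
    the sum of the derivatives is a differential by [quadratic_differentiable]. *)
Lemma power_series_diff F N r f h : power_series F N r f -> `|h| < r ->
  differentiable f h /\
  forall v, series (fun k => 'D_v (F k) h) @ \oo --> 'D_v f h.
Proof.
move=> [hF HN Ff] hr.
pose rho := (`|h| + r) / 2.
have hrho : `|h| < rho by rewrite /rho; lra.
have rhor : rho < r by rewrite /rho; lra.
have rho0 : 0 < rho by exact: le_lt_trans hrho.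
have N0 k : 0 <= N k by exact: hom_ge0 (hF k).
have N10 k : 0 <= k%:R * N k by rewrite mulr_ge0.
have N20 k : 0 <= k%:R * (k%:R * N k) by rewrite mulr_ge0.
have rr : 0 < rho < r by rewrite rho0.
have H1 := radius_geM N0 HN; have H2 := radius_geM N10 H1.
have [C1 C10 HC1] := radius_ge_series N10 H1 rr.
have [C2 C20 HC2] := radius_ge_series N20 H2 rr.
have Db s k : `|'D_s (F k) h| <= k%:R * N k * rho ^+ k * (`|s| / rho).
  have [Hd Hd0] := hom_derive s (hF k).
  case: k Hd Hd0 => [|k] Hd Hd0; first by rewrite Hd0 // normr0 !mul0r.
  apply: (le_trans (hom_bound Hd (ltW hrho))) => /=.
  rewrite exprS [leRHS](_ : _ = k.+1%:R * N k.+1 * `|s| * rho ^+ k) //.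
  by field; rewrite gt_eqF.
have partial s n : series (fun k => `|'D_s (F k) h|) n <= C1 / rho * `|s|.
  apply: (@le_trans _ _ (series (fun k => k%:R * N k * rho ^+ k) n * (`|s| / rho))).
    by rewrite /series /= mulr_suml; apply: ler_sum => k _; exact: Db.
  rewrite mulrAC -mulrA ler_wpM2r //.
  by rewrite divr_ge0 // ltW.
have cD s : cvgn (series (fun k => 'D_s (F k) h)).
  apply: (@abs_series_cvg _ _ (fun k => `|'D_s (F k) h|)) => //.
  exact: bounded_series_cvg (partial s).
pose l s := limn (series (fun k => 'D_s (F k) h)).
have ll : forall a u v, l (a *: u + v) = a * l u + l v.
  move=> a u v; apply: cvg_lim => //.
  rewrite (_ : series _ = fun n => a * series (fun k => 'D_u (F k) h) n
                                   + series (fun k => 'D_v (F k) h) n).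
    apply: cvgD; last exact: cD.
    by apply: cvgM; [exact: cvg_cst|exact: cD].
  apply/funext => n; rewrite /series /= mulr_sumr -big_split /=.
  apply: eq_bigr => k _; have dF := hom_diff (hF k) h.
  by rewrite !deriveE // linearD linearZ.
pose L : {linear W -> R} := HB.pack l (GRing.isLinear.Build R W R _ l ll).
have lb s : `|l s| <= C1 / rho * `|s|.
  apply: cvg_norm_le (cD s) _ => n; apply: le_trans (partial s n).
  exact: ler_norm_sum.
pose C := Num.max (C1 / rho) (C2 / rho ^+ 2).
have d0 : 0 < rho - `|h| by rewrite subr_gt0.
have [s|s sd|df de] := @quadratic_differentiable R W R f L h C (rho - `|h|) d0.
- by apply: (le_trans (lb s)); apply: ler_wpM2r => //; rewrite le_max lexx.
- apply: (@le_trans _ _ (C2 / rho ^+ 2 * `|s| ^+ 2)); last first.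
    by apply: ler_wpM2r; rewrite ?exprn_ge0 // le_max lexx orbT.
  have hsrho : `|h + s| <= rho by apply: (le_trans (ler_normD _ _)); lra.
  have : (fun n => series (F ^~ (h + s)) n - series (F ^~ h) n
      - series (fun k => 'D_s (F k) h) n) @ \oo --> f (h + s) - f h - l s.
    apply: cvgB; last exact: cD.
    by apply: cvgB; apply: Ff => //; exact: le_lt_trans rhor.
  move=> /cvg_norm_le; apply=> n; rewrite /series /= -!sumrB.
  apply: (le_trans (ler_norm_sum _ _ _)).
  apply: (@le_trans _ _ (series (fun k => k%:R * (k%:R * N k) * rho ^+ k) n *
     (`|s| ^+ 2 / rho ^+ 2))).
    rewrite /series /= mulr_suml; apply: ler_sum => k _.
    rewrite [leRHS]mulrA ler_pdivlMr ?exprn_gt0 // mulrC.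
    rewrite [leRHS](_ : _ = k%:R ^+ 2 * N k * rho ^+ k * `|s| ^+ 2); last by ring.
    by apply: (hom_rem2 (hF k)) => //; exact: ltW.
  rewrite [leRHS](_ : _ = C2 * (`|s| ^+ 2 / rho ^+ 2)); last by ring.
  rewrite ler_wpM2r //.
  by rewrite divr_ge0 // exprn_ge0 // ltW.
- by split=> // v; rewrite deriveE // de; exact: cD.
Qed.

Lemma power_series_derive F N r f v : power_series F N r f ->
  power_series (fun k => 'D_v (F k.+1)) (fun k => k.+1%:R * N k.+1 * `|v|) r
    ('D_v f).
Proof.
move=> /[dup] H [hF HN Ff]; split.
- by move=> k; have [] := hom_derive v (hF k.+1).
- have N0 k : 0 <= N k by exact: hom_ge0 (hF k).
  move=> rho /[dup] rr /andP[rho0 _]; have [C HC] := radius_geM N0 HN rr.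
  exists (C / rho * `|v|) => k; rewrite mulrAC; apply: ler_wpM2r => //.
  by rewrite ler_pdivlMr // -mulrA -exprSr.
- move=> h hr; have [_ /(_ v)] := power_series_diff H hr.
  rewrite -cvg_shiftS; apply: cvg_trans; apply: near_eq_cvg; near=> n.
  rewrite /series /= big_nat_recl //=.
  by have [_ ->] := hom_derive v (hF 0%N); rewrite ?add0r.
Unshelve. all: by end_near. Qed.

End PowerSeries.

Section ScaleDiff.
Context {R : realType} {U : normedModType R}.

Lemma scaler_is_bilinear : bilinear_for
  (GRing.Scale.Law.clone _ _ *:%R _) (GRing.Scale.Law.clone _ _ *:%R _)
  (@GRing.scale R U : R -> U -> U).
Proof.
split=> [u'|u] a x y /=.
- by rewrite scalerDl scalerA.
- by rewrite scalerDr !scalerA mulrC.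
Qed.

HB.instance Definition _ := bilinear_isBilinear.Build R R U U _ _
  (@GRing.scale R U : R -> U -> U) scaler_is_bilinear.

Context {W : normedModType R}.

Lemma differentiable_scale (a : W -> R) (g : W -> U) x :
  differentiable a x -> differentiable g x ->
  differentiable (fun p => a p *: g p) x /\
  'd (fun p => a p *: g p) x = (fun v => a x *: 'd g x v + 'd a x v *: g x)
    :> (W -> U).
Proof.
move=> da dg.
have sc : continuous (fun p : R * U => p.1 *: p.2).
  by move=> p; apply: cvgZ; [exact: cvg_fst|exact: cvg_snd].
have dp := differentiable_pair da dg.
pose B : {bilinear R -> U -> U} := (@GRing.scale R U : R -> U -> U).
have db := @differentiable_bilin R R U U B (a x, g x) sc.
split; first exact: (differentiable_comp dp db).
have := diff_comp dp db.
rewrite (@diff_bilin R R U U B) // diff_pair //.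
Qed.

End ScaleDiff.

(** Regularity is expressed with the operators ['D_v], which also measure orders of vanishing and
    make up the brackets. Differentiability is demanded at every stage, so that each ['D_v] is
    linear in [v]. *)
Fixpoint Cn {R : realType} {W U : normedModType R} (n : nat) (O : set W) (f : W -> U) : Prop :=
  (forall p, O p -> differentiable f p) /\
  if n is n'.+1 then forall v, Cn n' O ('D_v f) else True.

(** * Smooth functions on an open set *)

Section Cn.
Context {R : realType}.
Implicit Types W U : normedModType R.

Lemma CnS W U n (O : set W) (f : W -> U) : Cn n.+1 O f ->
  (forall p, O p -> differentiable f p) /\ forall v, Cn n O ('D_v f).
Proof. by []. Qed.

Definition smooth_on W U (O : set W) (f : W -> U) := forall n, Cn n O f.

Lemma smooth_onP W U (O : set W) (f : W -> U) : smooth_on O f <->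
  (forall p, O p -> differentiable f p) /\ forall v, smooth_on O ('D_v f).
Proof.
split=> [H|[H1 H2] [|n]].
  by split=> [|v n]; [have [] := H 0%N|have [_ /(_ v)] := H n.+1].
- by split.
- by split=> // v; exact: H2.
Qed.

Lemma smooth_on_diff W U (O : set W) (f : W -> U) p :
  smooth_on O f -> O p -> differentiable f p.
Proof. by move/smooth_onP => [H _]; exact: H. Qed.

Lemma smooth_on_derive W U (O : set W) (f : W -> U) v :
  smooth_on O f -> smooth_on O ('D_v f).
Proof. by move/smooth_onP => [_]. Qed.

Lemma Cn_sub W U n (O O' : set W) (f : W -> U) : O' `<=` O ->
  Cn n O f -> Cn n O' f.
Proof.
move=> OO'; elim: n f => [|n IH] f /= [df H]; split=> //.
- by move=> p Op; apply/df/OO'.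
- by move=> p Op; apply/df/OO'.
- by move=> v; apply: IH.
Qed.

Lemma derive_eq_on W U (O : set W) (f g : W -> U) v p : open O ->
  (forall p, O p -> f p = g p) -> O p -> 'D_v f p = 'D_v g p.
Proof.
move=> oO fg Op; apply: near_eq_derive.
by apply: (filterS fg); exact: open_nbhs_nbhs.
Qed.

Lemma differentiable_eq_on W U (O : set W) (f g : W -> U) p : open O ->
  (forall p, O p -> f p = g p) -> O p -> differentiable f p ->
  differentiable g p.
Proof.
move=> oO fg Op df.
have nO : \forall h \near (0 : W), O (h + p).
  have : \forall q \near p, O q by exact: open_nbhs_nbhs.
  by rewrite (near_shift 0) /= subr0.
have E : g \o shift p = cst (g p) + 'd f p +o_ 0 id.
  have /diff_locally/eqaddoP H := df.
  apply/eqaddoP => e e0; have := H e e0.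
  by apply: filterS2 nO => h Oh; rewrite !fctE /= -!fg.
have dc : continuous ('d f p) by exact: diff_continuous.
have dE := diff_unique dc E.
by apply/diff_locallyP; rewrite dE.
Qed.

Lemma Cn_eq W U n (O : set W) (f g : W -> U) : open O ->
  (forall p, O p -> f p = g p) -> Cn n O f -> Cn n O g.
Proof.
move=> oO; elim: n f g => [|n IH] f g fg /= [df H]; split=> //.
- by move=> p Op; apply: differentiable_eq_on fg Op (df p Op).
- by move=> p Op; apply: differentiable_eq_on fg Op (df p Op).
- by move=> v; apply: IH (H v) => p Op; exact: derive_eq_on fg Op.
Qed.

Lemma Cn_leS W U n (O : set W) (f : W -> U) : Cn n.+1 O f -> Cn n O f.
Proof.
elim: n f => [|n IH] f [df H]; first by split.
by split=> // v; exact: IH.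
Qed.

Lemma Cn_cst W U n (O : set W) (c : U) : Cn n O (fun=> c).
Proof.
elim: n c => [|n IH] c; split=> // v.
by rewrite (_ : 'D_v _ = fun=> 0) //; apply/funext => x; exact: derive_cst.
Qed.

Lemma Cn_add W U n (O : set W) (f g : W -> U) : open O ->
  Cn n O f -> Cn n O g -> Cn n O (fun p => f p + g p).
Proof.
move=> oO; elim: n f g => [|n IH] f g [df Hf] [dg Hg].
  by split=> // p Op; apply: differentiableD; [exact: df|exact: dg].
split=> [p Op|v]; first by apply: differentiableD; [exact: df|exact: dg].
apply: Cn_eq (IH _ _ (Hf v) (Hg v)) => // p Op.
by rewrite (_ : (fun p => _) = f + g) // deriveD //; apply: diff_derivable; [exact: df|exact: dg].
Qed.

Lemma Cn_sum W U n (O : set W) (I : Type) (r : seq I) (f : I -> W -> U) : open O ->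
  (forall i, Cn n O (f i)) -> Cn n O (fun p => \sum_(i <- r) f i p).
Proof.
move=> oO H; elim: r => [|i r IH].
  by rewrite (_ : (fun p => _) = fun=> 0);
    [exact: Cn_cst|apply/funext => p; rewrite big_nil].
rewrite (_ : (fun p => _) = fun p => f i p + \sum_(j <- r) f j p).
  exact: Cn_add.
by apply/funext => p; rewrite big_cons.
Qed.

Lemma derive_linear W U U' (l : {linear U -> U'}) (f : W -> U) x v :
  continuous l -> differentiable f x ->
  differentiable (fun p => l (f p)) x /\ 'D_v (fun p => l (f p)) x = l ('D_v f x).
Proof.
move=> lc df; have dl : differentiable l (f x) by exact: linear_differentiable.
have dc : differentiable (l \o f) x by exact: differentiable_comp.
split=> //; rewrite [LHS](@deriveE _ _ _ (l \o f)) // diff_comp // diff_lin //=.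
by rewrite deriveE.
Qed.

Lemma Cn_linear W U U' n (O : set W) (l : {linear U -> U'}) (f : W -> U) :
  open O -> continuous l -> Cn n O f -> Cn n O (fun p => l (f p)).
Proof.
move=> oO lc; elim: n f => [|n IH] f [df Hf]; split=> //.
- by move=> p Op; have [] := derive_linear 0 lc (df p Op).
- by move=> p Op; have [] := derive_linear 0 lc (df p Op).
- move=> v; apply: Cn_eq (IH _ (Hf v)) => // p Op.
  by have [_ ->] := derive_linear v lc (df p Op).
Qed.

Lemma Cn_scale W U n (O : set W) (a : W -> R) (g : W -> U) : open O ->
  Cn n O a -> Cn n O g -> Cn n O (fun p => a p *: g p).
Proof.
move=> oO; elim: n a g => [|n IH] a g Ha Hg.
  case: Ha => da _; case: Hg => dg _.
  by split=> // p Op; have [] := differentiable_scale (da p Op) (dg p Op).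
have [da Da] := Ha; have [dg Dg] := CnS Hg.
split=> [p Op|v]; first by have [] := differentiable_scale (da p Op) (dg p Op).
have H := Cn_add oO (IH _ _ (Cn_leS Ha) (Dg v)) (IH _ _ (Da v) (Cn_leS Hg)).
apply: Cn_eq H => // p Op.
have [ds dE] := differentiable_scale (da p Op) (dg p Op).
by rewrite [RHS]deriveE // dE !deriveE //; [exact: da|exact: dg].
Qed.

Lemma Cn_id W n (O : set W) : Cn n O (fun p : W => p).
Proof.
case: n => [|n]; split=> // v.
rewrite (_ : 'D_v _ = fun=> v); first exact: Cn_cst.
by apply/funext => x; rewrite derive_id.
Qed.

End Cn.

Section RowVectors.
Context {R : realType}.
Implicit Types W U : normedModType R.

Definition crd m (j : 'I_m) (v : 'rV[R]_m) : R := v ord0 j.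

Lemma crd_is_linear m (j : 'I_m) : linear (@crd m j).
Proof. by move=> a u v; rewrite /crd !mxE. Qed.

HB.instance Definition _ m (j : 'I_m) :=
  GRing.isLinear.Build R 'rV[R]_m R _ (@crd m j) (@crd_is_linear m j).

Lemma crd_continuous m (j : 'I_m) : continuous (@crd m j).
Proof. exact: coord_continuous. Qed.

Lemma linear_rV_continuous m U (l : {linear 'rV[R]_m -> U}) : continuous l.
Proof.
move=> x; have lE v : l v = \sum_(j < m) v ord0 j *: l (delta_mx ord0 j).
  by rewrite {1}[v]row_sum_delta linear_sum; apply: eq_bigr => j _; rewrite linearZ.
pose F (v : 'rV[R]_m) := \sum_(j < m) v ord0 j *: l (delta_mx ord0 j).
have lF : (l : _ -> _) = F by apply/funext.
rewrite /continuous_at lF.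
have H := @cvg_bigsum R U 'rV[R]_m 'I_m (nbhs x) (nbhs_filter x)
  (index_enum 'I_m) xpredT (fun j v => v ord0 j *: l (delta_mx ord0 j))
  (fun j => x ord0 j *: l (delta_mx ord0 j)).
apply: H => j _; apply: cvgZ; last exact: cvg_cst.
exact: coord_continuous.
Qed.

(** In coordinates of the target the derivative of the composite is a sum of products of a
    coordinate of ['D_v f] with ['D_(delta_mx ord0 j) g] taken along [f]. These are of the same kind
    with one derivative less, so the induction closes. *)
Lemma Cn_comp W U m n (O : set W) (O' : set 'rV[R]_m) (f : W -> 'rV[R]_m)
    (g : 'rV[R]_m -> U) : open O -> (forall p, O p -> O' (f p)) ->
  Cn n O f -> Cn n O' g -> Cn n O (fun p => g (f p)).
Proof.
move=> oO fO; elim: n f g fO => [|n IH] f g fO Hf Hg.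
  case: Hf => df _; case: Hg => dg _.
  by split=> // p Op; apply: differentiable_comp; [exact: df|exact/dg/fO].
have [df Df] := Hf; have [dg Dg] := CnS Hg.
split=> [p Op|v].
  by apply: differentiable_comp; [exact: df|exact/dg/fO].
have H j : Cn n O (fun p => crd j ('D_v f p) *: 'D_(delta_mx ord0 j) g (f p)).
  apply: Cn_scale => //.
    by apply: Cn_linear => //; [exact: crd_continuous|exact: Df].
  exact: (IH f ('D_(delta_mx ord0 j) g) fO (Cn_leS Hf) (Dg _)).
apply: Cn_eq (Cn_sum (index_enum 'I_m) oO H) => // p Op.
have dfp := df p Op; have dgp := dg _ (fO p Op).
rewrite [RHS]deriveE; last exact: differentiable_comp.
rewrite diff_comp //= -(deriveE _ dfp) [X in 'd g (f p) X]row_sum_delta linear_sum.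
by apply: eq_bigr => j _; rewrite linearZ (deriveE _ dgp) /crd ord1.
Qed.

End RowVectors.

Section Smooth.
Context {R : realType}.
Implicit Types W U : normedModType R.

Lemma smooth_on_sub W U (O O' : set W) (f : W -> U) : O' `<=` O ->
  smooth_on O f -> smooth_on O' f.
Proof. by move=> OO' H n; exact: Cn_sub (H n). Qed.

Lemma smooth_on_eq W U (O : set W) (f g : W -> U) : open O ->
  (forall p, O p -> f p = g p) -> smooth_on O f -> smooth_on O g.
Proof. by move=> oO fg H n; exact: Cn_eq (H n). Qed.

Lemma smooth_on_cst W U (O : set W) (c : U) : smooth_on O (fun=> c).
Proof. by move=> n; exact: Cn_cst. Qed.

Lemma smooth_on_id W (O : set W) : smooth_on O (fun p : W => p).
Proof. by move=> n; exact: Cn_id. Qed.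

Lemma smooth_on_add W U (O : set W) (f g : W -> U) : open O ->
  smooth_on O f -> smooth_on O g -> smooth_on O (fun p => f p + g p).
Proof. by move=> oO Hf Hg n; exact: Cn_add. Qed.

Lemma smooth_on_sum W U (O : set W) (I : Type) (r : seq I) (f : I -> W -> U) :
  open O -> (forall i, smooth_on O (f i)) ->
  smooth_on O (fun p => \sum_(i <- r) f i p).
Proof. by move=> oO H n; apply: Cn_sum => // i; exact: H. Qed.

Lemma smooth_on_linear W U U' (O : set W) (l : {linear U -> U'}) (f : W -> U) :
  open O -> continuous l -> smooth_on O f -> smooth_on O (fun p => l (f p)).
Proof. by move=> oO lc H n; apply: Cn_linear. Qed.

Lemma smooth_on_scale W U (O : set W) (a : W -> R) (g : W -> U) : open O ->
  smooth_on O a -> smooth_on O g -> smooth_on O (fun p => a p *: g p).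
Proof. by move=> oO Ha Hg n; exact: Cn_scale. Qed.

Lemma smooth_on_opp W U (O : set W) (f : W -> U) : open O ->
  smooth_on O f -> smooth_on O (fun p => - f p).
Proof.
move=> oO Hf; apply: (@smooth_on_eq _ _ _ (fun p => (-1) *: f p)) => //.
  by move=> p _; rewrite scaleN1r.
by apply: smooth_on_scale => //; exact: smooth_on_cst.
Qed.

Lemma smooth_on_subr W U (O : set W) (f g : W -> U) : open O ->
  smooth_on O f -> smooth_on O g -> smooth_on O (fun p => f p - g p).
Proof.
by move=> oO Hf Hg; apply: smooth_on_add => //; exact: smooth_on_opp.
Qed.

Lemma smooth_on_comp W U m (O : set W) (O' : set 'rV[R]_m) (f : W -> 'rV[R]_m)
    (g : 'rV[R]_m -> U) : open O -> (forall p, O p -> O' (f p)) ->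
  smooth_on O f -> smooth_on O' g -> smooth_on O (fun p => g (f p)).
Proof. by move=> oO fO Hf Hg n; exact: Cn_comp (Hf n) (Hg n). Qed.

Lemma smooth_on_crd W m (O : set W) (f : W -> 'rV[R]_m) j : open O ->
  smooth_on O f -> smooth_on O (fun p => f p ord0 j).
Proof.
move=> oO Hf; apply: (@smooth_on_linear _ _ _ _ (@crd R m j)) => //.
exact: crd_continuous.
Qed.

Lemma smooth_on_rV W m (O : set W) (f : W -> 'rV[R]_m) : open O ->
  (forall j, smooth_on O (fun p => f p ord0 j)) -> smooth_on O f.
Proof.
move=> oO H; apply: (@smooth_on_eq _ _ _
  (fun p => \sum_(j < m) f p ord0 j *: delta_mx ord0 j)) => //.
  by move=> p _; rewrite -row_sum_delta.
by apply: smooth_on_sum => // j; apply: smooth_on_scale => //; exact: smooth_on_cst.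
Qed.

Lemma derive_crd W m (f : W -> 'rV[R]_m) j p v : differentiable f p ->
  'D_v (fun q => f q ord0 j) p = 'D_v f p ord0 j.
Proof.
by move=> df; have [] := @derive_linear _ _ _ _ (@crd R m j) f p v
  (@crd_continuous R m j) df.
Qed.

Lemma derive_scale W U (a : W -> R) (g : W -> U) x v :
  differentiable a x -> differentiable g x ->
  'D_v (fun p => a p *: g p) x = a x *: 'D_v g x + 'D_v a x *: g x.
Proof.
by move=> da dg; have [ds dE] := differentiable_scale da dg; rewrite !deriveE // dE.
Qed.

Lemma derive_sum_seq W U (I : Type) (r : seq I) (f : I -> W -> U) x v :
  (forall i, differentiable (f i) x) ->
  differentiable (fun p => \sum_(i <- r) f i p) x /\
  'D_v (fun p => \sum_(i <- r) f i p) x = \sum_(i <- r) 'D_v (f i) x.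
Proof.
move=> df; elim: r => [|i r [IH1 IH2]].
  rewrite big_nil (_ : (fun p => _) = fun=> 0).
    by split; [exact: differentiable_cst|exact: derive_cst].
  by apply/funext => p; rewrite big_nil.
rewrite big_cons (_ : (fun p => _) = f i + (fun p => \sum_(j <- r) f j p)).
  split; first exact: differentiableD.
  by rewrite deriveD ?IH2 //; exact: diff_derivable.
by apply/funext => p; rewrite big_cons.
Qed.

Lemma derive_comp W U U' (f : W -> U) (g : U -> U') x v :
  differentiable f x -> differentiable g (f x) ->
  'D_v (fun p => g (f p)) x = 'd g (f x) ('D_v f x).
Proof.
move=> df dg; rewrite deriveE; last exact: differentiable_comp.
by rewrite diff_comp //= deriveE.
Qed.

Lemma diff_rV U m (g : 'rV[R]_m -> U) x v : differentiable g x ->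
  'd g x v = \sum_(j < m) v ord0 j *: 'D_(delta_mx ord0 j) g x.
Proof.
move=> dg; rewrite [v in LHS]row_sum_delta linear_sum.
by apply: eq_bigr => j _; rewrite linearZ deriveE.
Qed.

Lemma derive_line W U (f : W -> U) q v (s : R) : derivable f (q + s *: v) v ->
  is_derive s 1 (fun t : R => f (q + t *: v)) ('D_v f (q + s *: v)).
Proof.
move=> df; have E : (fun h : R => h^-1 *: (f (q + (h *: 1 + s) *: v) - f (q + s *: v)))
   = (fun h : R => h^-1 *: (f (h *: v + (q + s *: v)) - f (q + s *: v))).
  apply/funext => h; rewrite scalerDl [h *: 1]mulr1 addrCA [h *: v + _]addrC.
  by congr (_ *: (f _ - _)); rewrite addrC.
by split; [rewrite /derivable E|rewrite /derive E].
Qed.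

Lemma mvt_line W (f : W -> R) q v (s : R) : 0 < s ->
  (forall t, 0 <= t <= s -> differentiable f (q + t *: v)) ->
  exists2 t, 0 < t < s & f (q + s *: v) - f q = s * 'D_v f (q + t *: v).
Proof.
move=> s0 df.
have [t|t|t] := @MVT R (fun t => f (q + t *: v)) (fun t => 'D_v f (q + t *: v)) 0 s s0.
- rewrite in_itv /= => /andP[t0 ts]; apply: derive_line; apply: diff_derivable.
  by apply: df; rewrite !ltW.
- apply: derivable_within_continuous => x; rewrite in_itv /= => xs.
  have [] // : is_derive x 1 (fun t => f (q + t *: v)) ('D_v f (q + x *: v)).
  by apply: derive_line; apply: diff_derivable; exact: df.
- rewrite in_itv /= => ts; rewrite scale0r addr0 subr0 mulrC => H.
  by exists t.
Qed.

End Smooth.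

(** * Symmetry of second derivatives *)

Section Schwarz.
Context {R : realType}.
Implicit Types W U : normedModType R.

Lemma derive_translate W U (f : W -> U) c x v : differentiable f (x + c) ->
  differentiable (fun q => f (q + c)) x /\
  'D_v (fun q => f (q + c)) x = 'D_v f (x + c).
Proof.
move=> df; split; last first.
  rewrite /derive (_ : (fun h : R => _) =
    (fun h => h^-1 *: ((f \o shift (x + c)) (h *: v) - f (x + c)))) //.
  by apply/funext => h /=; rewrite addrA.
apply: (@differentiable_comp _ _ _ _ (fun q => q + c) f) => //.
Qed.

(** The mean value theorem is applied twice: along [v] to the increment of [f] in the direction [w],
    then along [w] to ['D_v f]. *)
Lemma second_difference W (O : set W) (f : W -> R) p v w (s : R) :
  0 < s -> smooth_on O f ->
  (forall a b, 0 <= a <= s -> 0 <= b <= s -> O (p + a *: v + b *: w)) ->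
  exists a b, [/\ 0 < a < s, 0 < b < s &
    f (p + s *: v + s *: w) - f (p + s *: v) - (f (p + s *: w) - f p) =
    s * (s * 'D_w ('D_v f) (p + a *: v + b *: w))].
Proof.
move=> s0 Sf Opp.
have s00 : (0 : R) <= 0 <= s by rewrite lexx ltW.
have ss0 : 0 <= s <= s by rewrite lexx ltW.
have d1 t : 0 <= t <= s -> differentiable f (p + t *: v).
  move=> ts; apply: smooth_on_diff Sf _.
  by have := Opp t 0 ts s00; rewrite scale0r addr0.
have d2 t : 0 <= t <= s -> differentiable f (p + t *: v + s *: w).
  by move=> ts; apply: smooth_on_diff Sf _; exact: Opp.
pose F q := f (q + s *: w) - f q.
have [t ts|a as_ Ea] := @mvt_line _ _ F p v s s0.
  apply: differentiableB; last exact: d1.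
  by have [] := derive_translate 0 (d2 t ts).
have as' : 0 <= a <= s by case/andP: as_ => a0 a1; rewrite !ltW.
have Sv := smooth_on_derive v Sf.
have [t ts|b bs Eb] := @mvt_line _ _ ('D_v f) (p + a *: v) w s s0.
  by apply: smooth_on_diff Sv _; exact: Opp.
exists a, b; split=> //; rewrite -/(F (p + s *: v)) -/(F p) Ea; congr (_ * _).
rewrite -Eb /F (_ : (fun q => _) = (fun q => f (q + s *: w)) - f) //.
have [df De] := derive_translate v (d2 a as').
rewrite deriveB; [by rewrite De|exact: diff_derivable|].
exact/diff_derivable/d1.
Qed.

(** The second difference over a parallelogram does not depend on the order of [v] and [w]. The two
    mixed derivatives thus agree when taken at two suitable nearby points, and continuity brings
    both points to [p]. *)
Lemma derive_symmetric W (O : set W) (f : W -> R) p v w :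
  open O -> smooth_on O f -> O p -> 'D_w ('D_v f) p = 'D_v ('D_w f) p.
Proof.
move=> oO Sf Op.
have cont u1 u2 : {for p, continuous ('D_u1 ('D_u2 f))}.
  apply: differentiable_continuous; apply: smooth_on_diff Op.
  by do 2 apply: smooth_on_derive.
apply/eqP; rewrite -subr_eq0 -normr_le0; apply/ler_addgt0Pr => e e0.
rewrite add0r.
have e2 : 0 < e / 2 by rewrite divr_gt0.
have := cont w v; move/cvgrPdist_le => /(_ _ e2) Hwv.
have := cont v w; move/cvgrPdist_le => /(_ _ e2) Hvw.
have nO : \forall q \near p, O q by exact: open_nbhs_nbhs.
have [d /= d0 Hd] := (nbhs_ballP _ _).1 (filterI nO (filterI Hwv Hvw)).
(* With s (|v| + |w| + 1) = d / 2 the whole parallelogram lies in the ball of radius [d]. *)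
pose s := d / 2 / (`|v| + `|w| + 1).
have s0 : 0 < s by rewrite /s !divr_gt0.
have close a b : 0 <= a <= s -> 0 <= b <= s -> ball p d (p + a *: v + b *: w).
  move=> /andP[a0 as_] /andP[b0 bs]; rewrite -ball_normE /ball_ /=.
  rewrite -addrA opprD addNKr normrN.
  apply: (le_lt_trans (ler_normD _ _)); rewrite !normrZ !ger0_norm //.
  apply: (@le_lt_trans _ _ (s * (`|v| + `|w| + 1))).
    rewrite !mulrDr mulr1; apply: (@le_trans _ _ (s * `|v| + s * `|w|)).
      by apply: lerD; exact: ler_wpM2r.
    by rewrite lerDl ltW.
  by rewrite /s divfK ?gt_eqF //; lra.
have [a b as_ bs|a1 [b1 [a1s b1s E1]]] := @second_difference _ O f p v w s s0 Sf.
  by have [] := Hd _ (close a b as_ bs).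
have [a b as_ bs|b2 [a2 [b2s a2s E2]]] := @second_difference _ O f p w v s s0 Sf.
  by have [] := Hd _ (close b a bs as_); rewrite addrAC.
have itv (t : R) : 0 < t < s -> 0 <= t <= s by case/andP => ? ?; rewrite !ltW.
have [_ [/= C1 _]] := Hd _ (close _ _ (itv _ a1s) (itv _ b1s)).
have [_ [_ /= C2]] := Hd _ (close _ _ (itv _ a2s) (itv _ b2s)).
move: E1 E2 C1 C2; rewrite [p + s *: w + s *: v]addrAC.
rewrite [p + b2 *: w + a2 *: v]addrAC.
move: ('D_w ('D_v f) (_ + _)) ('D_v ('D_w f) (_ + _)) => A B.
move: ('D_w ('D_v f) p) ('D_v ('D_w f) p) => A0 B0.
move: (f _) (f _) (f _) (f _) => f1 f2 f3 f4 E1 E2.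
have AB : A = B.
  have sn : s != 0 by rewrite gt_eqF.
  by apply: (mulfI sn); apply: (mulfI sn); lra.
rewrite AB => C1 C2; have := ler_normD (A0 - B) (- (B0 - B)).
by rewrite normrN opprB addrA subrK; lra.
Qed.

Lemma derive_symmetric_rV W m (O : set W) (f : W -> 'rV[R]_m) p v w :
  open O -> smooth_on O f -> O p -> 'D_w ('D_v f) p = 'D_v ('D_w f) p.
Proof.
move=> oO Sf Op; apply/rowP => j.
have H u1 u2 : 'D_u1 ('D_u2 f) p ord0 j = 'D_u1 ('D_u2 (fun q => f q ord0 j)) p.
  have S2 := smooth_on_derive u2 Sf.
  rewrite -derive_crd; last exact: smooth_on_diff S2 Op.
  apply: (derive_eq_on u1 oO) => // q Oq; rewrite derive_crd //.
  exact: smooth_on_diff Sf Oq.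
have E := derive_symmetric v w oO (smooth_on_crd j oO Sf) Op.
exact: etrans (H w v) (etrans E (esym (H v w))).
Qed.

Lemma power_series_smooth W (F : nat -> W -> R) (N : nat -> R) (r : R) (f : W -> R) :
  power_series F N r f -> smooth_on [set h | `|h| < r] f.
Proof.
move=> H n; elim: n F N f H => [|n IH] F N f H.
  by split=> // p pr; have [] := power_series_diff H pr.
split=> [p pr|v]; first by have [] := power_series_diff H pr.
exact: IH (power_series_derive v H).
Qed.

Lemma open_normlt W (r : R) : open [set h : W | `|h| < r].
Proof.
rewrite (_ : [set h : W | `|h| < r] = ball (0 : W) r); first exact: ball_open.
by apply/seteqP; split=> h; rewrite -ball_normE /ball_ /= sub0r normrN.
Qed.

End Schwarz.

(** All derivatives along words of fewer than [n] directions taken in [ds] vanish at 0. The set of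
    directions is a parameter because orders along the x-axis alone are compared with orders in the
    plane. *)
Fixpoint ord {R : realType} {W U : normedModType R} (ds : set W) (n : nat)
    (f : W -> U) : Prop :=
  if n is n'.+1 then f 0 = 0 /\ forall v, ds v -> ord ds n' ('D_v f) else True.

(** * Order of vanishing *)

Section Ord.
Context {R : realType} {W : normedModType R} (O : set W).
Hypotheses (oO : open O) (O0 : O 0).
Implicit Types (ds : set W) (U : normedModType R).

Lemma ord_eq U ds n (f g : W -> U) : (forall p, O p -> f p = g p) ->
  ord ds n f -> ord ds n g.
Proof.
elim: n f g => [//|n IH] f g fg /= [f0 H]; split; first by rewrite -fg.
by move=> v vds; apply: IH (H v vds) => p Op; exact: derive_eq_on fg Op.
Qed.

Lemma ord_leS U ds n (f : W -> U) : ord ds n.+1 f -> ord ds n f.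
Proof.
elim: n f => [//|n IH] f [f0 H]; split=> // v vds; exact/IH/H.
Qed.

Lemma ord_le U ds n m (f : W -> U) : (n <= m)%N -> ord ds m f -> ord ds n f.
Proof.
move=> nm; rewrite -(subnK nm) addnC.
by elim: (m - n)%N => [|k IH]; rewrite ?addn0 // addnS => /ord_leS/IH.
Qed.

Lemma ord_sub_dirs U ds ds' n (f : W -> U) : ds' `<=` ds ->
  ord ds n f -> ord ds' n f.
Proof.
move=> dd; elim: n f => [//|n IH] f [f0 H]; split=> // v /dd vds; exact/IH/H.
Qed.

Lemma ord_zero U ds n : ord ds n (fun=> 0 : U).
Proof.
elim: n => [//|n IH]; split=> // v _.
by apply: ord_eq IH => p _; rewrite derive_cst.
Qed.

Lemma ord_add U ds n (f g : W -> U) : smooth_on O f -> smooth_on O g ->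
  ord ds n f -> ord ds n g -> ord ds n (fun p => f p + g p).
Proof.
elim: n f g => [//|n IH] f g sf sg [f0 Hf] [g0 Hg]; split.
  by rewrite f0 g0 addr0.
move=> v vds; have H := IH _ _ (smooth_on_derive v sf) (smooth_on_derive v sg)
  (Hf v vds) (Hg v vds).
apply: ord_eq H => p Op; rewrite (_ : (fun p => _) = f + g) // deriveD //.
  exact/diff_derivable/(smooth_on_diff sf).
exact/diff_derivable/(smooth_on_diff sg).
Qed.

Lemma ord_sum U ds n (I : Type) (r : seq I) (f : I -> W -> U) :
  (forall i, smooth_on O (f i)) -> (forall i, ord ds n (f i)) ->
  ord ds n (fun p => \sum_(i <- r) f i p).
Proof.
move=> sf H; elim: r => [|i r IH].
  by apply: ord_eq (ord_zero U ds n) => p _; rewrite big_nil.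
have S := smooth_on_sum r oO sf.
by apply: ord_eq (ord_add (sf i) S (H i) IH) => p _; rewrite big_cons.
Qed.

Lemma ord_linear U U' ds n (l : {linear U -> U'}) (f : W -> U) : continuous l ->
  smooth_on O f -> ord ds n f -> ord ds n (fun p => l (f p)).
Proof.
move=> lc; elim: n f => [//|n IH] f sf [f0 H]; split; first by rewrite f0 linear0.
move=> v vds; apply: ord_eq (IH _ (smooth_on_derive v sf) (H v vds)) => p Op.
by have [_ ->] := derive_linear v lc (smooth_on_diff sf Op).
Qed.

(** Leibniz rule. The inequality, rather than [n = a + b], absorbs the case where [a] or [b] is
    already 0 and its predecessor does not decrease. *)
Lemma ord_scale U ds n a b (f : W -> R) (g : W -> U) : (n <= a + b)%N ->
  smooth_on O f -> smooth_on O g -> ord ds a f -> ord ds b g ->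
  ord ds n (fun p => f p *: g p).
Proof.
elim: n a b f g => [//|n IH] a b f g nab sf sg Hf Hg; split.
  case: a nab Hf => [|a] nab Hf; last by case: Hf => -> _; rewrite scale0r.
  by case: b nab Hg => [//|b] _ [-> _]; rewrite scaler0.
move=> v vds.
have Dg : ord ds b.-1 ('D_v g) by case: b Hg {nab} => [//|b] [_ H]; exact: H.
have Df : ord ds a.-1 ('D_v f) by case: a Hf {nab} => [//|a] [_ H]; exact: H.
have sDf := smooth_on_derive v sf; have sDg := smooth_on_derive v sg.
have H1 : ord ds n (fun p => f p *: 'D_v g p).
  by apply: (IH a b.-1) => //; case: b {Hg Dg} nab => [|b]; lia.
have H2 : ord ds n (fun p => 'D_v f p *: g p).
  by apply: (IH a.-1 b) => //; case: a {Hf Df H1} nab => [|a]; lia.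
have S1 := smooth_on_scale oO sf sDg; have S2 := smooth_on_scale oO sDf sg.
apply: ord_eq (ord_add S1 S2 H1 H2) => p Op.
by rewrite derive_scale //; [exact: smooth_on_diff sf Op|exact: smooth_on_diff sg Op].
Qed.

Lemma ord_scalel U ds n (f : W -> R) (g : W -> U) :
  smooth_on O f -> smooth_on O g -> ord ds n f -> ord ds n (fun p => f p *: g p).
Proof. by move=> sf sg Hf; apply: (@ord_scale _ _ _ n 0) => //; rewrite addn0. Qed.

Lemma ord_scaler U ds n (f : W -> R) (g : W -> U) :
  smooth_on O f -> smooth_on O g -> ord ds n g -> ord ds n (fun p => f p *: g p).
Proof. by move=> sf sg Hg; apply: (@ord_scale _ _ _ 0 n). Qed.

Lemma ord_opp U ds n (f : W -> U) : smooth_on O f -> ord ds n f ->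
  ord ds n (fun p => - f p).
Proof.
move=> sf Hf; apply: (@ord_eq _ _ _ (fun p => (-1) *: f p)).
  by move=> p _; rewrite scaleN1r.
by apply: ord_scaler => //; exact: smooth_on_cst.
Qed.

Lemma ord_subr U ds n (f g : W -> U) : smooth_on O f -> smooth_on O g ->
  ord ds n f -> ord ds n g -> ord ds n (fun p => f p - g p).
Proof.
move=> sf sg Hf Hg; apply: ord_add => //; last exact: ord_opp.
exact: smooth_on_opp.
Qed.

(* Along the characteristic direction the system determines [f] from its
   restriction to the [x]-axis. *)
Lemma ord_cauchy U (I : Type) (f : I -> W -> U) (tau : I -> I) (x y : W) k :
  (forall g p v w, smooth_on O g -> O p ->
     'D_w ('D_v g) p = 'D_v ('D_w g) p :> U) ->
  (forall i, smooth_on O (f i)) ->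
  (forall i, ord [set x; y] k (fun p => 'D_y (f i) p - 'D_x (f (tau i)) p)) ->
  (forall i, ord [set x] k.+1 (f i)) ->
  forall i, ord [set x; y] k.+1 (f i).
Proof.
move=> sym; elim: k f => [|k IH] f sf Hf Hx i; first by split=> //; case: (Hx i).
(* By symmetry of second derivatives the x-derivatives solve the same system one order lower. The
   y-derivative then equals an x-derivative up to the assumed defect. *)
have Dx j : ord [set x; y] k.+1 ('D_x (f j)).
  apply: (IH (fun j => 'D_x (f j))) => {}j.
  - exact: smooth_on_derive.
  - have /= [_ /(_ x)] := Hf j; move=> /(_ (or_introl erefl)).
    apply: ord_eq => p Op.
    have d1 : differentiable ('D_y (f j)) p.
      exact: smooth_on_diff (smooth_on_derive y (sf j)) Op.
    have d2 : differentiable ('D_x (f (tau j))) p.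
      exact: smooth_on_diff (smooth_on_derive x (sf (tau j))) Op.
    rewrite (_ : (fun p => _) = 'D_y (f j) - 'D_x (f (tau j))) // deriveB.
    + by rewrite sym.
    + exact: diff_derivable.
    + exact: diff_derivable.
  - by have [_ /(_ x erefl)] := Hx j.
split=> [|v [->|->]]; first by case: (Hx i).
  exact: Dx.
have S1 := smooth_on_derive y (sf i).
have S2 := smooth_on_derive x (sf (tau i)).
have := ord_add (smooth_on_subr oO S1 S2) S2 (Hf i) (Dx (tau i)).
by apply: ord_eq => p _; rewrite subrK.
Qed.

(** The dual forms give the values at 0. For a derivative, sum D_v(g_i) e_i differs from the
    derivative of the sum by sum g_i D_v(e_i), whose order is known from the previous stage. *)
Lemma ord_coef U ds d k (g : 'I_d -> W -> R) (e : 'I_d -> W -> U)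
    (l : 'I_d -> {linear U -> R}) : (forall i, smooth_on O (g i)) ->
  (forall i, smooth_on O (e i)) -> (forall i j, l j (e i 0) = (i == j)%:R) ->
  ord ds k (fun p => \sum_(i < d) g i p *: e i p) -> forall i, ord ds k (g i).
Proof.
move=> + se le; elim: k g => [//|k IH] g sg H i.
have Hk j : ord ds k (g j) by apply: IH => //; exact: ord_leS.
case: H => H0 H; split.
  have := congr1 (l i) H0; rewrite linear0 linear_sum (bigD1 i) //= linearZ /= le eqxx.
  rewrite big1 ?addr0 => [|j ji]; first by move=> <-; rewrite -[LHS]mulr1.
  by rewrite linearZ /= le (negbTE ji) [LHS]mulr0.
move=> v vds; apply: IH (fun j => 'D_v (g j)) _ _ i.
  by move=> j; exact: smooth_on_derive.
have S1 j := smooth_on_scale oO (sg j) (smooth_on_derive v (se j)).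
have S2 j := smooth_on_scale oO (sg j) (se j).
have H1 : ord ds k (fun p => \sum_(j < d) g j p *: 'D_v (e j) p).
  apply: ord_sum => // j; apply: ord_scalel => //; exact: smooth_on_derive.
have := ord_subr (smooth_on_derive v (smooth_on_sum _ oO S2))
  (smooth_on_sum _ oO S1) (H v vds) H1.
apply: ord_eq => p Op.
have [j|_ ->] := @derive_sum_seq _ _ _ _ (index_enum 'I_d)
   (fun j p => g j p *: e j p) p v.
  exact: smooth_on_diff (S2 j) Op.
rewrite -sumrB; apply: eq_bigr => j _.
rewrite derive_scale ?[g j p *: _ + _]addrC ?addrK //.
  exact: smooth_on_diff (sg j) Op.
exact: smooth_on_diff (se j) Op.
Qed.

End Ord.

(** * Taylor polynomials in given functions *)

Section Taylor.
Context {R : realType} {W : normedModType R} (O : set W).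
Hypotheses (oO : open O) (O0 : O 0).
Implicit Types (ds : set W) (h : W -> R).

Lemma smooth_on_mul (f g : W -> R) : smooth_on O f -> smooth_on O g ->
  smooth_on O (fun p => f p * g p).
Proof. exact: smooth_on_scale. Qed.

Lemma smooth_on_pow (f : W -> R) n : smooth_on O f ->
  smooth_on O (fun p => f p ^+ n).
Proof.
move=> sf; elim: n => [|n IH]; first exact: smooth_on_cst.
under eq_fun do rewrite exprS; exact: smooth_on_mul.
Qed.

Lemma ord_mul ds n a b (f g : W -> R) : (n <= a + b)%N ->
  smooth_on O f -> smooth_on O g -> ord ds a f -> ord ds b g ->
  ord ds n (fun p => f p * g p).
Proof. move=> nab sf sg of1 og; exact: (ord_scale oO O0 nab sf sg of1 og). Qed.

Lemma ord_mull ds n c (f : W -> R) : smooth_on O f -> ord ds n f ->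
  ord ds n (fun p => c * f p).
Proof.
by move=> sf; apply: (@ord_mul _ _ 0 n) => //; exact: smooth_on_cst.
Qed.

Lemma ord_one ds (f : W -> R) : f 0 = 0 -> ord ds 1 f.
Proof. by []. Qed.

Lemma ord_pow ds (f : W -> R) n : smooth_on O f -> f 0 = 0 ->
  ord ds n (fun p => f p ^+ n).
Proof.
move=> sf f0; elim: n => [//|n IH].
have H := @ord_mul ds n.+1 1 n f _ (leqnn _) sf (smooth_on_pow n sf) (ord_one ds f0) IH.
by apply: (ord_eq oO O0 _ H) => p _; rewrite exprS.
Qed.

Lemma derive_mul (f g : W -> R) p v : smooth_on O f -> smooth_on O g -> O p ->
  'D_v (fun q => f q * g q) p = f p * 'D_v g p + 'D_v f p * g p.
Proof.
by move=> sf sg Op; apply: derive_scale; [exact: smooth_on_diff sf Op|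
  exact: smooth_on_diff sg Op].
Qed.

Lemma derive_subr (U : normedModType R) (f g : W -> U) p v : smooth_on O f ->
  smooth_on O g -> O p -> 'D_v (fun q => f q - g q) p = 'D_v f p - 'D_v g p.
Proof.
move=> sf sg Op; rewrite (_ : (fun q => _) = f - g) // deriveB //; apply: diff_derivable.
  exact: smooth_on_diff sf Op.
exact: smooth_on_diff sg Op.
Qed.

(** The difference is n f^(n-1) (D_v f - c), and the last factor vanishes at 0. To this order a
    power of [f] is differentiated as if [f] were linear. *)
Lemma ord_derive_pow ds (f : W -> R) n v c : smooth_on O f -> f 0 = 0 ->
  'D_v f 0 = c ->
  ord ds n (fun p => 'D_v (fun q => f q ^+ n) p - c * n%:R * f p ^+ n.-1).
Proof.
move=> sf f0 fc; elim: n => [//|n IH].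
have sDf := smooth_on_derive v sf; have sp m := smooth_on_pow m sf.
have sDp m := smooth_on_derive v (sp m).
have s1 : smooth_on O (fun p => 'D_v f p - c).
  by apply: smooth_on_subr => //; exact: smooth_on_cst.
have s2 : smooth_on O (fun p => 'D_v (fun q => f q ^+ n) p - c * n%:R * f p ^+ n.-1).
  apply: smooth_on_subr => //; apply: smooth_on_mul => //; exact: smooth_on_cst.
have o1 : ord ds 1 (fun p => 'D_v f p - c) by apply: ord_one; rewrite fc subrr.
have H1 := @ord_mul ds n.+1 1 n _ _ (leqnn _) sf s2 (ord_one ds f0) IH.
have H2 := @ord_mul ds n.+1 1 n _ _ (leqnn _) s1 (sp n) o1 (ord_pow ds n sf f0).
have H := ord_add oO O0 (smooth_on_mul sf s2) (smooth_on_mul s1 (sp n)) H1 H2.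
apply: (ord_eq oO O0 _ H) => p Op.
rewrite (_ : (fun q => f q ^+ n.+1) = fun q => f q * f q ^+ n); last first.
  by apply/funext => q; rewrite exprS.
rewrite derive_mul //= -natr1; case: n {IH H1 H2 H sDp s2 o1 sp} => [|n] /=.
  by rewrite expr0; ring.
by rewrite [f p ^+ n.+1]exprS; ring.
Qed.

(** Treat the x-derivative of [h] first, then integrate: s f^n has the primitive s f^(n+1) / (n +
    1), up to the error of [ord_derive_pow]. *)
Lemma taylor_line x (f h : W -> R) n : smooth_on O f -> f 0 = 0 ->
  'D_x f 0 = 1 -> smooth_on O h -> ord [set x] n h ->
  exists s, ord [set x] n.+1 (fun p => h p - s * f p ^+ n).
Proof.
move=> sf f0 fx; elim: n h => [|n IH] h sh Hh.
  by exists (h 0); apply: ord_one; rewrite expr0 mulr1 subrr.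
have [s Hs] := IH ('D_x h) (smooth_on_derive x sh) (Hh.2 x erefl).
exists (s / n.+1%:R); split; first by rewrite Hh.1 f0 expr0n mulr0 subr0.
move=> _ ->; have sp m := smooth_on_pow m sf.
have scp m c : smooth_on O (fun p => c * f p ^+ m).
  by apply: smooth_on_mul => //; exact: smooth_on_cst.
have s2 : smooth_on O (fun p => 'D_x (fun q => f q ^+ n.+1) p
    - 1 * n.+1%:R * f p ^+ n).
  by apply: smooth_on_subr => //; exact: smooth_on_derive.
have H2 := @ord_mull [set x] n.+1 (s / n.+1%:R) _ s2
  (ord_derive_pow _ n.+1 sf f0 fx).
have H := ord_subr oO O0 (smooth_on_subr oO (smooth_on_derive x sh) (scp n s))
  (smooth_on_mul (smooth_on_cst _ (s / n.+1%:R)) s2) Hs H2.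
apply: (ord_eq oO O0 _ H) => p Op.
rewrite derive_subr // derive_mul //; last exact: smooth_on_cst.
by rewrite derive_cst; field.
Qed.

(** To first order [f] is x and [g] is y plus a multiple of x. Expand the y-derivative by induction,
    integrate the result in y, and correct what is left on the x-axis by a multiple of f^(k+1);
    since [f] has zero y-derivative at 0, this correction leaves the y-derivative unchanged to the
    order required. *)
Lemma taylor_plane x y (f g : W -> R) k h :
  smooth_on O f -> smooth_on O g -> f 0 = 0 -> g 0 = 0 ->
  'D_x f 0 = 1 -> 'D_y f 0 = 0 -> 'D_y g 0 = 1 ->
  smooth_on O h -> ord [set x; y] k h ->
  exists t : nat -> R, ord [set x; y] k.+1
    (fun p => h p - \sum_(a < k.+1) t a * (f p ^+ a * g p ^+ (k - a))).
Proof.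
move=> sf sg f0 g0 fx fy gy; set ds := [set x; y].
have sm a b : smooth_on O (fun p => f p ^+ a * g p ^+ b).
  by apply: smooth_on_mul; exact: smooth_on_pow.
have om a b : ord ds (a + b) (fun p => f p ^+ a * g p ^+ b).
  apply: (@ord_mul ds _ a b) => //; first exact: smooth_on_pow.
  - exact: smooth_on_pow.
  - exact: ord_pow.
  - exact: ord_pow.
have scm c a b : smooth_on O (fun p => c * (f p ^+ a * g p ^+ b)).
  by apply: smooth_on_mul => //; exact: smooth_on_cst.
have sd a b : smooth_on O (fun p => 'D_y (fun q => f q ^+ a * g q ^+ b) p
     - b%:R * (f p ^+ a * g p ^+ b.-1)).
  by apply: smooth_on_subr => //; exact: smooth_on_derive.
have dm a b : ord ds (a + b) (fun p => 'D_y (fun q => f q ^+ a * g q ^+ b) p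
     - b%:R * (f p ^+ a * g p ^+ b.-1)).
  have sfa := smooth_on_pow a sf; have sgb := smooth_on_pow b sg.
  have sdf := smooth_on_derive y sfa; have sdg := smooth_on_derive y sgb.
  have sr : smooth_on O (fun p => 'D_y (fun q => g q ^+ b) p - 1 * b%:R * g p ^+ b.-1).
    apply: smooth_on_subr => //; apply: smooth_on_mul; first exact: smooth_on_cst.
    exact: smooth_on_pow.
  have H1 : ord ds a ('D_y (fun q => f q ^+ a)).
    have := ord_derive_pow ds a sf f0 fy.
    by apply: (ord_eq oO O0) => // p _; rewrite !mul0r subr0.
  have H2 := ord_derive_pow ds b sg g0 gy.
  have H3 := @ord_mul ds (a + b) a b _ _ (leqnn _) sfa sr (ord_pow ds a sf f0) H2.
  have H4 := @ord_mul ds (a + b) a b _ _ (leqnn _) sdf sgb H1 (ord_pow ds b sg g0).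
  have := ord_add oO O0 (smooth_on_mul sfa sr) (smooth_on_mul sdf sgb) H3 H4.
  apply: (ord_eq oO O0) => // p Op; rewrite derive_mul //; ring.
elim: k h => [|k IH] h sh Hh.
  exists (fun=> h 0); apply: ord_one.
  by rewrite big_ord1 !expr0 mulr1 mulr1 subrr.
have sDh := smooth_on_derive y sh.
have [t Ht] := IH ('D_y h) sDh (Hh.2 y (or_intror erefl)).
pose T p := \sum_(a < k.+1) t a / (k.+1 - a)%:R * (f p ^+ a * g p ^+ (k.+1 - a)).
have sT : smooth_on O T by apply: smooth_on_sum.
have oT : ord ds k.+1 T.
  apply: (ord_sum oO O0) => a; first exact: scm.
  apply: ord_mull => //; have := om a (k.+1 - a)%N.
  by rewrite subnKC // ltnW.
have sh1 := smooth_on_subr oO sh sT.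
have oh1 : ord [set x] k.+1 (fun p => h p - T p).
  apply: (@ord_sub_dirs _ _ _ ds); first by move=> _ ->; left.
  exact: (ord_subr oO O0 sh sT Hh oT).
have [s Hs] := taylor_line sf f0 fx sh1 oh1.
have sfk : smooth_on O (fun p => s * f p ^+ k.+1).
  by apply: smooth_on_mul; [exact: smooth_on_cst|exact: smooth_on_pow].
have sh2 := smooth_on_subr oO sh1 sfk.
(* Integrating f^a g^(k-a) in y divides by k + 1 - a; the coefficient of f^(k+1) is the one found on
   the axis. *)
exists (fun a => if (a < k.+1)%N then t a / (k.+1 - a)%:R else s).
(* The second member of the family is 0 and [tau] always points to it, so that the system of
   [ord_cauchy] reduces to a small y-derivative. *)
pose F (i : bool) := if i then fun p => h p - T p - s * f p ^+ k.+1 else fun=> 0.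
have sF i : smooth_on O (F i) by case: i => //; exact: smooth_on_cst.
have sym (q : W -> R) p v w : smooth_on O q -> O p ->
    'D_w ('D_v q) p = 'D_v ('D_w q) p by exact: derive_symmetric.
have c2 i : ord [set x] k.+2 (F i) by case: i; [exact: Hs|exact: (ord_zero oO O0)].
have c1 i : ord ds k.+1 (fun p => 'D_y (F i) p - 'D_x (F false) p).
    case: i; last first.
      by apply: (ord_eq oO O0) (ord_zero oO O0 _ _ _) => p Op; rewrite /= !derive_cst subrr.
    pose S1 p := 'D_y h p - \sum_(a < k.+1) t a * (f p ^+ a * g p ^+ (k - a)).
    have sS1 : smooth_on O S1 by apply: smooth_on_subr => //; exact: smooth_on_sum.
    pose S2 p := \sum_(a < k.+1) t a / (k.+1 - a)%:R *
      ('D_y (fun q => f q ^+ a * g q ^+ (k.+1 - a)) p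
     - (k.+1 - a)%:R * (f p ^+ a * g p ^+ (k.+1 - a).-1)).
    have sS2i (a : 'I_k.+1) : smooth_on O (fun p => t a / (k.+1 - a)%:R *
      ('D_y (fun q => f q ^+ a * g q ^+ (k.+1 - a)) p
       - (k.+1 - a)%:R * (f p ^+ a * g p ^+ (k.+1 - a).-1))).
      by apply: smooth_on_mul; [exact: smooth_on_cst|exact: sd].
    have sS2 : smooth_on O S2 by exact: smooth_on_sum.
    have oS2 : ord ds k.+1 S2.
      apply: (ord_sum oO O0) => // a; apply: ord_mull; first exact: sd.
      by have := dm a (k.+1 - a)%N; rewrite subnKC // ltnW.
    have sdp := smooth_on_derive y (smooth_on_pow k.+1 sf).
    pose S3 p := s * 'D_y (fun q => f q ^+ k.+1) p.
    have sS3 : smooth_on O S3 by apply: smooth_on_mul => //; exact: smooth_on_cst.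
    have oS3 : ord ds k.+1 S3.
      apply: ord_mull => //; have := ord_derive_pow ds k.+1 sf f0 fy.
      by apply: (ord_eq oO O0) => // p _; rewrite !mul0r subr0.
    have oS12 := ord_subr oO O0 sS1 sS2 Ht oS2.
    have := ord_subr oO O0 (smooth_on_subr oO sS1 sS2) sS3 oS12 oS3.
    apply: (ord_eq oO O0) => // p Op; rewrite /F derive_cst subr0 derive_subr //.
    rewrite derive_subr // /S3 /S1 /S2; congr (_ - _); last first.
      rewrite derive_mul //; [|exact: smooth_on_cst|exact: smooth_on_pow].
      by rewrite derive_cst; ring.
    rewrite -addrA -opprD -big_split /=; congr (_ - _).
    have dti (a : 'I_k.+1) := smooth_on_diff
      (scm (t a / (k.+1 - a)%:R) a (k.+1 - a)%N) Op.
    have [//|_ ->] := @derive_sum_seq _ _ _ _ (index_enum 'I_k.+1)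
      (fun a q => t a / (k.+1 - a)%:R * (f q ^+ a * g q ^+ (k.+1 - a))) p y.
    apply: eq_bigr => a _; rewrite (derive_mul y (smooth_on_cst O (t a / (k.+1 - a)%:R)) (sm a (k.+1 - a)%N) Op).
    rewrite (derive_cst (t a / (k.+1 - a)%:R) p y).
    have -> : (k.+1 - a)%N = (k - a).+1 by rewrite subSn // -ltnS.
    move: ('D_y _ p) => D /=; field.
    by rewrite ?natr1 ?nat1r gt_eqF.
have := @ord_cauchy R W O oO O0 R bool F (fun=> false) x y k.+1 sym sF c1 c2 true.
apply: (ord_eq oO O0) => // p _; rewrite /F big_ord_recr /= ltnn subnn expr0 mulr1.
rewrite opprD addrA; congr (_ - _ - _).
by rewrite /T; apply: eq_bigr => a _; rewrite ltn_ord.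
Qed.

End Taylor.

(** * Analytic functions *)

Section ListPoly.
Context {R : realType} {m : nat}.
Notation V := 'rV[R]_m.
(** Polynomials as lists of coefficients and words of variables, repetitions allowed. Compared with
    multi-indices, a product of monomials is a concatenation, and substituting series for the
    variables is a fold along the word. *)
Definition lpoly := seq (R * seq 'I_m).
Implicit Types (P Q : lpoly) (x : 'I_m -> R).

Definition leval P x : R := \sum_(cw <- P) cw.1 * \prod_(i <- cw.2) x i.
Definition lnorm P : R := \sum_(cw <- P) `|cw.1|.
Definition ldeg (k : nat) P : bool := all (fun cw => size cw.2 == k) P.

Lemma lnorm_ge0 P : 0 <= lnorm P.
Proof. by apply: sumr_ge0. Qed.

Lemma crd_unit_form (j : 'I_m) : unit_form (fun h : V => h ord0 j).
Proof.
split=> [a u v|h]; first by rewrite !mxE.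
by rewrite [leRHS]mx_normrE; apply: (le_bigmax _ (fun ij => `|h ij.1 ij.2|) (ord0, j)).
Qed.

Lemma hom_leval k P : ldeg k P -> hom k (lnorm P) (fun h : V => leval P (h ord0)).
Proof.
have Hw (w : seq 'I_m) : hom (size w) 1 (fun h : V => \prod_(i <- w) h ord0 i).
  elim: w => [|i w IH].
    under eq_fun do rewrite big_nil.
    by have := @HomC R V 1; rewrite normr1.
  under eq_fun do rewrite big_cons; apply: HomL IH; exact: crd_unit_form.
elim: P => [|[c w] P IH] /=.
  rewrite /lnorm big_nil (_ : (fun h : V => _) = fun=> 0); first by move=> _; exact: Hom0.
  by apply/funext => h; rewrite /leval big_nil.
move=> /andP[/eqP wk dP]; rewrite /lnorm big_cons.
rewrite (_ : (fun h : V => _) = (fun h : V => c * \prod_(i <- w) h ord0 i + leval P (h ord0))).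
  apply: HomD; last exact: IH.
  by have := hom_scale c (Hw w); rewrite mulr1 wk.
by apply/funext => h; rewrite /leval big_cons.
Qed.

Lemma leval_le k P x (s : R) : ldeg k P -> (forall i, `|x i| <= s) ->
  `|leval P x| <= lnorm P * s ^+ k.
Proof.
move=> + xs; elim: P => [|[c w] P IH] /=.
  by rewrite /leval /lnorm !big_nil normr0 mul0r.
move=> /andP[/eqP wk dP]; rewrite /leval /lnorm !big_cons mulrDl /=.
apply: (le_trans (ler_normD _ _)); apply: lerD; last exact: IH.
rewrite normrM; apply: ler_wpM2l => //; rewrite -wk.
elim: w {IH dP wk} => [|i w IHw]; first by rewrite big_nil normr1.
by rewrite big_cons normrM /= exprS; apply: ler_pM.
Qed.

Definition analytic_list (P : nat -> lpoly) (r : R) (f : V -> R) (p : V) : Prop :=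
  [/\ forall k, ldeg k (P k), radius_ge (fun k => lnorm (P k)) r &
      forall h : V, `|h| < r -> series (fun k => leval (P k) (h ord0)) @ \oo --> f (p + h)].

Lemma analytic_list_power_series (P : nat -> lpoly) r f : analytic_list P r f 0 ->
  power_series (fun k (h : V) => leval (P k) (h ord0)) (fun k => lnorm (P k)) r f.
Proof.
move=> [dP rP cP]; split=> // [k|h hr]; first exact: hom_leval.
by have := cP h hr; rewrite add0r.
Qed.

Lemma radius_ge_le (N : nat -> R) r r' : r' <= r -> radius_ge N r -> radius_ge N r'.
Proof.
by move=> rr H rho /andP[r0 r1]; apply: H; rewrite r0 (lt_le_trans r1).
Qed.

Lemma analytic_list_le (P : nat -> lpoly) r r' f p : r' <= r -> analytic_list P r f p ->
  analytic_list P r' f p.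
Proof.
move=> rr [dP rP cP]; split=> //; first exact: radius_ge_le rP.
by move=> h hr; apply: cP; exact: lt_le_trans rr.
Qed.

Lemma analytic_at_list f p : analytic_at f p ->
  exists (P : nat -> lpoly) r, 0 < r /\ analytic_list P r f p.
Proof.
move=> [c [r [r0 Hc]]].
pose word k (a : {ffun 'I_m -> 'I_k.+1}) : seq 'I_m :=
  flatten [seq nseq (a i) i | i <- enum 'I_m].
pose P k : lpoly := [seq (c [ffun i => a i : nat], word k a)
  | a : {ffun 'I_m -> 'I_k.+1} <- enum [pred a : {ffun 'I_m -> 'I_k.+1} | (\sum_i a i == k)%N]].
have prodw k a x : \prod_(i <- word k a) x i = \prod_i x i ^+ a i.
  rewrite /word big_flatten big_map big_enum /=; apply: eq_bigr => i _.
  by rewrite big_nseq iter_mulr_1.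
have evP k (h : V) : leval (P k) (h ord0) = homogeneous_part c h k.
  rewrite /leval big_map big_enum_cond /=; apply: eq_big => [a|a _].
    by rewrite inE andbT.
  by rewrite prodw.
have nP k : lnorm (P k) = homogeneous_part (fun a => `|c a|) (const_mx 1 : V) k.
  rewrite /lnorm big_map big_enum_cond /=; apply: eq_big => [a|a _].
    by rewrite inE andbT.
  by rewrite big1 ?mulr1 // => i _; rewrite mxE expr1n.
exists P, r; split=> //; split.
- move=> k; apply/allP => cw /mapP[a]; rewrite mem_enum inE => /eqP ak ->.
  rewrite /= /word size_flatten /shape -map_comp sumnE big_map big_enum /=.
  by apply/eqP; rewrite -[RHS]ak; apply: eq_bigr => i _; rewrite size_nseq.
- move=> rho /andP[rho0 rhor].
  (* At the constant vector [rho] every monomial of degree k equals rho^k, so that convergence there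
     bounds the whole sum of absolute coefficients of degree k. *)
  have hr : `|(const_mx rho : V)| < r.
    apply: le_lt_trans rhor; rewrite [leLHS]mx_normrE.
    by apply: bigmax_le => [|ij _]; rewrite ?mxE ?ger0_norm // ltW.
  have [Hcv _] := Hc _ hr.
  have := cvg_series_cvg_0 Hcv => H0.
  have /cvg_seq_bounded/bounded_fun_has_ubound[C HC] :
    cvgn (homogeneous_part (fun a => `|c a|) (map_mx Num.norm (const_mx rho : V))).
    by apply/cvg_ex; exists 0.
  exists C => k; apply: le_trans (HC _ _); last by exists k.
  rewrite nP /homogeneous_part mulr_suml; apply: ler_sum => a /eqP ak.
  rewrite big1 ?mulr1 => [|i _]; last by rewrite mxE expr1n.
  apply: ler_wpM2l => //; rewrite -{1}ak.
  rewrite (eq_bigr (fun i => rho ^+ a i)).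
    by rewrite prodrXr.
  by move=> i _; rewrite !mxE ger0_norm // ltW.
- move=> h hr; have [_] := Hc h hr.
  by apply: cvg_trans; apply: near_eq_cvg; near=> n; apply: eq_bigr => k _; rewrite evP.
Unshelve. all: by end_near. Qed.

End ListPoly.

Section Converse.
Context {R : realType} {m : nat}.
Notation V := 'rV[R]_m.
Implicit Types (x : 'I_m -> R).

Definition content (w : seq 'I_m) : {ffun 'I_m -> nat} := [ffun i => count_mem i w].

Lemma prod_count (w : seq 'I_m) x :
  \prod_(i <- w) x i = \prod_i x i ^+ count_mem i w.
Proof.
elim: w => [|j w IH].
  by rewrite big_nil big1 // => i _; rewrite expr0.
rewrite big_cons IH (bigD1 j) //= [in RHS](bigD1 j) //= eqxx add1n exprS mulrA.
by congr (_ * _); apply: eq_bigr => i ij; rewrite eq_sym (negbTE ij).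
Qed.

Lemma sum_count (w : seq 'I_m) : (\sum_i count_mem i w)%N = size w.
Proof.
elim: w => [|j w IH]; first by rewrite big1.
rewrite /= big_split /= IH (bigD1 j) //= eqxx big1 ?addn0 // => i ij.
by rewrite eq_sym (negbTE ij).
Qed.

(** Words with the same content give the same monomial. The weight [d] is left free so that the
    regrouping applies to the coefficients and to their absolute values. *)
Lemma sum_content (P : @lpoly R m) (d : R * seq 'I_m -> R) k x : ldeg k P ->
  \sum_(a : {ffun 'I_m -> 'I_k.+1} | (\sum_i a i == k)%N)
    (\sum_(cw <- P | content cw.2 == [ffun i => a i : nat]) d cw)
      * \prod_i x i ^+ a i
  = \sum_(cw <- P) d cw * \prod_(i <- cw.2) x i.
Proof.
move=> dP; under eq_bigr do rewrite mulr_suml.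
rewrite (exchange_big_dep xpredT) //=; apply: eq_big_seq => cw cwP.
have szk : size cw.2 = k by apply/eqP; exact: (allP dP).
pose a0 : {ffun 'I_m -> 'I_k.+1} := [ffun i => inord (count_mem i cw.2)].
have a0E i : a0 i = count_mem i cw.2 :> nat.
  by rewrite ffunE inordK // ltnS -szk count_size.
rewrite (big_pred1 a0) => [|a].
  by rewrite [in RHS]prod_count; congr (_ * _); apply: eq_bigr => i _; rewrite a0E.
apply/andP/eqP => [[_ /eqP ca]|->].
  apply/ffunP => i; apply: val_inj; rewrite /= a0E.
  by move/ffunP: ca => /(_ i); rewrite /content !ffunE.
split; first by under eq_bigr do rewrite a0E; rewrite sum_count szk.
by apply/eqP/ffunP => i; rewrite [LHS]ffunE [RHS]ffunE a0E.
Qed.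

Lemma analytic_list_at (P : nat -> lpoly) r f (p : V) : 0 < r ->
  analytic_list P r f p -> analytic_at f p.
Proof.
move=> r0 [dP rP cP].
pose c (a : {ffun 'I_m -> nat}) : R :=
  \sum_(cw <- P (\sum_i a i)%N | content cw.2 == a) cw.1.
have degE k (a : {ffun 'I_m -> 'I_k.+1}) : (\sum_i a i == k)%N ->
   (\sum_i [ffun i => a i : nat] i)%N = k.
  by move=> /eqP ak; rewrite -[RHS]ak; apply: eq_bigr => i _; rewrite ffunE.
exists c, r; split=> // h hr; split; last first.
  apply: cvg_trans (cP h hr); apply: near_eq_cvg; near=> n.
  apply: eq_bigr => k _; rewrite /leval -(sum_content _ _ (dP k)) /homogeneous_part.
  by apply: eq_bigr => a ak; rewrite /c degE.
pose rho := (`|h| + r) / 2.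
have hrho : `|h| <= rho by rewrite /rho; lra.
have rr : 0 < rho < r by have := normr_ge0 h; rewrite /rho; lra.
have [C C0 HC] := radius_ge_series (fun k => lnorm_ge0 (P k)) rP rr.
have mh0 (i : 'I_m) : 0 <= map_mx Num.norm h ord0 i by rewrite mxE.
have prod0 k (a : {ffun 'I_m -> 'I_k.+1}) :
    0 <= \prod_i map_mx Num.norm h ord0 i ^+ a i.
  by apply: prodr_ge0 => i _; rewrite exprn_ge0.
apply: (@bounded_series_cvg _ _ C) => [k|N].
  by apply: sumr_ge0 => a _; rewrite mulr_ge0.
apply: le_trans (HC N); apply: ler_sum => k _; rewrite /homogeneous_part.
apply: (@le_trans _ _ (\sum_(a : {ffun 'I_m -> 'I_k.+1} | (\sum_i a i == k)%N)
    (\sum_(cw <- P k | content cw.2 == [ffun i => a i : nat]) `|cw.1|)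
      * \prod_i map_mx Num.norm h ord0 i ^+ a i)).
  apply: ler_sum => a ak; apply: ler_wpM2r => //.
  by rewrite /c degE //; exact: ler_norm_sum.
rewrite (@sum_content _ (fun cw => `|cw.1|) _ (fun i => map_mx Num.norm h ord0 i)) //.
(* The same list with nonnegative coefficients: regrouping words may cancel coefficients, but the
   bound is taken before any cancellation. *)
pose P' : @lpoly R m := [seq (`|cw.1|, cw.2) | cw <- P k].
have dP' : ldeg k P'.
  by rewrite /ldeg all_map; apply: sub_all (dP k) => cw.
have -> : lnorm (P k) = lnorm P'.
  by rewrite /lnorm big_map; apply: eq_bigr => cw _ /=; rewrite normr_id.
have xs i : `|map_mx Num.norm h ord0 i| <= rho.
  by rewrite ger0_norm // mxE; apply: le_trans hrho; case: (@crd_unit_form R m i).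
have := leval_le dP' xs; rewrite /leval big_map /=; apply: le_trans.
exact: ler_norm.
Unshelve. all: by end_near. Qed.

End Converse.

(** * Closure properties of analytic functions *)

Section Closure.
Context {R : realType} {m : nat}.
Notation V := 'rV[R]_m.
Implicit Types (f g : V -> R) (p : V).

Lemma analytic_list_common f g p : analytic_at f p -> analytic_at g p ->
  exists (P Q : nat -> @lpoly R m) r, [/\ 0 < r, analytic_list P r f p &
    analytic_list Q r g p].
Proof.
move=> /analytic_at_list[P [r [r0 HP]]] /analytic_at_list[Q [s [s0 HQ]]].
exists P, Q, (Num.min r s); rewrite lt_min r0 s0; split=> //.
- by apply: analytic_list_le HP; rewrite ge_min lexx.
- by apply: analytic_list_le HQ; rewrite ge_min lexx orbT.
Qed.

Lemma analytic_at_add f g p : analytic_at f p -> analytic_at g p ->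
  analytic_at (fun q => f q + g q) p.
Proof.
move=> Hf Hg; have [P [Q [r [r0 [dP rP cP] [dQ rQ cQ]]]]] := analytic_list_common Hf Hg.
apply: (@analytic_list_at _ _ (fun k => P k ++ Q k) r) => //; split.
- by move=> k; rewrite /ldeg all_cat; apply/andP; split; [exact: dP|exact: dQ].
- move=> rho rr; have [C HC] := rP _ rr; have [D HD] := rQ _ rr.
  exists (C + D) => k; rewrite /lnorm big_cat /= mulrDl; apply: lerD; [exact: HC|exact: HD].
- move=> h hr; apply: cvg_trans (cvgD (cP h hr) (cQ h hr)); apply: near_eq_cvg; near=> n.
  rewrite /series /= fctE -big_split /=; apply: eq_bigr => k _.
  by rewrite /leval big_cat.
Unshelve. all: by end_near. Qed.

(** The part of degree k lists all concatenations of a word of degree l with one of degree k - l.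
    Both [leval] and [lnorm] turn this list into a Cauchy product. *)
Lemma analytic_at_mul f g p : analytic_at f p -> analytic_at g p ->
  analytic_at (fun q => f q * g q) p.
Proof.
move=> Hf Hg; have [P [Q [r [r0 [dP rP cP] [dQ rQ cQ]]]]] := analytic_list_common Hf Hg.
pose M k : @lpoly R m := flatten [seq [seq (a.1 * b.1, a.2 ++ b.2) | a <- P l, b <- Q (k - l)%N]
   | l <- iota 0 k.+1].
have MP k x : leval (M k) x = conv (fun l => leval (P l) x) (fun l => leval (Q l) x) k.
  rewrite /leval /M big_flatten big_map -[iota 0 k.+1]/(index_iota 0 k.+1) big_mkord.
  apply: eq_bigr => l _; rewrite big_allpairs_dep /= mulr_suml; apply: eq_bigr => a _.
  by rewrite mulr_sumr; apply: eq_bigr => b _; rewrite big_cat /=; ring.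
have MN k : lnorm (M k) = conv (fun l => lnorm (P l)) (fun l => lnorm (Q l)) k.
  rewrite /lnorm /M big_flatten big_map -[iota 0 k.+1]/(index_iota 0 k.+1) big_mkord.
  apply: eq_bigr => l _; rewrite big_allpairs_dep /= mulr_suml; apply: eq_bigr => a _.
  by rewrite mulr_sumr; apply: eq_bigr => b _; rewrite normrM.
apply: (@analytic_list_at _ _ M r) => //; split.
- move=> k; apply/allP => cw /flatten_mapP[l]; rewrite mem_iota add0n ltnS => lk.
  move=> /allpairsP[[a b] /= [aP bQ ->]] /=.
  have /eqP ha := allP (dP l) a aP; have /eqP hb := allP (dQ (k - l)%N) b bQ.
  by rewrite size_cat ha hb subnKC.
- move=> rho /[dup] rr /andP[rho0 _].
  have [C C0 HC] := radius_ge_series (fun k => lnorm_ge0 (P k)) rP rr.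
  have [D HD] := rQ _ rr.
  exists (C * D) => k; rewrite MN /conv mulr_suml.
  have D0 : 0 <= D by apply: le_trans (HD 0%N); rewrite expr0 mulr1 lnorm_ge0.
  apply: (@le_trans _ _ (\sum_(l < k.+1) lnorm (P l) * rho ^+ l * D)).
    apply: ler_sum => l _; have -> : rho ^+ k = rho ^+ l * rho ^+ (k - l).
      by rewrite -exprD subnKC // -ltnS.
    rewrite mulrACA; apply: ler_wpM2l => //.
    by rewrite mulr_ge0 ?lnorm_ge0 // exprn_ge0 // ltW.
  rewrite -mulr_suml; apply: ler_wpM2r => //.
  by have := HC k.+1; rewrite /series /= big_mkord.
- move=> h hr; pose rho := (`|h| + r) / 2.
  have hrho : `|h| <= rho by rewrite /rho; lra.
  have rr : 0 < rho < r by have := normr_ge0 h; rewrite /rho; lra.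
  have xs (i : 'I_m) : `|h ord0 i| <= rho.
    by apply: le_trans hrho; case: (@crd_unit_form R m i).
  have [C C0 HC] := radius_ge_series (fun k => lnorm_ge0 (P k)) rP rr.
  have [D D0 HD] := radius_ge_series (fun k => lnorm_ge0 (Q k)) rQ rr.
  have HC' N : series (fun k => `|leval (P k) (h ord0)|) N <= C.
    by apply: le_trans (HC N); apply: ler_sum => k _; exact: leval_le.
  have HD' N : series (fun k => `|leval (Q k) (h ord0)|) N <= D.
    by apply: le_trans (HD N); apply: ler_sum => k _; exact: leval_le.
  apply: cvg_trans (cvg_conv HC' HD' (cP h hr) (cQ h hr)).
  by apply: near_eq_cvg; near=> n; apply: eq_bigr => k _; rewrite MP.
Unshelve. all: by end_near. Qed.

Lemma analytic_at_affine (c : R) (l : 'I_m -> R) p :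
  analytic_at (fun q : V => c + \sum_i l i * q ord0 i) p.
Proof.
pose P k : @lpoly R m := match k with
  | 0 => [:: (c + \sum_i l i * p ord0 i, [::])]
  | 1 => [seq (l i, [:: i]) | i <- enum 'I_m]
  | _ => [::] end.
apply: (@analytic_list_at _ _ P 1) => //; split.
- case=> [|[|k]] //; rewrite /ldeg; apply/allP => cw /mapP[i _ ->] //.
- move=> rho /andP[r0 r1]; exists (lnorm (P 0%N) + lnorm (P 1%N)) => k.
  apply: (@le_trans _ _ (lnorm (P k))).
    by rewrite ler_piMr ?lnorm_ge0 // exprn_ile1 // ltW.
  case: k => [|[|k]]; rewrite ?lerDl ?lerDr ?lnorm_ge0 //.
  by rewrite {1}/lnorm big_nil addr_ge0 // lnorm_ge0.
- move=> h _; apply: cvg_near_cst; near=> n.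
  have n2 : (2 <= n)%N by near: n; exists 2%N.
  rewrite /series /= -(subnKC n2) big_nat_recl // big_nat_recl // big1_seq.
    rewrite /leval big_seq1 big_nil big_map big_enum /= mulr1 addr0 -addrA.
    congr (_ + _); rewrite -big_split /=; apply: eq_bigr => i _.
    by rewrite big_seq1 mxE mulrDr.
  by move=> k _; rewrite /leval big_nil.
Unshelve. all: by end_near. Qed.

Lemma analytic_at_cst (c : R) p : analytic_at (fun=> c) p.
Proof.
have := analytic_at_affine c (fun=> 0) p; rewrite (_ : (fun q : V => _) = fun=> c) //.
by apply/funext => q; rewrite big1 ?addr0 // => i _; rewrite mul0r.
Qed.

Lemma analytic_at_linear (l : {linear V -> R}) p : analytic_at l p.
Proof.
have := analytic_at_affine 0 (fun i => l (delta_mx ord0 i)) p.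
rewrite (_ : (fun q : V => _) = l) //; apply/funext => q.
rewrite add0r [q in RHS]row_sum_delta linear_sum; apply: eq_bigr => i _.
by rewrite linearZ mulrC.
Qed.

Lemma analytic_at_sum (I : Type) (s : seq I) (f : I -> V -> R) p :
  (forall i, analytic_at (f i) p) -> analytic_at (fun q => \sum_(i <- s) f i q) p.
Proof.
move=> H; elim: s => [|i s IH].
  by rewrite (_ : (fun q => _) = fun=> 0); [exact: analytic_at_cst|
    apply/funext => q; rewrite big_nil].
rewrite (_ : (fun q => _) = fun q => f i q + \sum_(j <- s) f j q).
  exact: analytic_at_add.
by apply/funext => q; rewrite big_cons.
Qed.

Lemma analytic_at_pow f n p : analytic_at f p -> analytic_at (fun q => f q ^+ n) p.
Proof.
move=> Hf; elim: n => [|n IH]; first exact: analytic_at_cst.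
under eq_fun do rewrite exprS; exact: analytic_at_mul.
Qed.

End Closure.

(** * Rearrangement of triangular sums *)

Section Triangle.
Context {R : realType}.
Implicit Types (f : nat -> nat -> R).

(** An indicator in place of dependent bounds lets all indices range over one type, after which sums
    can be exchanged freely. *)
Lemma triangle_sum n a f : (a <= n)%N ->
  \sum_(i < a.+1) f i (a - i)%N =
  \sum_(i < n.+1) \sum_(k < n.+1) (i + k == a)%N%:R * f i k.
Proof.
move=> an; rewrite (big_ord_widen n.+1 (fun i => f i (a - i)%N)) // big_mkcond /=.
apply: eq_bigr => i _; rewrite ltnS; case: leqP => ia.
  have an1 : (a - i < n.+1)%N by rewrite ltnS (leq_trans (leq_subr _ _)).
  rewrite (bigD1 (Ordinal an1)) //= subnKC // eqxx mul1r big1 ?addr0 // => k ka.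
  suff /negbTE -> : (i + k != a)%N by rewrite mul0r.
  by apply: contraNneq ka => ika; apply/eqP/val_inj; rewrite /= -ika addKn.
rewrite big1 // => k _; suff /negbTE -> : (i + k != a)%N by rewrite mul0r.
by rewrite gtn_eqF // (leq_trans ia) // leq_addr.
Qed.

Lemma triangle_le N f : (forall i k, 0 <= f i k) ->
  \sum_(n < N) \sum_(i < n.+1) f i (n - i)%N <= \sum_(i < N) \sum_(k < N) f i k.
Proof.
move=> f0; case: N => [|N]; first by rewrite !big_ord0.
rewrite (eq_bigr (fun n : 'I_N.+1 =>
   \sum_(i < N.+1) \sum_(k < N.+1) (i + k == n)%N%:R * f i k)); last first.
  by move=> n _; apply: triangle_sum; rewrite -ltnS.
rewrite exchange_big /=; apply: ler_sum => i _.
rewrite exchange_big /=; apply: ler_sum => k _.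
rewrite -mulr_suml -[leRHS]mul1r; apply: ler_wpM2r => //.
case: (ltnP (i + k) N.+1) => ikN.
  rewrite (bigD1 (Ordinal ikN)) //= eqxx big1 ?addr0 // => n nik.
  by rewrite eq_sym; case: eqP => // E; case/eqP: nik; apply: val_inj.
rewrite big1 // => n _; case: eqP => // E.
by have := ltn_ord n; rewrite -E ltnNge ikN.
Qed.

Lemma indicator_sum (n p q : nat) (c : R) :
  \sum_(a < n.+1) \sum_(b < n.+1)
    (a + b == n)%N%:R * ((p == a)%N%:R * ((q == b)%N%:R * c)) =
  (p + q == n)%N%:R * c.
Proof.
case: (ltnP p n.+1) => pn; last first.
  have /negbTE -> : (p + q != n)%N by rewrite gtn_eqF // (leq_trans pn) // leq_addr.
  rewrite mul0r big1 // => a _; rewrite big1 // => b _.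
  by rewrite (gtn_eqF (leq_trans (ltn_ord a) pn)) mul0r mulr0.
rewrite (bigD1 (Ordinal pn)) //= [X in _ + X]big1 ?addr0; last first.
  move=> a ap; rewrite big1 // => b _.
  suff /negbTE -> : p != a by rewrite mul0r mulr0.
  by apply: contraNneq ap => E; apply/eqP/val_inj.
under eq_bigr do rewrite eqxx mul1r.
case: (ltnP q n.+1) => qn; last first.
  have /negbTE -> : (p + q != n)%N by rewrite gtn_eqF // (leq_trans qn) // leq_addl.
  rewrite mul0r big1 // => b _.
  by rewrite (gtn_eqF (leq_trans (ltn_ord b) qn)) mul0r mulr0.
rewrite (bigD1 (Ordinal qn)) //= eqxx mul1r big1 ?addr0 // => b bq.
suff /negbTE -> : q != b by rewrite mul0r mulr0.
by apply: contraNneq bq => E; apply/eqP/val_inj.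
Qed.

End Triangle.

(** * The formal Cauchy problem *)

Section FormalSeries.
Context {R : realType}.
Implicit Types (u v g F G : nat -> nat -> R).

(* [u a b] is the coefficient of x^a y^b. *)
Definition fmul u v a b : R :=
  \sum_(i < a.+1) \sum_(j < b.+1) u i j * v (a - i)%N (b - j)%N.
Definition fone a b : R := ((a == 0%N) && (b == 0%N))%:R.
Definition fdx u a b : R := a.+1%:R * u a.+1 b.
Definition fdy u a b : R := b.+1%:R * u a b.+1.

(** Partial sums of the weighted l1 norm, when [u] is nonnegative; a bound uniform in [N] means
    absolute convergence for |x|, |y| at most [eta]. *)
Definition box (N : nat) (eta : R) u : R :=
  \sum_(a < N) \sum_(b < N) u a b * eta ^+ (a + b).

Lemma box_fmul N eta u v : 0 <= eta -> (forall a b, 0 <= u a b) ->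
  (forall a b, 0 <= v a b) ->
  box N eta (fmul u v) <= box N eta u * box N eta v.
Proof.
move=> e0 u0 v0.
pose h i j k l := (u i j * eta ^+ (i + j)) * (v k l * eta ^+ (k + l)).
have h0 i j k l : 0 <= h i j k l by rewrite /h !mulr_ge0 ?exprn_ge0.
have -> : box N eta (fmul u v) =
    \sum_(a < N) \sum_(i < a.+1) \sum_(b < N) \sum_(j < b.+1)
      h i j (a - i)%N (b - j)%N.
  apply: eq_bigr => a _; rewrite [RHS]exchange_big /=; apply: eq_bigr => b _.
  rewrite /fmul mulr_suml; apply: eq_bigr => i _; rewrite mulr_suml.
  apply: eq_bigr => j _; rewrite /h mulrACA -exprD; congr (_ * eta ^+ _).
  have ia : (i <= a)%N by rewrite -ltnS.
  have jb : (j <= b)%N by rewrite -ltnS.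
  by rewrite addnACA !subnKC.
apply: (@le_trans _ _ (\sum_(i < N) \sum_(k < N) \sum_(b < N) \sum_(j < b.+1)
      h i j k (b - j)%N)).
  apply: (@triangle_le _ N (fun i k => \sum_(b < N) \sum_(j < b.+1)
      h i j k (b - j)%N)) => i k.
  by apply: sumr_ge0 => b _; apply: sumr_ge0.
apply: (@le_trans _ _ (\sum_(i < N) \sum_(k < N) \sum_(j < N) \sum_(l < N) h i j k l)).
  by do 2 (apply: ler_sum => ? _); apply: (triangle_le N (f := fun j l => h _ j _ l)).
rewrite /box mulr_suml; apply: ler_sum => i _.
rewrite exchange_big /= mulr_suml; apply: ler_sum => j _.
rewrite mulr_sumr; apply: ler_sum => k _; rewrite mulr_sumr.
by apply: ler_sum.
Qed.

Definition ser u (z : R * R) (n : nat) : R :=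
  \sum_(i < n.+1) u i (n - i)%N * (z.1 ^+ i * z.2 ^+ (n - i)).

(** Both sides are the sum of [T i j k l] over i + j + k + l = n. On the left the indices are
    grouped by variable, as i + k and j + l; on the right by factor, as i + j and k + l. *)
Lemma ser_fmul u v z n : ser (fmul u v) z n = conv (ser u z) (ser v z) n.
Proof.
pose U i j := u i j * (z.1 ^+ i * z.2 ^+ j).
pose V i j := v i j * (z.1 ^+ i * z.2 ^+ j).
pose T i j k l := U i j * V k l.
transitivity (\sum_(i < n.+1) \sum_(j < n.+1) \sum_(k < n.+1) \sum_(l < n.+1)
   ((i + k) + (j + l) == n)%N%:R * T i j k l).
  pose g a b := \sum_(i < n.+1) \sum_(k < n.+1) (i + k == a)%N%:R *
     \sum_(j < n.+1) \sum_(l < n.+1) (j + l == b)%N%:R * T i j k l.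
  transitivity (\sum_(a < n.+1) g a (n - a)%N).
    apply: eq_bigr => a _; have an : (a <= n)%N by rewrite -ltnS.
    rewrite /fmul mulr_suml.
    rewrite (eq_bigr (fun i : 'I_a.+1 => \sum_(j < (n - a).+1)
       T i j (a - i)%N (n - a - j)%N)); last first.
      move=> i _; rewrite mulr_suml; apply: eq_bigr => j _; rewrite /T /U /V.
      have ia : (i <= a)%N by rewrite -ltnS.
      have jb : (j <= n - a)%N by rewrite -ltnS.
      have -> : z.1 ^+ a = z.1 ^+ i * z.1 ^+ (a - i) by rewrite -exprD subnKC.
      have -> : z.2 ^+ (n - a) = z.2 ^+ j * z.2 ^+ (n - a - j).
        by rewrite -exprD subnKC.
      ring.
    rewrite (@triangle_sum _ n a (fun i k => \sum_(j < (n - a).+1)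
       T i j k (n - a - j)%N)) //; apply: eq_bigr => i _; apply: eq_bigr => k _.
    congr (_ * _); rewrite (@triangle_sum _ n (n - a) (fun j l => T i j k l)) //.
    exact: leq_subr.
  rewrite (@triangle_sum _ n n g) // /g.
  under eq_bigr do under eq_bigr do rewrite mulr_sumr.
  under eq_bigr do rewrite exchange_big /=.
  rewrite exchange_big /=; apply: eq_bigr => i _; rewrite [RHS]exchange_big /=.
  under eq_bigr do under eq_bigr do rewrite mulr_sumr.
  under eq_bigr do rewrite exchange_big /=.
  rewrite exchange_big /=; apply: eq_bigr => k _.
  under eq_bigr do under eq_bigr do rewrite !mulr_sumr.
  under eq_bigr do rewrite exchange_big /=.
  rewrite exchange_big /=; apply: eq_bigr => j _.
  under eq_bigr do under eq_bigr do rewrite !mulr_sumr.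
  under eq_bigr do rewrite exchange_big /=.
  rewrite exchange_big /=; apply: eq_bigr => l _.
  exact: indicator_sum.
pose g p q := \sum_(i < n.+1) \sum_(j < n.+1) (i + j == p)%N%:R *
   \sum_(k < n.+1) \sum_(l < n.+1) (k + l == q)%N%:R * T i j k l.
transitivity (\sum_(p < n.+1) g p (n - p)%N); last first.
  apply: eq_bigr => p _; have pn : (p <= n)%N by rewrite -ltnS.
  rewrite /ser (@triangle_sum _ n p U) // mulr_suml; apply: eq_bigr => i _.
  rewrite mulr_suml; apply: eq_bigr => j _; rewrite -mulrA; congr (_ * _).
  rewrite (@triangle_sum _ n (n - p) V) ?leq_subr // mulr_sumr.
  apply: eq_bigr => k _; rewrite mulr_sumr; apply: eq_bigr => l _.
  by rewrite /T mulrCA.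
rewrite (@triangle_sum _ n n g) // /g.
under [RHS]eq_bigr do under eq_bigr do rewrite mulr_sumr.
under [RHS]eq_bigr do rewrite exchange_big /=.
rewrite [RHS]exchange_big /=; apply: eq_bigr => i _.
under [RHS]eq_bigr do under eq_bigr do rewrite mulr_sumr.
under [RHS]eq_bigr do rewrite exchange_big /=.
rewrite [RHS]exchange_big /=; apply: eq_bigr => j _.
under [RHS]eq_bigr do under eq_bigr do rewrite !mulr_sumr.
under [RHS]eq_bigr do rewrite exchange_big /=.
rewrite [RHS]exchange_big /=; apply: eq_bigr => k _.
under [RHS]eq_bigr do under eq_bigr do rewrite !mulr_sumr.
under [RHS]eq_bigr do rewrite exchange_big /=.
rewrite [RHS]exchange_big /=; apply: eq_bigr => l _.
by rewrite indicator_sum addnACA.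
Qed.

Lemma ser_abs_le u z eta N : `|z.1| <= eta -> `|z.2| <= eta ->
  series (fun n => `|ser u z n|) N <= box N eta (fun a b => `|u a b|).
Proof.
move=> z1 z2; have e0 : 0 <= eta by exact: le_trans z1.
rewrite /series /= big_mkord; apply: le_trans (triangle_le N
  (f := fun a b => `|u a b| * eta ^+ (a + b)) _); last first.
  by move=> i k; rewrite mulr_ge0 // exprn_ge0.
apply: ler_sum => n _; apply: (le_trans (ler_norm_sum _ _ _)).
apply: ler_sum => i _; rewrite normrM; apply: ler_wpM2l => //.
rewrite normrM !normrX exprD; apply: ler_pM; rewrite ?exprn_ge0 //.
  by apply: lerXn2r; rewrite ?nnegrE.
by apply: lerXn2r; rewrite ?nnegrE.
Qed.

Lemma fmul_eq u u' v v' a b :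
  (forall i j, (i <= a)%N -> (j <= b)%N -> u i j = u' i j) ->
  (forall i j, (i <= a)%N -> (j <= b)%N -> v i j = v' i j) ->
  fmul u v a b = fmul u' v' a b.
Proof.
move=> uu vv; apply: eq_bigr => i _; apply: eq_bigr => j _.
by rewrite uu ?vv ?leq_subr // -ltnS.
Qed.

Lemma fmul_le u v F G a b : (forall a b, `|u a b| <= F a b) ->
  (forall a b, `|v a b| <= G a b) -> `|fmul u v a b| <= fmul F G a b.
Proof.
move=> uF vG; apply: (le_trans (ler_norm_sum _ _ _)); apply: ler_sum => i _.
apply: (le_trans (ler_norm_sum _ _ _)); apply: ler_sum => j _.
by rewrite normrM; apply: ler_pM.
Qed.

Lemma fmul_scaler c F G a b :
  fmul F (fun a b => c * G a b) a b = c * fmul F G a b.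
Proof.
rewrite /fmul mulr_sumr; apply: eq_bigr => i _; rewrite mulr_sumr.
by apply: eq_bigr => j _; rewrite mulrCA.
Qed.

Lemma fmul_one u a b : fmul u fone a b = u a b.
Proof.
rewrite /fmul big_ord_recr /= [X in X + _]big1 ?add0r => [|i _]; last first.
  by rewrite big1 // => j _; rewrite /fone subn_eq0 leqNgt ltn_ord mulr0.
rewrite big_ord_recr /= big1 ?add0r => [|j _]; last first.
  by rewrite /fone [(b - j == 0)%N]subn_eq0 leqNgt ltn_ord andbF mulr0.
by rewrite /fone !subnn mulr1.
Qed.

End FormalSeries.

(** * Substitution of series without constant term *)

Section Composition.
Context {R : realType} {m : nat}.
Implicit Types (u v g : nat -> nat -> R) (U : 'I_m -> nat -> nat -> R)
  (P : nat -> @lpoly R m) (w : seq 'I_m).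

Definition act U w g := foldr (fun i acc => fmul (U i) acc) g w.

(* P(U) * g, truncated to k <= a + b: the [U i] have no constant term, so the
   degree [k] part of [P] contributes only to total degrees at least [k]. *)
Definition fcomp P U g a b : R :=
  \sum_(k < (a + b).+1) \sum_(cw <- P k) cw.1 * act U cw.2 g a b.

Lemma act_eq0 U w g a b : (forall i, U i 0%N 0%N = 0) -> (a + b < size w)%N ->
  act U w g a b = 0.
Proof.
move=> U0; elim: w a b => [//|i w IH] a b /=; rewrite ltnS => abw.
apply: big1 => j _; apply: big1 => k _.
have ja : (j <= a)%N by rewrite -ltnS. 
have kb : (k <= b)%N by rewrite -ltnS. 
case: (posnP (j + k)) => jk.
  have [-> ->] : nat_of_ord j = 0%N /\ nat_of_ord k = 0%N by lia.
  by rewrite U0 mul0r.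
by rewrite IH ?mulr0 //; lia.
Qed.

Lemma ser_fcomp P U g z n : ser (fcomp P U g) z n =
  \sum_(k < n.+1) \sum_(cw <- P k) cw.1 * ser (act U cw.2 g) z n.
Proof.
rewrite /ser.
under [RHS]eq_bigr do under eq_bigr do rewrite mulr_sumr.
under [RHS]eq_bigr do rewrite exchange_big /=.
rewrite [RHS]exchange_big /=; apply: eq_bigr => i _.
rewrite /fcomp subnKC; last by rewrite -ltnS.
rewrite mulr_suml; apply: eq_bigr => k _; rewrite mulr_suml.
by apply: eq_bigr => cw _; rewrite -mulrA.
Qed.

Lemma series_act U w g z (s Q : R) :
  (forall i N, series (fun n => `|ser (U i) z n|) N <= s) ->
  (forall N, series (fun n => `|ser g z n|) N <= Q) ->
  forall N, series (fun n => `|ser (act U w g) z n|) N <= s ^+ size w * Q.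
Proof.
move=> Us gQ; elim: w => [|i w IH] N /=; first by rewrite mul1r.
rewrite exprS -mulrA; have := series_abs_conv N (Us i) IH.
by apply: le_trans; apply: ler_sum => n _; rewrite ser_fmul.
Qed.

Lemma cvg_act U w g z (s Q q : R) (p : 'I_m -> R) :
  (forall i N, series (fun n => `|ser (U i) z n|) N <= s) ->
  (forall N, series (fun n => `|ser g z n|) N <= Q) ->
  (forall i, series (ser (U i) z) @ \oo --> p i) ->
  series (ser g z) @ \oo --> q ->
  series (ser (act U w g) z) @ \oo --> (\prod_(i <- w) p i) * q.
Proof.
move=> Us gQ Up gq; elim: w => [|i w IH]; first by rewrite big_nil mul1r.
have := cvg_conv (Us i) (series_act w Us gQ) (Up i) IH.
rewrite big_cons -mulrA; apply: cvg_trans; apply: near_eq_cvg; near=> N.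
by apply: eq_bigr => n _; rewrite ser_fmul.
Unshelve. all: by end_near. Qed.

(** The partial sums in total degree are triangular sums over the degree k of [P]. A word of length
    k contributes at most s^k Q, so lnorm(P k) s^k Q dominates, and it is summable because s < r. *)
Lemma fcomp_eval P U g z (s Q q r : R) (p : 'I_m -> R) (l : R) :
  (forall i, U i 0%N 0%N = 0) -> (forall k, ldeg k (P k)) ->
  radius_ge (fun k => lnorm (P k)) r -> 0 < s < r ->
  (forall i N, series (fun n => `|ser (U i) z n|) N <= s) ->
  (forall N, series (fun n => `|ser g z n|) N <= Q) ->
  (forall i, series (ser (U i) z) @ \oo --> p i) ->
  series (ser g z) @ \oo --> q ->
  series (fun k => leval (P k) p) @ \oo --> l ->
  series (ser (fcomp P U g) z) @ \oo --> l * q.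
Proof.
move=> U0 dP rP sr Us gQ Up gq Pl.
pose a N k := \sum_(cw <- P k) cw.1 * series (ser (act U cw.2 g) z) N.
pose A k := leval (P k) p * q.
have Q0 : 0 <= Q by apply: le_trans (gQ 0%N); rewrite /series /= big_geq.
have s0 : 0 <= s by case/andP: sr => /ltW.
have cb : cvgn (series (fun k => lnorm (P k) * s ^+ k * Q)).
  have [C C0 HC] := radius_ge_series (fun k => lnorm_ge0 (P k)) rP sr.
  apply: (@bounded_series_cvg _ _ (C * Q)) => [k|N].
    by rewrite !mulr_ge0 ?lnorm_ge0 // exprn_ge0.
  by rewrite /series /= -mulr_suml; apply: ler_wpM2r => //; exact: HC.
have [||cA HA] := tannery (a := a) (A := A) _ cb.
- move=> N k; apply: (le_trans (ler_norm_sum _ _ _)).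
  rewrite /lnorm !mulr_suml; rewrite [X in X <= _]big_seq [X in _ <= X]big_seq; apply: ler_sum => cw cwP.
  rewrite normrM -mulrA; apply: ler_wpM2l => //.
  have /eqP <- := allP (dP k) cw cwP.
  apply: le_trans (series_act cw.2 Us gQ N); exact: ler_norm_sum.
- move=> k; rewrite /A /leval mulr_suml; apply: cvg_bigsum => cw _.
  rewrite -mulrA; apply: cvgM; first exact: cvg_cst.
  exact: cvg_act Us gQ Up gq.
have <- : limn (series A) = l * q.
  apply: cvg_lim => //.
  rewrite (_ : series A = fun N => series (fun k => leval (P k) p) N * q).
    by apply: cvgM => //; exact: cvg_cst.
  by apply/funext => N; rewrite /series /= mulr_suml.
apply: cvg_trans HA; apply: near_eq_cvg; near=> N.
rewrite /series /= /a big_mkord [RHS]big_mkord.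
under [RHS]eq_bigr do rewrite ser_fcomp.
rewrite (eq_bigr (fun k : 'I_N => \sum_(n < N) \sum_(cw <- P k)
    cw.1 * ser (act U cw.2 g) z n)); last first.
  move=> k _; rewrite exchange_big /=; apply: eq_bigr => cw _.
  by rewrite /series /= big_mkord mulr_sumr.
rewrite exchange_big /=; apply: eq_bigr => n _.
(* Words longer than the total degree contribute nothing ([act_eq0]), so the range of k may be
   extended from n + 1 to [N]. *)
rewrite [RHS](big_ord_widen N (fun k => \sum_(cw <- P k) cw.1 * ser (act U cw.2 g) z n)) //.
rewrite [RHS]big_mkcond /=; apply: eq_bigr => k _.
rewrite ltnS; case: leqP => // nk.
apply: big1_seq => cw /= cwP; rewrite [ser _ _ _]big1 ?mulr0 // => i _.
rewrite act_eq0 ?mul0r // subnKC; last by rewrite -ltnS.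
by have /eqP -> := allP (dP k) cw cwP.
Unshelve. all: by end_near. Qed.

End Composition.

(** * The quadratic majorant *)

Section Majorant.
Context {R : realType} (al be K : R).
Hypotheses (al0 : 0 <= al) (be0 : 0 < be) (K0 : 0 <= K).
Implicit Types (a b N : nat).

Definition maj_lin a b : R :=
  ((a == 1%N) && (b == 0%N))%:R * al + ((a == 0%N) && (b == 1%N))%:R * (K * al).

Fixpoint maj_iter N a b : R :=
  if N is N'.+1 then maj_lin a b + be * fmul (maj_iter N') (maj_iter N') a b
  else 0.

(* The solution F = al (x + K y) + be F^2 without constant term; since it is a
   function of x + K y, it satisfies F_y = K F_x. *)
Definition majorant a b : R := maj_iter (a + b).+1 a b.

Lemma maj_iterS N a b : maj_iter N.+1 a b =
  maj_lin a b + be * fmul (maj_iter N) (maj_iter N) a b.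
Proof. by []. Qed.

Lemma maj_lin_ge0 a b : 0 <= maj_lin a b.
Proof. by rewrite /maj_lin addr_ge0 // !mulr_ge0. Qed.

Lemma maj_iter_ge0 N a b : 0 <= maj_iter N a b.
Proof.
elim: N a b => [//|N IH] a b /=; rewrite addr_ge0 ?maj_lin_ge0 //.
rewrite mulr_ge0 ?(ltW be0) //; apply: sumr_ge0 => i _; apply: sumr_ge0 => j _.
exact: mulr_ge0.
Qed.

Lemma maj_iter00 N : maj_iter N 0%N 0%N = 0.
Proof.
elim: N => [//|N IH] /=.
by rewrite /maj_lin /fmul !big_ord1 IH /= !mul0r mulr0 !addr0.
Qed.

(** Without constant terms, the square involves only coefficients of strictly smaller total degree;
    a coefficient of degree n is final after n + 1 iterations. *)
Lemma maj_iter_stable N M a b : (a + b < N)%N -> (a + b < M)%N ->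
  maj_iter N a b = maj_iter M a b.
Proof.
elim: N M a b => [//|N IH] [//|M] a b; rewrite !ltnS => abN abM /=.
congr (_ + _ * _); apply: eq_bigr => i _; apply: eq_bigr => j _.
have ia : (i <= a)%N by rewrite -ltnS. 
have jb : (j <= b)%N by rewrite -ltnS. 
case: (posnP (i + j)) => ij.
  have [-> ->] : nat_of_ord i = 0%N /\ nat_of_ord j = 0%N by lia.
  by rewrite !maj_iter00 !mul0r.
case: (posnP (a - i + (b - j))) => kl.
  have [-> ->] : (a - i = 0)%N /\ (b - j = 0)%N by lia.
  by rewrite !maj_iter00 !mulr0.
by congr (_ * _); apply: IH; lia.
Qed.

Lemma majorant_ge0 a b : 0 <= majorant a b.
Proof. exact: maj_iter_ge0. Qed.

Lemma majorant00 : majorant 0%N 0%N = 0.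
Proof. exact: maj_iter00. Qed.

Lemma majorantE a b :
  majorant a b = maj_lin a b + be * fmul majorant majorant a b.
Proof.
rewrite {1}/majorant (@maj_iter_stable _ (a + b).+2) // maj_iterS; congr (_ + _ * _).
by apply: fmul_eq => i j ia jb; apply: maj_iter_stable => //; rewrite ltnS leq_add.
Qed.

Lemma fmul_ge0 (u v : nat -> nat -> R) a b : (forall a b, 0 <= u a b) ->
  (forall a b, 0 <= v a b) -> 0 <= fmul u v a b.
Proof. by move=> u0 v0; do 2 apply: sumr_ge0 => ? _; exact: mulr_ge0. Qed.

(** This is the reason for a quadratic equation: be F^2 is F minus a nonnegative linear part. Each
    further factor F costs only 1 / be, so that a power series in F without constant term is
    majorized by a number times F. *)
Lemma majorant_sqr a b : fmul majorant majorant a b <= be^-1 * majorant a b.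
Proof.
rewrite [leRHS]mulrC ler_pdivlMr // mulrC majorantE lerDr; exact: maj_lin_ge0.
Qed.

Lemma leibniz_sum (f : nat -> nat -> R) a :
  a.+1%:R * (\sum_(i < a.+2) f i (a.+1 - i)%N) =
  \sum_(i < a.+1) i.+1%:R * f i.+1 (a - i)%N +
  \sum_(i < a.+1) (a - i).+1%:R * f i (a - i).+1.
Proof.
rewrite mulr_sumr (eq_bigr (fun i : 'I_a.+2 => i%:R * f i (a.+1 - i)%N +
    (a.+1 - i)%:R * f i (a.+1 - i)%N)); last first.
  by move=> i _; rewrite -mulrDl -natrD subnKC // -ltnS.
rewrite big_split /=; congr (_ + _).
  by rewrite big_ord_recl /= mul0r add0r.
rewrite big_ord_recr /= subnn mul0r addr0; apply: eq_bigr => i _ /=.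
by rewrite subSn // -ltnS.
Qed.

Lemma fdx_fmul (u v : nat -> nat -> R) a b :
  fdx (fmul u v) a b = fmul (fdx u) v a b + fmul u (fdx v) a b.
Proof.
rewrite /fdx /fmul.
rewrite (leibniz_sum (fun i k => \sum_(j < b.+1) u i j * v k (b - j)%N)).
congr (_ + _); apply: eq_bigr => i _; rewrite mulr_sumr; apply: eq_bigr => j _.
  by rewrite mulrA.
by rewrite mulrCA.
Qed.

Lemma fdy_fmul (u v : nat -> nat -> R) a b :
  fdy (fmul u v) a b = fmul (fdy u) v a b + fmul u (fdy v) a b.
Proof.
rewrite /fdy /fmul mulr_sumr -big_split /=; apply: eq_bigr => i _.
rewrite (leibniz_sum (fun j l => u i j * v (a - i)%N l)).
by congr (_ + _); apply: eq_bigr => j _; [rewrite mulrA|rewrite mulrCA].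
Qed.

Lemma fdx_majorant a b : fdx majorant a b = al * fone a b +
  be * (fmul (fdx majorant) majorant a b + fmul majorant (fdx majorant) a b).
Proof.
rewrite -fdx_fmul /fdx majorantE mulrDr [X in _ + X]mulrCA; congr (_ + _).
rewrite /maj_lin /fone eqSS /= mul0r addr0.
by case: a => [|a] /=; rewrite ?mul0r ?mulr0 // mul1r mulrC.
Qed.

Lemma fdy_majorant a b : fdy majorant a b = K * al * fone a b +
  be * (fmul (fdy majorant) majorant a b + fmul majorant (fdy majorant) a b).
Proof.
rewrite -fdy_fmul /fdy majorantE mulrDr [X in _ + X]mulrCA; congr (_ + _).
rewrite /maj_lin /fone eqSS /= andbF mul0r add0r.
by case: b => [|b] /=; rewrite ?andbF ?mul0r ?mulr0 // mul1r mulrC.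
Qed.

Lemma fdx_majorant_ge0 a b : 0 <= fdx majorant a b.
Proof. by rewrite mulr_ge0 // majorant_ge0. Qed.

(** The differentiated equation writes F_x as a sum of nonnegative terms, one of which is be F F_x.
    Multiplication by F thus costs 1 / be on F_x as well. *)
Lemma majorant_fdx a b :
  fmul majorant (fdx majorant) a b <= be^-1 * fdx majorant a b.
Proof.
rewrite [leRHS]mulrC ler_pdivlMr // mulrC [in leRHS]fdx_majorant.
rewrite mulrDr addrA lerDr addr_ge0 //; first by rewrite mulr_ge0 // ler0n.
rewrite mulr_ge0 ?(ltW be0) //; apply: fmul_ge0; first exact: fdx_majorant_ge0.
exact: majorant_ge0.
Qed.

(** F_y and K F_x solve the same linear equation, which determines each coefficient from those of
    smaller total degree because F has no constant term. *)
Lemma fdy_fdx_majorant a b : fdy majorant a b = K * fdx majorant a b.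
Proof.
have [n] := ubnP (a + b)%N; elim: n a b => [//|n IH] a b abn.
rewrite fdy_majorant fdx_majorant [RHS]mulrDr mulrA; congr (_ + _).
rewrite [RHS]mulrCA; congr (_ * _); rewrite [RHS]mulrDr; congr (_ + _);
  rewrite /fmul mulr_sumr; apply: eq_bigr => i _; rewrite mulr_sumr;
  apply: eq_bigr => j _;
  have ia := ltn_ord i; have jb := ltn_ord j.
- case: (posnP (a - i + (b - j))) => kl.
    have [-> ->] : (a - i = 0)%N /\ (b - j = 0)%N by lia.
    by rewrite majorant00 !mulr0.
  by rewrite (IH i j); [rewrite [RHS]mulrA|lia].
- case: (posnP (i + j)) => ij.
    have [-> ->] : nat_of_ord i = 0%N /\ nat_of_ord j = 0%N by lia.
    by rewrite majorant00 !mul0r mulr0.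
  by rewrite (IH (a - i)%N (b - j)%N); [rewrite [RHS]mulrCA|lia].
Qed.

Lemma majorant10 : majorant 1%N 0%N = al.
Proof.
rewrite majorantE /maj_lin /= mul1r mul0r addr0 /fmul.
rewrite big_ord_recl big_ord1 !big_ord1 /= majorant00.
by rewrite mul0r mulr0 !addr0 mulr0 addr0.
Qed.

(** In the square only the product of the coefficients of x and of x^a is kept, the former being
    [al]. The result is F_x >= al be F along the x-axis, in positive degrees, which is what the
    differential equation for the Cauchy data requires. *)
Lemma majorant_row a : (0 < a)%N ->
  al * be * majorant a 0%N <= a.+1%:R * majorant a.+1 0%N.
Proof.
case: a => // a _.
apply: (@le_trans _ _ (majorant a.+2 0%N)); last first.
  by rewrite ler_peMl ?majorant_ge0 // ler1n.
rewrite [leRHS]majorantE -[leLHS]add0r; apply: lerD; first exact: maj_lin_ge0.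
rewrite [al * be]mulrC -mulrA; apply: ler_wpM2l; first exact: ltW.
rewrite /fmul (bigD1 (lift ord0 ord0)) //= !big_ord1 /= -[leLHS]addr0.
apply: lerD; first by rewrite majorant10 subn1.
by apply: sumr_ge0 => i _; apply: sumr_ge0 => j _; rewrite mulr_ge0 // majorant_ge0.
Qed.

Lemma sum_delta_le N p q (h : nat -> nat -> R) : (forall a b, 0 <= h a b) ->
  \sum_(a < N) \sum_(b < N) ((a == p :> nat) && (b == q :> nat))%:R * h a b <= h p q.
Proof.
move=> h0.
have row (a : nat) : \sum_(b < N) ((a == p) && (b == q :> nat))%:R * h a b
    <= (a == p)%:R * h a q.
  case: eqP => [->|_]; last by rewrite mul0r big1 // => b _; rewrite mul0r.
  rewrite mul1r; case: (ltnP q N) => qN; last first.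
    rewrite big1 // => b _; case: eqP => [E|_]; last by rewrite mul0r.
    by have := ltn_ord b; rewrite E ltnNge qN.
  rewrite (bigD1 (Ordinal qN)) //= eqxx mul1r big1 ?addr0 // => b bq.
  suff /negbTE -> : nat_of_ord b != q by rewrite mul0r.
  by apply: contraNneq bq => E; apply/eqP/val_inj.
apply: (@le_trans _ _ (\sum_(a < N) (a == p :> nat)%:R * h a q)).
  by apply: ler_sum => a _; exact: row.
case: (ltnP p N) => pN; last first.
  rewrite big1 // => a _; case: eqP => [E|_]; last by rewrite mul0r.
  by have := ltn_ord a; rewrite E ltnNge pN.
rewrite (bigD1 (Ordinal pN)) //= eqxx mul1r big1 ?addr0 // => a ap.
suff /negbTE -> : nat_of_ord a != p by rewrite mul0r.
by apply: contraNneq ap => E; apply/eqP/val_inj.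
Qed.

Lemma box_maj_lin N eta : 0 <= eta -> box N eta maj_lin <= (1 + K) * al * eta.
Proof.
move=> e0.
rewrite /box (eq_bigr (fun a : 'I_N =>
  (\sum_(b < N) ((a == 1%N :> nat) && (b == 0%N :> nat))%:R * (al * eta ^+ (a + b)))
  + \sum_(b < N) ((a == 0%N :> nat) && (b == 1%N :> nat))%:R * (K * al * eta ^+ (a + b))));
  last first.
  move=> a _; rewrite -big_split /=; apply: eq_bigr => b _.
  by rewrite /maj_lin mulrDl -!mulrA.
rewrite big_split /= [leRHS](_ : _ = al * eta + K * al * eta); last by ring.
apply: lerD.
  have := @sum_delta_le N 1 0 (fun a b => al * eta ^+ (a + b)).
  by rewrite expr1; apply => a b; rewrite mulr_ge0 // exprn_ge0.
have := @sum_delta_le N 0 1 (fun a b => K * al * eta ^+ (a + b)).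
by rewrite expr1; apply => a b; rewrite mulr_ge0 ?exprn_ge0 // mulr_ge0.
Qed.

(** With c the bound on the linear part, the bound 2c is preserved by the iteration: c + be (2c)^2
    <= 2c as soon as 4 be c <= 1. *)
Lemma box_majorant N eta : 0 <= eta -> 4 * be * ((1 + K) * al * eta) <= 1 ->
  box N eta majorant <= 2 * ((1 + K) * al * eta).
Proof.
move=> e0; set c := (1 + K) * al * eta => bc.
have c0 : 0 <= c by rewrite !mulr_ge0 // addr_ge0.
have box0 u : (forall a b, 0 <= u a b) -> 0 <= box N eta u.
  move=> u0; apply: sumr_ge0 => a _; apply: sumr_ge0 => b _.
  by rewrite mulr_ge0 // exprn_ge0.
suff H M : box N eta (maj_iter M) <= 2 * c.
  apply: le_trans (H (N + N)%N); rewrite le_eqVlt; apply/orP; left; apply/eqP.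
  apply: eq_bigr => a _; apply: eq_bigr => b _; congr (_ * _).
  apply: maj_iter_stable => //; have := ltn_ord a; have := ltn_ord b; lia.
elim: M => [|M IH].
  rewrite /box /= big1 => [|a _]; first by apply: mulr_ge0.
  by rewrite big1 // => b _; rewrite mul0r.
have -> : box N eta (maj_iter M.+1) = box N eta maj_lin
    + be * box N eta (fmul (maj_iter M) (maj_iter M)).
  rewrite /box mulr_sumr -big_split /=; apply: eq_bigr => a _.
  rewrite mulr_sumr -big_split /=; apply: eq_bigr => b _.
  by rewrite mulrDl mulrA.
have H1 := box_maj_lin N e0.
have H2 := box_fmul N e0 (maj_iter_ge0 M) (maj_iter_ge0 M).
have H3 : box N eta (maj_iter M) * box N eta (maj_iter M) <= (2 * c) * (2 * c).
  by apply: ler_pM => //; apply: box0; exact: maj_iter_ge0.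
have H4 : be * box N eta (fmul (maj_iter M) (maj_iter M)) <= be * ((2 * c) * (2 * c)).
  by apply: ler_wpM2l; [exact: ltW|exact: le_trans H3].
have : c * (4 * be * c) <= c * 1 by apply: ler_wpM2l.
rewrite -/c in H1; lra.
Qed.

End Majorant.

(** * Existence and majorization of the formal solution *)

Section FormalSolution.
Context {R : realType} {m : nat}.
Variables (PX : 'I_m -> nat -> @lpoly R m) (PJ : 'I_m -> 'I_m -> nat -> @lpoly R m).
Implicit Types (U V : 'I_m -> nat -> nat -> R) (a b : nat).

Lemma act_agree U U' w (g g' : nat -> nat -> R) a b :
  (forall i p q, (p <= a)%N -> (q <= b)%N -> U i p q = U' i p q) ->
  (forall p q, (p <= a)%N -> (q <= b)%N -> g p q = g' p q) ->
  act U w g a b = act U' w g' a b.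
Proof.
elim: w a b => [|i w IH] a b UU gg /=; first exact: gg.
apply: fmul_eq => p q pa qb; first exact: UU.
by apply: IH => [j|] p' q' p'p q'q; [apply: UU|apply: gg];
  rewrite ?(leq_trans p'p) ?(leq_trans q'q).
Qed.

Lemma fcomp_agree P U U' (g g' : nat -> nat -> R) a b :
  (forall i p q, (p <= a)%N -> (q <= b)%N -> U i p q = U' i p q) ->
  (forall p q, (p <= a)%N -> (q <= b)%N -> g p q = g' p q) ->
  fcomp P U g a b = fcomp P U' g' a b.
Proof.
move=> UU gg; apply: eq_bigr => k _; apply: eq_bigr => cw _.
by congr (_ * _); exact: act_agree.
Qed.

(** One round of formal integration: in x for the Cauchy data on the row b = 0, in y for the
    evolution equation on the other rows. *)
Definition cauchy_step U (j : 'I_m) a b : R :=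
  match b with
  | 0 => match a with
         | 0 => 0
         | a'.+1 => a'.+1%:R^-1 * fcomp (PX j) U fone a' 0%N
         end
  | b'.+1 => b'.+1%:R^-1 * \sum_i fcomp (PJ i j) U (fdx (U i)) a b'
  end.

(* The coefficient of x^a y^b produced by [cauchy_step] involves only
   coefficients of smaller weight a + 2 b. *)
Lemma cauchy_step_causal U U' N :
  (forall j a b, (a + 2 * b < N)%N -> U j a b = U' j a b) ->
  forall j a b, (a + 2 * b < N.+1)%N -> cauchy_step U j a b = cauchy_step U' j a b.
Proof.
move=> UU j a [|b] abN /=.
  case: a abN => [//|a] aN; congr (_ * _); apply: fcomp_agree => // i p q pa qb.
  by apply: UU; lia.
congr (_ * _); apply: eq_bigr => i _; apply: fcomp_agree => [k|] p q pa qb.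
  by apply: UU; lia.
by rewrite /fdx UU //; lia.
Qed.

Definition cauchy_iter N : 'I_m -> nat -> nat -> R :=
  iter N cauchy_step (fun _ _ _ => 0).

Lemma cauchy_iter_stable N j a b : (a + 2 * b < N)%N ->
  cauchy_iter N.+1 j a b = cauchy_iter N j a b.
Proof.
elim: N j a b => [//|N IH] j a b abN.
rewrite /cauchy_iter iterS [in RHS]iterS; apply: cauchy_step_causal abN => {}j {}a {}b.
exact: IH.
Qed.

Definition cauchy_series j a b : R := cauchy_iter (a + 2 * b).+1 j a b.

Lemma cauchy_series_iter N j a b : (a + 2 * b < N)%N ->
  cauchy_series j a b = cauchy_iter N j a b.
Proof.
move=> abN; rewrite /cauchy_series -(subnKC abN).
by elim: (N - _)%N => [|k IH]; rewrite ?addn0 // addnS [RHS]cauchy_iter_stable //; lia.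
Qed.

Lemma cauchy_seriesE j a b : cauchy_series j a b = cauchy_step cauchy_series j a b.
Proof.
rewrite (@cauchy_series_iter (a + 2 * b).+2) // /cauchy_iter iterS.
apply: (@cauchy_step_causal _ _ (a + 2 * b).+1) => // {}j p q pq.
by rewrite (@cauchy_series_iter (a + 2 * b).+1).
Qed.

Variables (r : R).
Hypotheses (r0 : 0 < r).
Hypotheses (dX : forall j k, ldeg k (PX j k)) (dJ : forall i j k, ldeg k (PJ i j k)).
Hypotheses (rX : forall j, radius_ge (fun k => lnorm (PX j k)) r).
Hypotheses (rJ : forall i j, radius_ge (fun k => lnorm (PJ i j k)) r).

(** Each letter of the word costs one factor [de]. The majorant [G] of the last factor is F for the
    equation in x and F_x for the equation in y. *)
Lemma act_le (U : 'I_m -> nat -> nat -> R) w (g F G : nat -> nat -> R) (de : R) :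
  0 <= de -> (forall a b, 0 <= F a b) ->
  (forall i a b, `|U i a b| <= F a b) -> (forall a b, `|g a b| <= G a b) ->
  (forall a b, fmul F G a b <= de * G a b) ->
  forall a b, `|act U w g a b| <= de ^+ size w * G a b.
Proof.
move=> de0 F0 UF gG FG; elim: w => [|i w IH] a b /=; first by rewrite mul1r.
apply: (le_trans (fmul_le a b (UF i) IH)); rewrite fmul_scaler exprSr -mulrA.
by apply: ler_wpM2l => //; exact: exprn_ge0.
Qed.

Lemma uniform_bound : exists2 C, 0 <= C & forall j n,
  series (fun k => lnorm (PX j k) * (r / 2) ^+ k) n <= C /\
  forall i, series (fun k => lnorm (PJ i j k) * (r / 2) ^+ k) n <= C.
Proof.
have rr : 0 < r / 2 < r by have := r0; lra.
have [cX cX0 HX] := fin_all_exists2 (fun j => radius_ge_series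
  (fun k => lnorm_ge0 (PX j k)) (@rX j) rr).
have HJ' j := fin_all_exists2 (fun i => radius_ge_series
  (fun k => lnorm_ge0 (PJ i j k)) (@rJ i j) rr).
have [cJ cJ0 HJ] := fin_all_exists2 HJ'.
have le1 (I : finType) (c : I -> R) i : (forall i, 0 <= c i) -> c i <= \sum_i c i.
  by move=> c0; rewrite (bigD1 i) //= lerDl sumr_ge0.
exists (\sum_j cX j + \sum_j \sum_i cJ j i) => [|j n].
  by rewrite addr_ge0 // sumr_ge0 // => j _; rewrite sumr_ge0.
split=> [|i].
  apply: (le_trans (HX j n)); apply: (le_trans (le1 _ _ j cX0)); rewrite lerDl.
  by apply: sumr_ge0 => k _; exact: sumr_ge0.
apply: (le_trans (HJ j i n)); apply: (le_trans (le1 _ _ i (cJ0 j))).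
apply: (le_trans (le1 _ (fun j => \sum_i cJ j i) j _)).
  by move=> k; exact: sumr_ge0.
by rewrite lerDr sumr_ge0.
Qed.

Theorem formal_solution : exists U : 'I_m -> nat -> nat -> R,
  [/\ forall i, U i 0%N 0%N = 0,
      forall j a, fdx (U j) a 0%N = fcomp (PX j) U fone a 0%N,
      forall j a b, fdy (U j) a b = \sum_i fcomp (PJ i j) U (fdx (U i)) a b &
      forall s, 0 < s -> exists2 eta, 0 < eta &
        forall i N, box N eta (fun a b => `|U i a b|) <= s].
Proof.
have [C C0 HC] := uniform_bound.
(* [C] sums the coefficients at radius [de]; [be] makes each factor F cost [de]; [al] dominates a
   component of X, and [K] the sum over the m entries of a column of J. The added 1 makes them
   positive. *)
pose de := r / 2; have de0 : 0 < de by have := r0; rewrite /de; lra.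
pose al := C + 1; pose be := de^-1; pose K := m%:R * C + 1.
have al0 : 0 < al by rewrite /al; lra.
have be0 : 0 < be by rewrite invr_gt0.
have mC : 0 <= m%:R * C by rewrite mulr_ge0.
have K0 : 0 < K by rewrite /K; lra.
have al0' := ltW al0; have K0' := ltW K0.
pose F := majorant al be K.
have F0 a b : 0 <= F a b by exact: majorant_ge0.
have FF a b : fmul F F a b <= de * F a b.
  by have := @majorant_sqr _ al be K al0' be0 K0' a b; rewrite invrK.
have FFx a b : fmul F (fdx F) a b <= de * fdx F a b.
  by have := @majorant_fdx _ al be K al0' be0 K0' a b; rewrite invrK.
have stepF U : (forall i a b, `|U i a b| <= F a b) ->
    forall i a b, `|cauchy_step U i a b| <= F a b.
  move=> UF j a [|b] /=.
    case: a => [|a]; first by rewrite normr0.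
    rewrite normrM ger0_norm ?invr_ge0 // ler_pdivrMl ?ltr0n //.
    (* The empty word leaves [fone], which F does not majorize, and is kept apart. In a longer word
       the last letter times [fone] is bounded by F itself, so that only k - 1 factors [de]
       remain. *)
    have fc : `|fcomp (PX j) U fone a 0| <= \sum_(k < a.+1)
        lnorm (PX j k) * (if k == 0%N :> nat then fone a 0 else de ^+ k.-1 * F a 0%N).
      rewrite /fcomp addn0; apply: (le_trans (ler_norm_sum _ _ _)).
      apply: ler_sum => k _; apply: (le_trans (ler_norm_sum _ _ _)).
      rewrite /lnorm mulr_suml big_seq [leRHS]big_seq; apply: ler_sum => cw cwP.
      rewrite normrM; apply: ler_wpM2l => //.
      have /eqP <- := allP (dX j k) cw cwP.
      case/lastP: {cwP} cw.2 => [|w i] /=; first by rewrite ger0_norm // /fone ler0n.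
      rewrite size_rcons /= /act -cats1 foldr_cat /=.
      apply: (act_le (F := F) (G := F) w _ F0 UF) => //; first exact: ltW.
      by move=> p q; rewrite fmul_one.
    (* For a = 0 the value of X at 0 is compared with the first coefficient [al] of F; for a > 0 the
       term [fone] vanishes and [majorant_row] concludes. *)
    apply: (le_trans fc); case: a fc => [|a] _.
      rewrite big_ord1 /= mul1r; apply: (@le_trans _ _ C).
        by have [] := HC j 1%N; rewrite /series /= big_nat1 expr0 mulr1.
      by rewrite /F majorant10 // /al lerDl.
    apply: le_trans (majorant_row al0' be0 K0' _) => //.
    apply: (@le_trans _ _ (C * be * F a.+1 0%N)); last first.
      by apply: ler_wpM2r => //; apply: ler_wpM2r; [exact: ltW|rewrite /al lerDl].
    apply: (@le_trans _ _ (\sum_(k < a.+2) lnorm (PX j k) * de ^+ k * (be * F a.+1 0%N))).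
      apply: ler_sum => k _; rewrite -mulrA; apply: ler_wpM2l; first exact: lnorm_ge0.
      case: eqP => [->|/eqP k0].
        by rewrite /fone /= expr0 mul1r mulr_ge0 // ltW.
      rewrite mulrA; apply: ler_wpM2r => //.
      by rewrite -{2}(prednK (n := k)) ?lt0n // exprSr /be mulfK // gt_eqF.
    rewrite -mulr_suml -mulrA; apply: ler_wpM2r.
      by rewrite mulr_ge0 // ltW.
    by have [] := HC j a.+2; rewrite /series /= big_mkord.
  rewrite normrM ger0_norm ?invr_ge0 // ler_pdivrMl ?ltr0n //.
  rewrite -[leRHS]/(fdy F a b) /F fdy_fdx_majorant // -/F.
  apply: (le_trans (ler_norm_sum _ _ _)).
  have Fx0 : 0 <= fdx F a b by exact: fdx_majorant_ge0.
  apply: (@le_trans _ _ (\sum_(i < m) C * fdx F a b)); last first.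
    rewrite sumr_const card_ord -[leLHS]mulr_natl mulrA; apply: ler_wpM2r => //.
    by rewrite /K lerDl.
  apply: ler_sum => i _; rewrite /fcomp.
  apply: (@le_trans _ _ (\sum_(k < (a + b).+1) lnorm (PJ i j k) * de ^+ k * fdx F a b)).
    apply: (le_trans (ler_norm_sum _ _ _)).
    apply: ler_sum => k _; apply: (le_trans (ler_norm_sum _ _ _)).
    rewrite /lnorm !mulr_suml big_seq [leRHS]big_seq; apply: ler_sum => cw cwP.
    rewrite normrM -mulrA; apply: ler_wpM2l => //.
    have /eqP <- := allP (dJ i j k) cw cwP.
    apply: (act_le (F := F) (G := fdx F) cw.2 _ F0 UF) => //; first exact: ltW.
    move=> p q; rewrite /fdx normrM ger0_norm //; exact: ler_wpM2l.
  rewrite -mulr_suml; apply: ler_wpM2r => //.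
  by have [_ /(_ i)] := HC j (a + b).+1; rewrite /series /= big_mkord.
have iterF N i a b : `|cauchy_iter N i a b| <= F a b.
  elim: N i a b => [|N IH] i a b; first by rewrite normr0.
  by rewrite /cauchy_iter iterS; exact: stepF.
exists cauchy_series; split.
- by move=> i; rewrite cauchy_seriesE.
- move=> j a; rewrite /fdx cauchy_seriesE /=.
  by rewrite mulrA divff ?mul1r // pnatr_eq0.
- move=> j a b; rewrite {1}/fdy cauchy_seriesE /=.
  by rewrite mulrA divff ?mul1r // pnatr_eq0.
- move=> s s0; pose c := (1 + K) * al.
  have c0 : 0 < c by rewrite mulr_gt0 // addr_gt0.
  have H4 : 0 < 4 * be * c by apply: mulr_gt0 => //; apply: mulr_gt0.
  have H2 : 0 < 2 * c by apply: mulr_gt0.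
  (* The first bound makes [box_majorant] applicable, the second makes its conclusion at most
     [s]. *)
  pose eta := Num.min ((4 * be * c)^-1) (s / (2 * c)).
  have eta0 : 0 < eta.
    by rewrite lt_min invr_gt0 H4 divr_gt0.
  exists eta => // i N.
  apply: (@le_trans _ _ (box N eta F)).
    apply: ler_sum => a _; apply: ler_sum => b _; apply: ler_wpM2r.
      by rewrite exprn_ge0 // ltW.
    exact: iterF.
  apply: (@le_trans _ _ (2 * (c * eta))).
    apply: box_majorant => //; first exact: ltW.
    rewrite -/c mulrA -ler_pdivlMl // mulr1 ge_min lexx //.
  by rewrite mulrA -ler_pdivlMl // [_^-1 * s]mulrC ge_min lexx orbT.
Qed.

End FormalSolution.

(** * From formal series to functions of (x, y) *)

Section SerFunction.
Context {R : realType}.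
Implicit Types (u : nat -> nat -> R) (z : R * R).

Lemma fst_unit_form : unit_form (fun z : R * R => z.1).
Proof. by split=> // z; rewrite [leRHS]prod_normE le_max lexx. Qed.

Lemma snd_unit_form : unit_form (fun z : R * R => z.2).
Proof. by split=> // z; rewrite [leRHS]prod_normE le_max lexx orbT. Qed.

Lemma hom_monomial a b : hom (a + b) 1 (fun z : R * R => z.1 ^+ a * z.2 ^+ b).
Proof.
elim: a => [|a IH]; last first.
  rewrite (_ : (fun z : R * R => _) = fun z : R * R => z.1 * (z.1 ^+ a * z.2 ^+ b)).
    exact: HomL fst_unit_form IH.
  by apply/funext => z; rewrite exprS mulrA.
elim: b => [|b IH].
  rewrite (_ : (fun z : R * R => _) = fun=> 1); last first.
    by apply/funext => z; rewrite !expr0 mulr1.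
  by have := @HomC R (R * R)%type 1; rewrite normr1.
rewrite (_ : (fun z : R * R => _) = fun z : R * R => z.2 * (z.1 ^+ 0 * z.2 ^+ b)).
  by rewrite addnS; exact: HomL snd_unit_form IH.
by apply/funext => z; rewrite exprS mulrCA.
Qed.

Lemma derive_monomial a b z :
  'D_((1, 0) : R * R) (fun z : R * R => z.1 ^+ a * z.2 ^+ b) z =
    a%:R * (z.1 ^+ a.-1 * z.2 ^+ b) /\
  'D_((0, 1) : R * R) (fun z : R * R => z.1 ^+ a * z.2 ^+ b) z =
    b%:R * (z.1 ^+ a * z.2 ^+ b.-1).
Proof.
have [d1 D1] := unit_form_diff z fst_unit_form.
have [d2 D2] := unit_form_diff z snd_unit_form.
have c1 v : derivable (fun z : R * R => z.1) z v by exact: diff_derivable.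
have c2 v : derivable (fun z : R * R => z.2) z v by exact: diff_derivable.
have E v : 'D_v (fun z : R * R => z.1 ^+ a * z.2 ^+ b) z =
    a%:R * z.1 ^+ a.-1 * z.2 ^+ b * v.1 + b%:R * z.1 ^+ a * z.2 ^+ b.-1 * v.2.
  rewrite (_ : (fun z : R * R => _) =
     ((fun z : R * R => z.1) ^+ a) * ((fun z : R * R => z.2) ^+ b)); last first.
    by apply/funext => q; rewrite /= !exprfctE.
  rewrite deriveM; [|exact: derivableX|exact: derivableX].
  rewrite !deriveX // D1 D2 !exprfctE /GRing.scale /=; ring.
by rewrite !E /=; split; ring.
Qed.

Definition ser_norm u n : R := \sum_(i < n.+1) `|u i (n - i)%N|.

Lemma hom_ser u n : hom n (ser_norm u n) (ser u ^~ n).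
Proof.
apply: hom_sum => i; have := hom_scale (u i (n - i)%N) (hom_monomial i (n - i)).
by rewrite mulr1 subnKC // -ltnS.
Qed.

Lemma derive_ser u n z :
  'D_((1, 0) : R * R) (ser u ^~ n.+1) z = ser (fdx u) z n /\
  'D_((0, 1) : R * R) (ser u ^~ n.+1) z = ser (fdy u) z n.
Proof.
have dm i c : differentiable
    (fun z : R * R => u i c * (z.1 ^+ i * z.2 ^+ c)) z.
  exact: hom_diff (hom_scale (u i c) (hom_monomial i c)) z.
have dM (v : R * R) i c : 'D_v (fun z : R * R => u i c * (z.1 ^+ i * z.2 ^+ c)) z =
    u i c * 'D_v (fun z : R * R => z.1 ^+ i * z.2 ^+ c) z.
  have dmon : differentiable (fun z : R * R => z.1 ^+ i * z.2 ^+ c) z.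
    exact: hom_diff (hom_monomial i c) z.
  by rewrite [LHS](deriveZ (u i c) (diff_derivable dmon)).
have S v := derive_sum_seq (index_enum 'I_n.+2) v (fun i : 'I_n.+2 => dm i (n.+1 - i)%N).
have [_ S1] := S (1, 0); have [_ S2] := S (0, 1).
split.
  rewrite [LHS]S1 big_ord_recl /= dM (derive_monomial _ _ z).1 mul0r mulr0 add0r.
  apply: eq_bigr => i _; rewrite dM (derive_monomial _ _ z).1 /fdx /= subSS.
  by rewrite [RHS]mulrAC [RHS]mulrC.
rewrite [LHS]S2 big_ord_recr /= dM (derive_monomial _ _ z).2 subnn mul0r mulr0 addr0.
apply: eq_bigr => i _; rewrite dM (derive_monomial _ _ z).2 /fdy /=.
have -> : (n.+1 - i)%N = (n - i).+1 by rewrite subSn // -ltnS.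
by rewrite /= [RHS]mulrAC [RHS]mulrC.
Qed.

Lemma ser_norm_bound u eta s n : 0 <= eta ->
  (forall N, box N eta (fun a b => `|u a b|) <= s) ->
  ser_norm u n * eta ^+ n <= s.
Proof.
move=> e0 us; apply: le_trans (us n.+1).
pose f a b := `|u a b| * eta ^+ (a + b).
have f0 a b : 0 <= f a b by rewrite mulr_ge0 // exprn_ge0.
apply: le_trans (triangle_le n.+1 f0).
rewrite big_ord_recr /= -[leLHS]add0r; apply: lerD.
  by apply: sumr_ge0 => k _; apply: sumr_ge0.
rewrite /ser_norm mulr_suml; apply: ler_sum => i _.
by rewrite /f subnKC // -ltnS.
Qed.

Lemma ser_scale u (t : R) z n : ser u (t *: z) n = t ^+ n * ser u z n.
Proof.
rewrite /ser mulr_sumr; apply: eq_bigr => i _ /=; rewrite !exprMn.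
have -> : t ^+ n = t ^+ i * t ^+ (n - i) by rewrite -exprD subnKC // -ltnS.
ring.
Qed.

Lemma ser_axis u (x : R) n : ser u (x, 0) n = u n 0%N * x ^+ n.
Proof.
rewrite /ser big_ord_recr /= subnn expr0 mulr1 big1 ?add0r // => i _.
by rewrite expr0n subn_eq0 leqNgt ltn_ord !mulr0.
Qed.

Lemma ser_fone z n : ser fone z n = (n == 0%N)%:R.
Proof.
rewrite /ser big_ord_recl /= big1 ?addr0; last by move=> i _; rewrite /fone mul0r.
by rewrite /fone subn0; case: n => [|n] /=; rewrite ?mul0r // !expr0 !mulr1.
Qed.

Lemma series_fone z : series (ser fone z) @ \oo --> (1 : R).
Proof.
apply: cvg_near_cst; near=> n.
have n1 : (1 <= n)%N by near: n; exists 1%N.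
rewrite /series /= -(subnKC n1) big_nat_recl // big1 ?addr0 ?ser_fone // => i _.
by rewrite ser_fone.
Unshelve. all: by end_near. Qed.

Lemma series_abs_fone z N : series (fun n => `|ser fone z n|) N <= 1.
Proof.
rewrite /series /=; case: N => [|N]; first by rewrite big_geq.
rewrite big_nat_recl // big1 ?addr0 ?ser_fone ?normr1 // => i _.
by rewrite ser_fone normr0.
Qed.

(** The inverse of 1 plus the sum of the inverses is a common lower bound, meaningful even for an
    empty family. *)
Lemma finite_radius (I : finType) (r : I -> R) : (forall i, 0 < r i) ->
  exists2 s, 0 < s & forall i, s <= r i.
Proof.
move=> r0; have S0 (P : pred I) : 0 <= \sum_(i | P i) (r i)^-1.
  by apply: sumr_ge0 => i _; rewrite invr_ge0 ltW.
have S1 : 0 < 1 + \sum_i (r i)^-1 by rewrite ltr_pwDl.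
exists (1 + \sum_i (r i)^-1)^-1 => [|i]; first by rewrite invr_gt0.
rewrite -[leRHS]invrK lef_pV2 ?posrE ?invr_gt0 //.
rewrite (bigD1 i) //= addrCA lerDl addr_ge0 //.
Qed.

End SerFunction.

(** * The holomorphic disc tangent to X on the axis *)

Section AnalyticDisc.
Context {R : realType} {m : nat}.
Notation V := 'rV[R]_m.

Lemma analytic_list_family (I : finType) (f : I -> V -> R) p :
  (forall i, analytic_at (f i) p) ->
  exists (P : I -> nat -> @lpoly R m) (r : R), 0 < r /\
    forall i, analytic_list (P i) r (f i) p.
Proof.
move=> Hf; have [P HP] := fin_all_exists (fun i => analytic_at_list (Hf i)).
have [r Hr] := fin_all_exists HP.
have [s s0 sr] := finite_radius (fun i => (Hr i).1).
by exists P, s; split=> // i; exact: analytic_list_le (sr i) (Hr i).2.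
Qed.

(** Analyticity of phi along the disc is recorded only on rays, by a power series in t valid up to t
    = 1, with coefficients depending on [z]; [power_series_flat] asks for nothing more. *)
Theorem analytic_disc (X : V -> V) (J : V -> 'M[R]_m) (phi : V -> R) (rho : R) :
  analytic_field_at X 0 -> (forall i j, analytic_at (fun q => J q i j) 0) ->
  analytic_at phi 0 -> 0 < rho ->
  exists (eta : R) (gamma : R * R -> V),
  [/\ 0 < eta, smooth_on [set z : R * R | `|z| < eta] gamma, gamma 0 = 0 &
   forall z : R * R, `|z| < eta ->
   [/\ `|gamma z| < rho,
       'D_((0, 1) : R * R) gamma z = 'D_((1, 0) : R * R) gamma z *m J (gamma z),
       z.2 = 0 -> 'D_((1, 0) : R * R) gamma z = X (gamma z) &
       exists c : nat -> R, forall t : R, `|t| <= 1 ->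
         series (fun n => c n * t ^+ n) @ \oo --> phi (gamma (t *: z))]].
Proof.
move=> aX aJ aphi rho0.
have [PX [rX [rX0 HX]]] := analytic_list_family aX.
have [PJ [rJ [rJ0 HJ]]] := analytic_list_family
  (fun ij : 'I_m * 'I_m => aJ ij.1 ij.2).
have [PF [rF [rF0 HF]]] := analytic_at_list aphi.
pose r := Num.min rX (Num.min rJ rF).
have r0 : 0 < r by rewrite !lt_min rX0 rJ0.
have {}HX j := analytic_list_le (_ : r <= rX) (HX j).
have {}HX j : analytic_list (PX j) r (fun q => X q ord0 j) 0.
  by apply: HX; rewrite /r !ge_min lexx.
have {}HJ i j : analytic_list (PJ (i, j)) r (fun q => J q i j) 0.
  by apply: analytic_list_le (HJ (i, j)); rewrite /r !ge_min lexx orbT.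
have {}HF : analytic_list PF r phi 0.
  by apply: analytic_list_le HF; rewrite /r !ge_min lexx !orbT.
have [U [U0 UX UJ Ubox]] := @formal_solution R m PX (fun i j => PJ (i, j)) r r0
  (fun j => let: And3 d _ _ := HX j in d) (fun i j => let: And3 d _ _ := HJ i j in d)
  (fun j => let: And3 _ d _ := HX j in d) (fun i j => let: And3 _ d _ := HJ i j in d).
(* A disc bounded by [s] stays inside the domain of the expansions of X, J and phi, and in the
   prescribed ball of radius [rho]. *)
pose s := Num.min r rho / 2.
have s0 : 0 < s by rewrite divr_gt0 // lt_min r0.
have sr : s < r by have : Num.min r rho <= r by [rewrite ge_min lexx]; rewrite /s; lra.
have srho : s < rho.
  by have : Num.min r rho <= rho by [rewrite ge_min lexx orbT]; rewrite /s; lra.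
have ssr : 0 < s < r by rewrite s0.
have [eta eta0 Ueta] := Ubox s s0.
pose g i z := limn (series (ser (U i) z)).
pose gamma (z : R * R) : V := \row_i g i z.
have le1 (z : R * R) : `|z| < eta -> `|z.1| <= eta.
  by move=> /ltW; apply: le_trans; case: (@fst_unit_form R) => _; exact.
have le2 (z : R * R) : `|z| < eta -> `|z.2| <= eta.
  by move=> /ltW; apply: le_trans; case: (@snd_unit_form R) => _; exact.
have Us z : `|z| < eta -> forall i N, series (fun n => `|ser (U i) z n|) N <= s.
  move=> ze i N; apply: le_trans (Ueta i N); apply: ser_abs_le; [exact: le1|exact: le2].
have gcv z : `|z| < eta -> forall i, series (ser (U i) z) @ \oo --> g i z.
  move=> ze i; apply: (@abs_series_cvg _ _ (fun n => `|ser (U i) z n|)) => //.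
  exact: bounded_series_cvg (Us z ze i).
have gs z : `|z| < eta -> forall i, `|g i z| <= s.
  move=> ze i; apply: cvg_norm_le (gcv z ze i) _ => n; apply: le_trans (Us z ze i n).
  exact: ler_norm_sum.
have gammas z : `|z| < eta -> `|gamma z| <= s.
  move=> ze; rewrite [leLHS]mx_normrE; apply: bigmax_le => [|ij _]; first exact: ltW.
  by rewrite mxE; exact: gs.
have PS i : power_series (fun k => ser (U i) ^~ k) (ser_norm (U i)) eta (g i).
  split=> [k|rh /andP[rh0 rhe]|z ze]; [exact: hom_ser| |exact: gcv].
  exists s => k; apply: le_trans (ser_norm_bound k (ltW eta0) (Ueta i)).
  apply: ler_wpM2l; first exact: sumr_ge0.
  by apply: lerXn2r; rewrite ?nnegrE ltW.
have oD : open [set z : R * R | `|z| < eta] by exact: open_normlt.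
have sg : smooth_on [set z : R * R | `|z| < eta] gamma.
  apply: smooth_on_rV => // j; rewrite (_ : (fun z => _) = g j); last by apply/funext => q; rewrite mxE.
  exact: power_series_smooth (PS j).
have Dg z v i : `|z| < eta -> 'D_v gamma z ord0 i = 'D_v (g i) z.
  move=> ze; rewrite -derive_crd; last exact: smooth_on_diff sg ze.
  by congr ('D_v _ z); apply/funext => q; rewrite mxE.
have shift i z v : `|z| < eta ->
    series (fun k => 'D_v (fun q => ser (U i) q k.+1) z) @ \oo --> 'D_v (g i) z.
  by move=> ze; have [_ _ /(_ z ze)] := power_series_derive v (PS i).
have Dx z i : `|z| < eta -> series (ser (fdx (U i)) z) @ \oo --> 'D_((1, 0) : R * R) (g i) z.
  move=> ze; apply: cvg_trans (shift i z (1, 0) ze); apply: near_eq_cvg; near=> n.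
  by apply: eq_bigr => k _; have [] := derive_ser (U i) k z.
have Dy z i : `|z| < eta -> series (ser (fdy (U i)) z) @ \oo --> 'D_((0, 1) : R * R) (g i) z.
  move=> ze; apply: cvg_trans (shift i z (0, 1) ze); apply: near_eq_cvg; near=> n.
  by apply: eq_bigr => k _; have [] := derive_ser (U i) k z.
have leD P f : analytic_list P r f 0 -> forall z, `|z| < eta ->
    series (fun k => leval (P k) (gamma z ord0)) @ \oo --> f (gamma z).
  move=> [_ _ H] z ze; have := H (gamma z); rewrite add0r; apply.
  exact: le_lt_trans (gammas z ze) sr.
have comp P f (u : nat -> nat -> R) Q q z : analytic_list P r f 0 -> `|z| < eta ->
    (forall N, series (fun n => `|ser u z n|) N <= Q) ->
    series (ser u z) @ \oo --> q ->
    series (ser (fcomp P U u) z) @ \oo --> f (gamma z) * q.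
  move=> HP ze uQ uq; have [dP rP _] := HP.
  apply: (fcomp_eval U0 dP rP ssr (Us z ze) uQ _ uq (leD _ _ HP z ze)) => i.
  by rewrite mxE; exact: gcv.
exists eta, gamma; split=> //.
  apply/rowP => i; rewrite !mxE; apply: cvg_lim => //; apply: cvg_near_cst; near=> n.
  rewrite /series /= big1 // => k _.
  rewrite (_ : (0 : R * R) = ((0, 0) : R * R)) // ser_axis.
  by case: k => [|k]; rewrite ?U0 ?mul0r // expr0n mulr0.
move=> z ze; split.
- exact: le_lt_trans (gammas z ze) srho.
- apply/rowP => j; rewrite Dg // mxE.
  under eq_bigr do rewrite Dg //.
  (* Substitution requires a bound on the absolute partial sums; for the x-derivative it comes from
     the differentiated power series at a radius between |z| and [eta]. *)
  have ndx i : exists Q, forall N, series (fun n => `|ser (fdx (U i)) z n|) N <= Q.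
    have [hF HN _] := power_series_derive ((1, 0) : R * R) (PS i).
    pose rh := (`|z| + eta) / 2.
    have zrh : `|z| <= rh by rewrite /rh; lra.
    have rr : 0 < rh < eta by have := normr_ge0 z; rewrite /rh; lra.
    have [Q _ HQ] := radius_ge_series (fun k => hom_ge0 (hF k)) HN rr.
    exists Q => N; apply: le_trans (HQ N); apply: ler_sum => k _.
    have [<- _] := derive_ser (U i) k z; exact: hom_bound (hF k) zrh.
  have lim2 : series (ser (fdy (U j)) z) @ \oo -->
      \sum_i J (gamma z) i j * 'D_((1, 0) : R * R) (g i) z.
    have H i : series (ser (fcomp (PJ (i, j)) U (fdx (U i))) z) @ \oo -->
        J (gamma z) i j * 'D_((1, 0) : R * R) (g i) z.
      have [Q HQ] := ndx i; exact: comp (HJ i j) ze HQ (Dx z i ze).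
    rewrite (_ : series _ = fun n => \sum_i
      series (ser (fcomp (PJ (i, j)) U (fdx (U i))) z) n).
      by apply: cvg_bigsum => i _; exact: H.
    apply/funext => n; rewrite /series /= exchange_big /=; apply: eq_bigr => k _.
    rewrite /ser exchange_big /=; apply: eq_bigr => i _.
    by rewrite UJ mulr_suml.
  have -> := cvg_unique (@Rhausdorff R) (Dy z j ze) lim2.
  by apply: eq_bigr => i _; rewrite mulrC.
- move=> z2; apply/rowP => j; rewrite Dg //.
  have H := comp _ _ _ _ _ z (HX j) ze (series_abs_fone z) (series_fone z).
  rewrite mulr1 in H; apply: cvg_unique (Dx z j ze) _ => //.
  apply: cvg_trans H; apply: near_eq_cvg; near=> n; apply: eq_bigr => k _.
  have -> : z = (z.1, 0) by rewrite -z2 -surjective_pairing.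
  by rewrite !ser_axis UX.
(* The homogeneous part of degree n at t z is t^n times the one at z. *)
- exists (ser (fcomp PF U fone) z) => t t1.
  have tze : `|t *: z| < eta.
    by apply: le_lt_trans ze; rewrite normrZ ler_piMl.
  have H := comp _ _ _ _ _ (t *: z) HF tze (series_abs_fone _) (series_fone _).
  rewrite mulr1 in H; apply: cvg_trans H; apply: near_eq_cvg; near=> n.
  by apply: eq_bigr => k _; rewrite ser_scale mulrC.
Unshelve. all: by end_near. Qed.

End AnalyticDisc.

(** * Brackets and derivatives along the disc *)

Section AlongDisc.
Context {R : realType} {m : nat}.
Notation V := 'rV[R]_m.
Notation W := (R * R)%type.
Variables (O : set V) (D : set W) (gamma : W -> V) (J : V -> 'M[R]_m).
Hypotheses (oO : open O) (oD : open D) (D0 : D 0).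
Hypotheses (sgamma : smooth_on D gamma) (gamma0 : gamma 0 = 0)
  (gammaO : forall z, D z -> O (gamma z)).
Hypothesis (sJ : forall i, smooth_on O (fun p => row i (J p))).
Implicit Types (Z F G : V -> V) (A : W -> V).

Definition vx : W := (1, 0).
Definition vy : W := (0, 1).
Definition dxy : set W := [set vx; vy].

Let ordE := ord_eq oD D0.

Lemma smooth_along (U : normedModType R) (G : V -> U) : smooth_on O G ->
  smooth_on D (fun z => G (gamma z)).
Proof. exact: smooth_on_comp. Qed.

Lemma smooth_mulmx (n : nat) (A : W -> 'rV[R]_n) (B : 'I_n -> W -> V)
    (M : W -> 'M[R]_(n, m)) : (forall i z, row i (M z) = B i z) ->
  smooth_on D A -> (forall i, smooth_on D (B i)) ->
  smooth_on D (fun z => A z *m M z).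
Proof.
move=> MB sA sB; rewrite (_ : (fun z => _) = fun z => \sum_i A z ord0 i *: B i z).
  apply: smooth_on_sum => // i; apply: smooth_on_scale => //.
  exact: smooth_on_crd.
by apply/funext => z; rewrite mulmx_sum_row; apply: eq_bigr => i _; rewrite MB.
Qed.

Lemma smooth_mulJ A : smooth_on D A -> smooth_on D (fun z => A z *m J (gamma z)).
Proof.
move=> sA; apply: (@smooth_mulmx m A (fun i z => row i (J (gamma z)))) => // i.
exact: (smooth_along (sJ i)).
Qed.

Lemma smooth_fieldJ Z : smooth_on O Z -> smooth_on O (fun p => Z p *m J p).
Proof.
move=> sZ; rewrite (_ : (fun p => _) = fun p => \sum_i Z p ord0 i *: row i (J p)).
  apply: smooth_on_sum => // i; apply: smooth_on_scale => //.
  exact: smooth_on_crd.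
by apply/funext => p; rewrite mulmx_sum_row.
Qed.

Lemma ord_crd ds k A i : smooth_on D A -> ord ds k A ->
  ord ds k (fun z => A z ord0 i).
Proof.
move=> sA; apply: (ord_linear oD D0 (l := @crd R m i)) => //.
exact: crd_continuous.
Qed.

Lemma ord_mulJ ds k A : smooth_on D A -> ord ds k A ->
  ord ds k (fun z => A z *m J (gamma z)).
Proof.
move=> sA oA.
apply: (ordE (f := fun z => \sum_i A z ord0 i *: row i (J (gamma z)))).
  by move=> z _; rewrite mulmx_sum_row.
have sAi i : smooth_on D (fun z => A z ord0 i) by exact: smooth_on_crd.
have sJi i := smooth_along (sJ i).
apply: (ord_sum oD D0) => i; first exact: smooth_on_scale.
by apply: (ord_scalel oD D0) => //; exact: ord_crd.
Qed.

Lemma diff_along (U : normedModType R) (G : V -> U) A z : smooth_on O G -> D z ->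
  'd G (gamma z) (A z) =
  \sum_i A z ord0 i *: 'D_(delta_mx ord0 i) G (gamma z).
Proof. by move=> sG Dz; apply: diff_rV; exact: smooth_on_diff sG (gammaO Dz). Qed.

Lemma smooth_diff_along (U : normedModType R) (G : V -> U) A : smooth_on O G ->
  smooth_on D A -> smooth_on D (fun z => 'd G (gamma z) (A z)).
Proof.
move=> sG sA; apply: (@smooth_on_eq _ _ _ _
  (fun z => \sum_i A z ord0 i *: 'D_(delta_mx ord0 i) G (gamma z))) => //.
  by move=> z Dz; rewrite diff_along.
apply: smooth_on_sum => // i; apply: smooth_on_scale => //; first exact: smooth_on_crd.
exact: (smooth_along (smooth_on_derive _ sG)).
Qed.

Lemma ord_diff_along (U : normedModType R) ds k (G : V -> U) A : smooth_on O G ->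
  smooth_on D A -> ord ds k A -> ord ds k (fun z => 'd G (gamma z) (A z)).
Proof.
move=> sG sA oA.
apply: (ordE (f := fun z => \sum_i A z ord0 i *: 'D_(delta_mx ord0 i) G (gamma z))).
  by move=> z Dz; rewrite diff_along.
have sAi i : smooth_on D (fun z => A z ord0 i) by exact: smooth_on_crd.
have sGi (i : 'I_m) := smooth_along (smooth_on_derive (delta_mx ord0 i) sG).
apply: (ord_sum oD D0) => i; first exact: smooth_on_scale.
by apply: (ord_scalel oD D0) => //; exact: ord_crd.
Qed.

Lemma derive_along (U : normedModType R) (G : V -> U) v z : smooth_on O G -> D z ->
  'D_v (fun z => G (gamma z)) z = 'd G (gamma z) ('D_v gamma z).
Proof.
move=> sG Dz; apply: derive_comp; first exact: smooth_on_diff sgamma Dz.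
exact: smooth_on_diff sG (gammaO Dz).
Qed.

Lemma smooth_diff_field (U : normedModType R) F (G : V -> U) : smooth_on O F ->
  smooth_on O G -> smooth_on O (fun p => 'd G p (F p)).
Proof.
move=> sF sG; apply: (@smooth_on_eq _ _ _ _
  (fun p => \sum_i F p ord0 i *: 'D_(delta_mx ord0 i) G p)) => //.
  by move=> p Op; rewrite diff_rV //; exact: smooth_on_diff sG Op.
apply: smooth_on_sum => // i; apply: smooth_on_scale => //; first exact: smooth_on_crd.
exact: smooth_on_derive.
Qed.

Lemma smooth_derive_field (U : normedModType R) F (G : V -> U) : smooth_on O F ->
  smooth_on O G -> smooth_on O (fun p => 'D_(F p) G p).
Proof.
move=> sF sG; apply: (smooth_on_eq oO) (smooth_diff_field sF sG) => p Op.
by rewrite deriveE //; exact: smooth_on_diff sG Op.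
Qed.

Lemma smooth_lie_bracket F G : smooth_on O F -> smooth_on O G ->
  smooth_on O (lie_bracket F G).
Proof.
by move=> sF sG; apply: smooth_on_subr => //; exact: smooth_derive_field.
Qed.

Lemma lie_bracket_along F G z : smooth_on O F -> smooth_on O G -> D z ->
  lie_bracket F G (gamma z) = 'd G (gamma z) (F (gamma z)) - 'd F (gamma z) (G (gamma z)).
Proof.
move=> sF sG Dz; rewrite /lie_bracket !deriveE //.
  exact: smooth_on_diff sF (gammaO Dz).
exact: smooth_on_diff sG (gammaO Dz).
Qed.

Hypothesis (CR : forall z, D z -> 'D_vy gamma z = 'D_vx gamma z *m J (gamma z)).

Definition err Z (z : W) : V := 'D_vx gamma z - Z (gamma z).
(** As in [word_bracket], the boolean pairs x with Z and y with JZ. The error in y is the image by J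
    of the error in x, so [derive_dir] treats both directions alike. *)
Definition fld Z (b : bool) : V -> V := if b then (fun p => Z p *m J p) else Z.
Definition dir (b : bool) : W := if b then vy else vx.
Definition derr Z (b : bool) (z : W) : V :=
  if b then err Z z *m J (gamma z) else err Z z.

Section Field.
Variables (Z : V -> V) (k : nat).
Hypotheses (sZ : smooth_on O Z) (oerr : ord dxy k (err Z)).

Lemma smooth_err : smooth_on D (err Z).
Proof.
by apply: smooth_on_subr => //; [exact: smooth_on_derive|exact: smooth_along].
Qed.

Lemma smooth_fld b : smooth_on O (fld Z b).
Proof. by case: b => //; exact: smooth_fieldJ. Qed.

Lemma smooth_derr b : smooth_on D (derr Z b).
Proof. by case: b; [apply: smooth_mulJ|]; exact: smooth_err. Qed.

Lemma ord_derr b : ord dxy k (derr Z b).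
Proof. by case: b => //; apply: ord_mulJ => //; exact: smooth_err. Qed.

Lemma derive_dir b z : D z -> 'D_(dir b) gamma z = fld Z b (gamma z) + derr Z b z.
Proof.
have E : 'D_vx gamma z = Z (gamma z) + err Z z by rewrite /err addrC subrK.
by case: b => Dz /=; rewrite ?CR // E ?mulmxDl.
Qed.

(** Deriving F along the disc gives dF(fld) + dF(derr). The bracket has dF(fld) as well, and the
    remaining term d(fld)(F) has the order of F along the disc because it is linear in F. *)
Lemma ord_bracket_along F b j : smooth_on O F -> (j <= k)%N ->
  ord dxy j (fun z => F (gamma z)) ->
  ord dxy j (fun z => lie_bracket (fld Z b) F (gamma z)
     - 'D_(dir b) (fun z => F (gamma z)) z).
Proof.
move=> sF jk oF; have sFg := smooth_along sF.
have s1 := smooth_diff_along sF (smooth_derr b).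
have s2 := smooth_diff_along (smooth_fld b) sFg.
have H1 := ord_diff_along sF (smooth_derr b) (ord_le jk (ord_derr b)).
have H2 := ord_diff_along (smooth_fld b) sFg oF.
have := ord_opp oD D0 (smooth_on_add oD s1 s2) (ord_add oD D0 s1 s2 H1 H2).
apply: ordE => z Dz; rewrite derive_along // lie_bracket_along //; last exact: smooth_fld.
have L : 'd F (gamma z) (fld Z b (gamma z) + derr Z b z) =
  'd F (gamma z) (fld Z b (gamma z)) + 'd F (gamma z) (derr Z b z) by exact: linearD.
rewrite derive_dir //.
rewrite [X in _ - X]L.
by rewrite !opprD [RHS]addrACA subrr add0r addrC.
Qed.

Lemma smooth_words (w : seq bool) : smooth_on O (word_bracket J Z w).
Proof.
rewrite /word_bracket; elim: w => [|b w IH] /=; first exact: smooth_on_cst.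
case: w IH => [|c w] IH /=; first exact: (smooth_fld b).
by apply: smooth_lie_bracket; [exact: (smooth_fld b)|exact: IH].
Qed.

Definition dword (U : normedModType R) (u : seq bool) (f : W -> U) : W -> U :=
  foldr (fun b g => 'D_(dir b) g) f u.

Lemma smooth_dword (U : normedModType R) u (f : W -> U) : smooth_on D f ->
  smooth_on D (dword u f).
Proof. by move=> sf; elim: u => //= b u IH; exact: smooth_on_derive. Qed.

Lemma dir_dxy b : dxy (dir b).
Proof. by case: b; [right|left]. Qed.

Lemma ord_dword (U : normedModType R) u (f : W -> U) n : ord dxy n f ->
  ord dxy (n - size u) (dword u f).
Proof.
move=> of1; elim: u => [|b u IH] /=; first by rewrite subn0.
rewrite subnS; case: (n - size u)%N IH => [//|l] /= [_ H].
exact/H/dir_dxy.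
Qed.

(** Each letter of [u] costs one order, both for the bracket and for its difference with the
    iterated derivative. The difference starts one order better, and so is still controlled when the
    bracket no longer vanishes at 0. *)
Lemma word_bracket_error (u : seq bool) b1 b2 : (size u < k)%N ->
  ord dxy k.-1 (fun z => word_bracket J Z [:: b1; b2] (gamma z)) ->
  ord dxy (k - size u) (fun z => word_bracket J Z (u ++ [:: b1; b2]) (gamma z)
    - dword u (fun z => word_bracket J Z [:: b1; b2] (gamma z)) z) /\
  ord dxy (k.-1 - size u) (fun z => word_bracket J Z (u ++ [:: b1; b2]) (gamma z)).
Proof.
move=> + ob; set F0 := fun z => word_bracket J Z [:: b1; b2] (gamma z).
have sF0 : smooth_on D F0 by exact: (smooth_along (smooth_words [:: b1; b2])).
elim: u => [|b u IH] uk /=.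
  rewrite !subn0; split=> //; apply: ordE (ord_zero oD D0 _ _ _) => z _.
  by rewrite /F0 /= subrr.
have [IH1 IH2] := IH (ltnW uk).
have sG := smooth_words (u ++ [:: b1; b2]).
have sGg := smooth_along sG.
have sd := smooth_dword u sF0.
have Hb := ord_bracket_along b sG (leq_trans (leq_subr (size u) k.-1) (leq_pred k)) IH2.
have kE : (k - size u = (k.-1 - size u).+1)%N by move: uk => /=; lia.
rewrite kE in IH1; case: IH1 => _ /(_ (dir b) (dir_dxy b)) IH1.
have sdG := smooth_on_derive (dir b) sGg.
have sdd := smooth_on_derive (dir b) sd.
have sl : smooth_on D (fun z => lie_bracket (fld Z b) (word_bracket J Z (u ++ [:: b1; b2])) (gamma z)).
  by apply: smooth_along; apply: smooth_lie_bracket => //; exact: smooth_fld.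
have E : word_bracket J Z (b :: u ++ [:: b1; b2]) =
    lie_bracket (fld Z b) (word_bracket J Z (u ++ [:: b1; b2])).
  by case: (u) => [|c u'].
have O1 : ord dxy (k.-1 - size u) (fun z => word_bracket J Z (b :: u ++ [:: b1; b2]) (gamma z)
    - 'D_(dir b) (dword u F0) z).
  have := ord_add oD D0 (smooth_on_subr oD sl sdG) (smooth_on_derive (dir b) (smooth_on_subr oD sGg sd)) Hb IH1.
  apply: ordE => z Dz; rewrite E (derive_subr (dir b) sGg sd Dz).
  have telescope (a c d : V) : (a - c) + (c - d) = a - d by rewrite addrA subrK.
  exact: telescope.
have sE : smooth_on D (fun z => word_bracket J Z (b :: u ++ [:: b1; b2]) (gamma z)).
  by rewrite E.
split; first by rewrite (_ : (k - (size u).+1 = k.-1 - size u)%N) //; move: uk => /=; lia.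
have O2 := ord_dword (b :: u) ob.
have := ord_add oD D0 (smooth_on_subr oD sE sdd) sdd
  (ord_le (_ : (k.-1 - (size u).+1 <= k.-1 - size u)%N) O1) O2.
rewrite -/F0 /= => H; apply: ordE (H _) => [z Dz|]; last by lia.
by rewrite subrK.
Qed.

End Field.

Lemma smooth_mulB n A (B : 'M[R]_(m, n)) : smooth_on D A ->
  smooth_on D (fun z => A z *m B).
Proof.
move=> sA; apply: (@smooth_on_linear _ _ _ _ D (@mulmxr R 1 m n B)) => //.
exact: linear_rV_continuous.
Qed.

Lemma ord_mulB n ds k A (B : 'M[R]_(m, n)) : smooth_on D A -> ord ds k A ->
  ord ds k (fun z => A z *m B).
Proof.
move=> sA; apply: (ord_linear oD D0 (l := @mulmxr R 1 m n B)) => //.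
exact: linear_rV_continuous.
Qed.

Lemma derive_mulB n A (B : 'M[R]_(m, n)) v z : smooth_on D A -> D z ->
  'D_v (fun z => A z *m B) z = 'D_v A z *m B.
Proof.
move=> sA Dz; have [] // := derive_linear v
  (@linear_rV_continuous R m _ (@mulmxr R 1 m n B)) (smooth_on_diff sA Dz).
Qed.

Lemma derive_mulJ A v z : smooth_on D A -> D z ->
  'D_v (fun z => A z *m J (gamma z)) z =
    \sum_i A z ord0 i *: 'D_v (fun z => row i (J (gamma z))) z
    + 'D_v A z *m J (gamma z).
Proof.
move=> sA Dz; have sJi i := smooth_along (sJ i).
have sAi i : smooth_on D (fun z => A z ord0 i) by exact: smooth_on_crd.
rewrite (_ : (fun z => _) = fun z => \sum_i A z ord0 i *: row i (J (gamma z))); last first.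
  by apply/funext => q; rewrite mulmx_sum_row.
have [i|_ ->] := @derive_sum_seq _ _ _ _ (index_enum 'I_m)
   (fun i z => A z ord0 i *: row i (J (gamma z))) z v.
  exact: smooth_on_diff (smooth_on_scale oD (sAi i) (sJi i)) Dz.
rewrite mulmx_sum_row -big_split /=; apply: eq_bigr => i _.
rewrite derive_scale; [|exact: smooth_on_diff (sAi i) Dz|exact: smooth_on_diff (sJi i) Dz].
by congr (_ + _ *: _); rewrite derive_crd //; exact: smooth_on_diff sA Dz.
Qed.

(* The failure of [gamma] to be tangent to [Z], hence also to [Z J], is driven
   by the bracket [Z, Z J]. *)
Lemma ord_err_bracket Z k : smooth_on O Z -> ord dxy k (err Z) ->
  ord dxy k (fun z => 'D_vy (err Z) z - 'D_vx (err Z) z *m J 0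
    - lie_bracket Z (fun p => Z p *m J p) (gamma z)).
Proof.
move=> sZ oE; have sE := smooth_err sZ; have sJZ := smooth_fieldJ sZ.
have sJi i := smooth_along (sJ i).
have sDE := smooth_on_derive vx sE.
have oDE : ord dxy k.-1 ('D_vx (err Z)).
  by case: k oE => // k [_]; apply; left.
have sEJ := smooth_mulJ sE.
pose Q z := \sum_i err Z z ord0 i *: 'D_vx (fun z => row i (J (gamma z))) z.
(* Cost of freezing J at 0: the derivative of the error has order k - 1, and J(gamma) - J(0) brings
   the missing order. *)
pose T z := \sum_i 'D_vx (err Z) z ord0 i *: (row i (J (gamma z)) - row i (J 0)).
have sEi i : smooth_on D (fun z => err Z z ord0 i) by exact: smooth_on_crd.
have sDEi i : smooth_on D (fun z => 'D_vx (err Z) z ord0 i) by exact: smooth_on_crd.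
have sJ0 i : smooth_on D (fun z => row i (J (gamma z)) - row i (J 0)).
  by apply: smooth_on_subr => //; exact: smooth_on_cst.
have sQi i := smooth_on_scale oD (sEi i) (smooth_on_derive vx (sJi i)).
have sQ : smooth_on D Q by exact: smooth_on_sum.
have oQ : ord dxy k Q.
  apply: (ord_sum oD D0) => [i|i]; first exact: sQi.
  apply: (ord_scalel oD D0); first exact: sEi.
    exact: smooth_on_derive.
  exact: ord_crd.
have sT : smooth_on D T.
  by apply: smooth_on_sum => // i; exact: smooth_on_scale.
have oT : ord dxy k T.
  apply: (ord_sum oD D0) => i; first exact: smooth_on_scale.
  apply: (@ord_scale _ _ _ oD D0 _ _ _ k.-1 1) => //; first by rewrite addn1 leqSpred.
    exact: ord_crd.
  by split=> [|v _]; [rewrite gamma0 subrr|exact: I].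
have s1 := smooth_diff_along sJZ sE; have o1 := ord_diff_along sJZ sE oE.
have s2 := smooth_diff_along sZ sEJ; have o2 := ord_diff_along sZ sEJ (ord_mulJ sE oE).
have s3 := smooth_on_add oD sT s1; have o3 := ord_add oD D0 sT s1 oT o1.
have s4 := smooth_on_add oD s3 sQ; have o4 := ord_add oD D0 s3 sQ o3 oQ.
have := ord_subr oD D0 s4 s2 o4 o2.
apply: ordE => z Dz; rewrite lie_bracket_along //.
have sDg := smooth_on_derive vx sgamma.
have a1 : 'D_vy (err Z) z = 'D_vy ('D_vx gamma) z - 'd Z (gamma z) ('D_vy gamma z).
  by rewrite (derive_subr vy sDg (smooth_along sZ) Dz) derive_along.
have a2 := derive_symmetric_rV vx vy oD sgamma Dz.
have sJZg := smooth_along sJZ.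
have a3 : 'D_vx ('D_vy gamma) z = 'd (fun p => Z p *m J p) (gamma z) ('D_vx gamma z)
     + 'D_vx (fun z => err Z z *m J (gamma z)) z.
  pose f1 z := Z (gamma z) *m J (gamma z); pose f2 z := err Z z *m J (gamma z).
  transitivity ('D_vx (f1 + f2) z).
    apply: (@derive_eq_on R W V D ('D_vy gamma) (f1 + f2) vx z oD _ Dz) => q Dq.
    exact: (derive_dir Z true Dq).
  rewrite deriveD; [|exact: diff_derivable (smooth_on_diff sJZg Dz)|
    exact: diff_derivable (smooth_on_diff sEJ Dz)].
  by congr (_ + _); exact: (derive_along vx sJZ Dz).
have L1 : 'd (fun p => Z p *m J p) (gamma z) (Z (gamma z) + err Z z) =
    'd (fun p => Z p *m J p) (gamma z) (Z (gamma z))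
    + 'd (fun p => Z p *m J p) (gamma z) (err Z z) by exact: linearD.
have L2 : 'd Z (gamma z) (Z (gamma z) *m J (gamma z) + err Z z *m J (gamma z)) =
    'd Z (gamma z) (Z (gamma z) *m J (gamma z))
    + 'd Z (gamma z) (err Z z *m J (gamma z)) by exact: linearD.
have b1 := etrans (congr1 ('d (fun p => Z p *m J p) (gamma z)) (derive_dir Z false Dz)) L1.
have b2 := etrans (congr1 ('d Z (gamma z)) (derive_dir Z true Dz)) L2.
have b3 := derive_mulJ vx sE Dz.
(* Exact expression of the y-derivative of the error: the mixed derivatives of gamma are exchanged,
   and d_y gamma is replaced by its value J d_x gamma = JZ + J err. *)
have tot := etrans a1 (congr2 (fun u v : V => u - v)
  (etrans a2 (etrans a3 (congr2 (fun u v : V => u + v) b1 b3))) b2).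
have TE : T z = 'D_vx (err Z) z *m J (gamma z) - 'D_vx (err Z) z *m J 0.
  by rewrite !mulmx_sum_row -sumrB; apply: eq_bigr => i _; rewrite scalerBr.
have fin (u w v1 v2 v3 v4 v5 v6 v7 : V) : u = w -> w = v1 + v2 + (v7 + v5) - (v3 + v4) ->
    v5 - v6 + v2 + v7 - v4 = u - v6 - (v1 - v3).
  by move=> -> ->; apply/rowP => j; rewrite !mxE; ring.
rewrite TE; exact: fin tot erefl.
Qed.

(** By [ord_err_bracket] the bracket [Z, JZ] is a combination of first derivatives of the error, up
    to order k; the other pairs follow by antisymmetry. *)
Lemma ord_base Z k b1 b2 : smooth_on O Z -> ord dxy k (err Z) ->
  ord dxy k.-1 (fun z => word_bracket J Z [:: b1; b2] (gamma z)).
Proof.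
move=> sZ oE; have sE := smooth_err sZ; have sJZ := smooth_fieldJ sZ.
have sDx := smooth_on_derive vx sE; have sDy := smooth_on_derive vy sE.
have sDxB := smooth_mulB (J 0) sDx.
have sF := smooth_along (smooth_lie_bracket sZ sJZ).
have [oDx oDy] : ord dxy k.-1 ('D_vx (err Z)) /\ ord dxy k.-1 ('D_vy (err Z)).
  by case: k oE => // k [_ H]; split; apply: H; [left|right].
have oH := ord_le (leq_pred k) (ord_err_bracket sZ oE).
have s1 := smooth_on_subr oD sDy sDxB.
have o1 := ord_subr oD D0 sDy sDxB oDy (ord_mulB (J 0) sDx oDx).
have oF : ord dxy k.-1 (fun z => lie_bracket Z (fun p => Z p *m J p) (gamma z)).
  have := ord_subr oD D0 s1 (smooth_on_subr oD s1 sF) o1 oH.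
  apply: ordE => z _; have cancel2 (u v : V) : u - (u - v) = v by rewrite opprB addrC subrK.
  exact: cancel2.
have zero G : ord dxy k.-1 (fun z => lie_bracket G G (gamma z)).
  by apply: ordE (ord_zero oD D0 _ _ _) => z _; rewrite /lie_bracket subrr.
case: b1; case: b2; [exact: (zero (fld Z true))| |exact: oF|exact: (zero Z)].
have := ord_opp oD D0 sF oF; apply: ordE => z _.
exact: opprB.
Qed.

(** Write the word as [u] followed by two letters. The bracket has order k - 1 - |u| along the disc,
    which is at least 1 when the length is at most k. *)
Lemma ord_commutes Z k : smooth_on O Z -> ord dxy k (err Z) ->
  commutes_at_order J Z k 0.
Proof.
move=> sZ oE w /andP[w2 wk].
have [u [b1 [b2 wE]]] : exists u b1 b2, w = u ++ [:: b1; b2].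
  case/lastP: w w2 {wk} => // w b2; case/lastP: w => // u b1 _.
  by exists u, b1, b2; rewrite -!cats1 -catA.
have uk : (size u + 2 <= k)%N by rewrite -[2%N]/(size [:: b1; b2]) -size_cat -wE.
have [|_] := word_bracket_error (u := u) sZ oE _ (ord_base b1 b2 sZ oE).
  by lia.
rewrite -wE (_ : (k.-1 - size u = (k.-1 - size u).-1.+1)%N); last by lia.
by rewrite -[in RHS]gamma0 => -[]; rewrite gamma0.
Qed.

(** Length k + 1 is the first at which brackets need not vanish. The difference in
    [word_bracket_error] still has order 1 there, so that bracket and derivative agree at 0. *)
Lemma dword_word_bracket Z k u : smooth_on O Z -> ord dxy k (err Z) ->
  (size u).+1 = k ->
  dword u (fun z => lie_bracket Z (fun p => Z p *m J p) (gamma z)) 0 =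
  word_bracket J Z (u ++ [:: false; true]) 0.
Proof.
move=> sZ oE uk.
have [|+ _] := word_bracket_error (u := u) sZ oE _ (ord_base false true sZ oE).
  by rewrite -uk.
rewrite -uk subSn // subnn => -[/eqP]; rewrite subr_eq0 gamma0 => /eqP -> _.
by [].
Qed.

Lemma ord_of_dword (U : normedModType R) k (f : W -> U) : ord dxy k f ->
  (forall u, size u = k -> dword u f 0 = 0) -> ord dxy k.+1 f.
Proof.
elim: k f => [|k IH] f of1 H; first by split=> //; exact: (H [::]).
case: of1 => f0 of1; split=> // v [->|->].
  apply: IH => [|u uk]; first by apply: of1; left.
  by have := H (rcons u false); rewrite size_rcons uk /dword foldr_rcons; apply.
apply: IH => [|u uk]; first by apply: of1; right.
by have := H (rcons u true); rewrite size_rcons uk /dword foldr_rcons; apply.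
Qed.

Lemma dword_mulB n u A (B : 'M[R]_(m, n)) z : smooth_on D A -> D z ->
  dword u (fun z => A z *m B) z = dword u A z *m B.
Proof.
move=> sA; elim: u z => //= b u IH z Dz.
transitivity ('D_(dir b) (fun z => dword u A z *m B) z).
  by apply: (derive_eq_on (dir b) oD) Dz => q Dq; exact: IH.
exact: derive_mulB (smooth_dword u sA) Dz.
Qed.

Lemma derive_on_axis (U : normedModType R) (f g : W -> U) x :
  (forall x, D (x, 0) -> f (x, 0) = g (x, 0)) -> D (x, 0) ->
  'D_vx f (x, 0) = 'D_vx g (x, 0).
Proof.
move=> fg Dx.
have nD : \forall t \near (0 : R), D (t *: vx + ((x, 0) : W)).
  have c : (fun t : R => t *: vx + ((x, 0) : W)) t @[t --> (0 : R)] --> ((x, 0) : W).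
    have : (fun t : R => t *: vx + ((x, 0) : W)) t @[t --> (0 : R)] -->
        (0 : R) *: vx + ((x, 0) : W).
      apply: cvgD; last exact: cvg_cst.
      by apply: cvgZ; [exact: cvg_id|exact: cvg_cst].
    by rewrite scale0r add0r.
  exact: c (open_nbhs_nbhs (conj oD Dx)).
have E t : D (t *: vx + ((x, 0) : W)) -> f (t *: vx + ((x, 0) : W)) = g (t *: vx + ((x, 0) : W)).
  have -> : t *: vx + ((x, 0) : W) = (t + x, 0).
    by congr (_, _); [rewrite -[RHS]/(t + x) -[X in _ = X + _]mulr1|
      rewrite -[RHS](mulr0 t) -[LHS]/(t * 0 + 0) addr0].
  exact: fg.
have nE : \forall t \near (0 : R)^', t^-1 *: ((f \o shift ((x, 0) : W)) (t *: vx) - f (x, 0)) =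
    t^-1 *: ((g \o shift ((x, 0) : W)) (t *: vx) - g (x, 0)).
  by apply: nbhs_dnbhs; apply: filterS nD => t Dt; rewrite /= E // fg.
rewrite /derive; congr (lim _); apply/seteqP; split; apply: near_eq_cvg => //.
by apply: filterS nE => t ->.
Qed.

(** Derivatives in x at points of the axis see only the values on the axis. *)
Lemma eq_on_axis (U : normedModType R) n (f g : W -> U) : smooth_on D f ->
  smooth_on D g -> (forall x, D (x, 0) -> f (x, 0) = g (x, 0)) ->
  ord [set vx] n f -> ord [set vx] n g.
Proof.
move=> sf sg fg of1.
suff H h : smooth_on D h -> (forall x, D (x, 0) -> h (x, 0) = 0 :> U) ->
    ord [set vx] n h.
  have sh := smooth_on_subr oD sf sg.
  have oh := H _ sh (fun x Dx => etrans (congr1 (fun u => u - _) (fg x Dx)) (subrr _)).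
  have := ord_subr oD D0 sf sh of1 oh; apply: ordE => z _.
  by rewrite opprB addrC subrK.
elim: n h {of1} => [//|n IH] h sh h0; split; first exact: h0.
move=> _ ->; apply: IH => [|x Dx]; first exact: smooth_on_derive.
by rewrite (@derive_on_axis _ h (fun=> 0)) ?derive_cst.
Qed.
End AlongDisc.

(** * Sections of L tangent to the disc at order k *)

Section Correction.
Context {R : realType} {m : nat}.
Notation V := 'rV[R]_m.
Notation W := (R * R)%type.
Variables (O : set V) (D : set W) (gamma : W -> V) (J : V -> 'M[R]_m).
Hypotheses (oO : open O) (oD : open D) (D0 : D 0).
Hypotheses (sgamma : smooth_on D gamma) (gamma0 : gamma 0 = 0)
  (gammaO : forall z, D z -> O (gamma z)).
Hypothesis (sJ : forall i, smooth_on O (fun p => row i (J p))).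
Hypothesis (CR : forall z, D z -> 'D_vy gamma z = 'D_vx gamma z *m J (gamma z)).
Variables (X : V -> V) (d : nat) (e : 'I_d -> V -> V) (L0 : {vspace V}).
Hypotheses (sX : smooth_on O X) (se : forall i, smooth_on O (e i)).
Hypothesis (axis : forall x, D (x, 0) -> 'D_vx gamma (x, 0) = X (gamma (x, 0))).
Variables (Lam : 'M[R]_(m, d)) (c1 c2 : 'cV[R]_m).
Hypotheses (eL : forall i, e i 0 \in L0)
  (eLam : forall i j, (e i 0 *m Lam) ord0 j = (i == j)%:R)
  (spanL : forall v, v \in L0 -> \sum_i (v *m Lam) ord0 i *: e i 0 = v)
  (JL : forall v, v \in L0 -> v *m J 0 \in L0).
Hypotheses (c1x : (X 0 *m c1) ord0 ord0 = 1) (c1y : (X 0 *m J 0 *m c1) ord0 ord0 = 0)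
  (c2y : (X 0 *m J 0 *m c2) ord0 ord0 = 1).

(** With analytic coefficients this is again a section of [L] ([section_correct]), to which the
    hypothesis on brackets applies. *)
Definition correct (g : 'I_d -> V -> R) (p : V) : V :=
  X p + \sum_i g i p *: e i p.

Hypothesis (bracketL : forall k g, (1 <= k)%N ->
  (forall i p, analytic_at (g i) p) -> commutes_at_order J (correct g) k 0 ->
  forall w, size w = k.+1 -> word_bracket J (correct g) w 0 \in L0).

Let ordE := ord_eq oD D0.
Let along := smooth_along oD sgamma gammaO.

Lemma smooth_correct g : (forall i, smooth_on O (g i)) -> smooth_on O (correct g).
Proof.
move=> sg; apply: smooth_on_add => //; apply: smooth_on_sum => // i.
exact: smooth_on_scale.
Qed.

(** [e i] takes at 0 a value killed by [B], which adds one order to that of [g i]. *)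
Lemma ord_annihilated n (g : 'I_d -> W -> R) k ds (B : 'M[R]_(m, n)) :
  (forall v, v \in L0 -> v *m B = 0) -> (forall i, smooth_on D (g i)) ->
  (forall i, ord ds k (g i)) ->
  ord ds k.+1 (fun z => (\sum_i g i z *: e i (gamma z)) *m B).
Proof.
move=> BL sg og.
have seB i : smooth_on D (fun z => e i (gamma z) *m B).
  by apply: (smooth_mulB oD); exact: along.
apply: (ordE (f := fun z => \sum_i g i z *: (e i (gamma z) *m B))).
  by move=> z _; rewrite mulmx_suml; apply: eq_bigr => i _; rewrite -scalemxAl.
apply: (ord_sum oD D0) => i; first exact: smooth_on_scale.
apply: (@ord_scale _ _ _ oD D0 _ _ _ k 1) => //; first by rewrite addn1.
by split=> [|v _]; [rewrite gamma0 BL|exact: Logic.I].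
Qed.

(* The brackets of length k + 1 lie in L0, so that their images by [B] vanish;
   on the axis the error is a combination of the [e i], and [ord_cauchy] extends
   this to the plane. *)
Lemma err_annihilated g k n (B : 'M[R]_(m, n)) : (0 < k)%N ->
  (forall i, smooth_on O (g i)) -> (forall i p, analytic_at (g i) p) ->
  ord dxy k (err gamma (correct g)) -> (forall v, v \in L0 -> v *m B = 0) ->
  ord dxy k.+1 (fun z => err gamma (correct g) z *m B).
Proof.
move=> k0 sg ag oE BL; set Z := correct g; set E := err gamma Z.
have sZ : smooth_on O Z by exact: smooth_correct.
have sE : smooth_on D E by exact: (smooth_err oD sgamma gammaO sZ).
have sJZ : smooth_on O (fun p => Z p *m J p) by exact: (smooth_fieldJ oO sJ sZ).
have sF := along (smooth_lie_bracket oO sZ sJZ).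
have comm := ord_commutes oO oD D0 sgamma gamma0 gammaO sJ CR sZ oE.
have wL := bracketL k0 ag comm.
have oFk := ord_base oO oD D0 sgamma gamma0 gammaO sJ CR false true sZ oE.
(* [ord_cauchy] is applied to the family of all matrices killing [L0]. It is stable under C -> J(0)
   C because [L0] is J(0)-invariant, and this gives [tau]. *)
pose I := {C : 'M[R]_(m, n) | forall v, v \in L0 -> v *m C = 0}.
have tauP (C : I) v : v \in L0 -> v *m (J 0 *m sval C) = 0.
  by move=> vL; rewrite mulmxA; apply: (svalP C); exact: JL.
pose tau (C : I) : I := exist _ (J 0 *m sval C) (tauP C).
pose f (C : I) z := E z *m sval C.
have sf C : smooth_on D (f C) by exact: (smooth_mulB oD).
have sym (q : W -> 'rV[R]_n) p v w : smooth_on D q -> D p ->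
  'D_w ('D_v q) p = 'D_v ('D_w q) p by exact: derive_symmetric_rV.
(* The bracket has order k - 1 along the disc, and its derivatives of order k - 1 at 0 are brackets
   of length k + 1, which lie in [L0] and are killed. *)
have oF (C : I) : ord dxy k (fun z => lie_bracket Z (fun p => Z p *m J p) (gamma z) *m sval C).
  rewrite -(prednK k0); apply: ord_of_dword.
    exact: (ord_mulB oD D0 (sval C) sF oFk).
  move=> u uk; rewrite (dword_mulB oD u (sval C) sF D0).
  have uk' : (size u).+1 = k by rewrite uk prednK.
  rewrite (dword_word_bracket oO oD D0 sgamma gamma0 gammaO sJ CR sZ oE uk').
  by apply: (svalP C); apply: wL; rewrite size_cat /= addn2 uk'.
have c1' C : ord dxy k (fun z => 'D_vy (f C) z - 'D_vx (f (tau C)) z).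
  have sDx := smooth_on_derive vx sE; have sDy := smooth_on_derive vy sE.
  have oH := ord_err_bracket oO oD D0 sgamma gamma0 gammaO sJ CR sZ oE.
  have sH := smooth_on_subr oD (smooth_on_subr oD sDy (smooth_mulB oD (J 0) sDx)) sF.
  have := ord_add oD D0 (smooth_mulB oD (sval C) sH) (smooth_mulB oD (sval C) sF)
    (ord_mulB oD D0 (sval C) sH oH) (oF C).
  apply: ordE => z Dz.
  have -> : 'D_vy (f C) z = 'D_vy E z *m sval C by exact: (derive_mulB _ _ sE Dz).
  have -> : 'D_vx (f (tau C)) z = 'D_vx E z *m (J 0 *m sval C).
    exact: (derive_mulB _ _ sE Dz).
  have fin (u v w : V) (M : 'M[R]_m) (N : 'M[R]_(m, n)) :
    (u - v *m M - w) *m N + w *m N = u *m N - v *m (M *m N).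
    by rewrite !mulmxBl subrK mulmxA.
  exact: fin.
have sgg i := along (sg i); have seg i := along (se i).
pose G z := - \sum_i g i (gamma z) *: e i (gamma z).
have sGi i := smooth_on_scale oD (sgg i) (seg i).
have sS : smooth_on D (fun z => \sum_i g i (gamma z) *: e i (gamma z)).
  exact: smooth_on_sum.
have sG : smooth_on D G by exact: smooth_on_opp.
have EG x : D (x, 0) -> E (x, 0) = G (x, 0).
  move=> Dx; rewrite /E /err axis // /Z /correct /G opprD addrA subrr.
  exact: add0r.
have oG : ord [set vx] k G.
  apply: (eq_on_axis oD D0 sE sG EG); apply: (ord_sub_dirs (ds := dxy)) oE.
  by move=> _ ->; left.
(* On the axis the error is minus the combination of the [e i] with coefficients [g i]; since the
   [e i] are independent at 0, each coefficient inherits the order. *)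
have og i : ord [set vx] k (fun z => g i (gamma z)).
  pose l (j : 'I_d) : {linear V -> R} := crd j \o mulmxr Lam.
  apply: (@ord_coef _ _ D oD D0 V [set vx] d k (fun i z => g i (gamma z))
    (fun i z => e i (gamma z)) l) => //.
  - by move=> a b; rewrite gamma0; exact: eLam.
  - have := ord_opp oD D0 sG oG; apply: ordE => z _; exact: opprK.
have c2' C : ord [set vx] k.+1 (f C).
  have := ord_annihilated (svalP C) sgg og.
  move=> /(ord_opp oD D0 (smooth_mulB oD (sval C) sS)).
  apply: (eq_on_axis oD D0) => [|//|x Dx].
    by apply: smooth_on_opp => //; exact: (smooth_mulB oD).
  rewrite /f EG // /G; exact: esym (mulNmx _ _).
exact: (ord_cauchy oD D0 (f := f) sym sf c1' c2' (exist _ B BL)).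
Qed.

(* Modulo L0 the error is already of order k + 1, so that its k-jet takes its
   values in L0 and can be removed by polynomials in the linear forms [c1], [c2],
   whose linear parts along the disc are x + 0 y and c x + y. *)
Lemma correction_step g k : (0 < k)%N ->
  (forall i, smooth_on O (g i)) -> (forall i p, analytic_at (g i) p) ->
  ord dxy k (err gamma (correct g)) ->
  exists g' : 'I_d -> V -> R, [/\ forall i, smooth_on O (g' i),
    forall i p, analytic_at (g' i) p & ord dxy k.+1 (err gamma (correct g'))].
Proof.
move=> k0 sg ag oE; set E := err gamma (correct g).
have sZ : smooth_on O (correct g) by exact: smooth_correct.
have sE : smooth_on D E by exact: (smooth_err oD sgamma gammaO sZ).
pose c1' (p : V) := (p *m c1) ord0 ord0; pose c2' (p : V) := (p *m c2) ord0 ord0.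
have sc (U : normedModType R) (Q : set U) (h : U -> V) (c : 'cV[R]_m) : open Q ->
    smooth_on Q h -> smooth_on Q (fun z => (h z *m c) ord0 ord0).
  move=> oQ sh; apply: (@smooth_on_linear _ _ _ _ Q (crd ord0 \o @mulmxr R 1 m 1 c)) => //.
  exact: linear_rV_continuous.
pose f1 z := c1' (gamma z); pose f2 z := c2' (gamma z).
have sf1 : smooth_on D f1 by exact: sc.
have sf2 : smooth_on D f2 by exact: sc.
have Dc v c : 'D_v (fun z => (gamma z *m c : 'rV[R]_1) ord0 ord0) 0 = ('D_v gamma 0 *m c) ord0 ord0.
  rewrite derive_crd; last exact: smooth_on_diff (smooth_mulB oD c sgamma) D0.
  by congr (fun_of_matrix _ _ _); exact: (derive_mulB _ _ sgamma D0).
have Dx0 : 'D_vx gamma 0 = X 0 by exact: etrans (axis D0) (congr1 X gamma0).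
have Dy0 : 'D_vy gamma 0 = X 0 *m J 0 by rewrite CR // Dx0 gamma0.
have f10 : f1 0 = 0 by rewrite /f1 /c1' gamma0 mul0mx mxE.
have f20 : f2 0 = 0 by rewrite /f2 /c2' gamma0 mul0mx mxE.
have Df1x : 'D_vx f1 0 = 1 by rewrite [LHS]Dc Dx0.
have Df1y : 'D_vy f1 0 = 0 by rewrite [LHS]Dc Dy0.
have Df2y : 'D_vy f2 0 = 1 by rewrite [LHS]Dc Dy0.
pose h i z := (E z *m Lam) ord0 i.
have sEL := smooth_mulB oD Lam sE.
have sh i : smooth_on D (h i) by exact: smooth_on_crd.
have oh i : ord dxy k (h i).
  by apply: (ord_crd oD D0) => //; exact: (ord_mulB oD D0).
have [t Ht] := fin_all_exists (fun i => taylor_plane oD D0 sf1 sf2 f10 f20 Df1x Df1y Df2y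
  (sh i) (oh i)).
(* The Taylor polynomials of the coordinates of the error are written in the linear forms [c1'] and
   [c2'] of the target, hence make sense as coefficients off the disc. *)
pose T (i : 'I_d) (p : V) := \sum_(a < k.+1) t i a * (c1' p ^+ a * c2' p ^+ (k - a)).
have sT i : smooth_on O (T i).
  apply: smooth_on_sum => // a; apply: smooth_on_mul => //; first exact: smooth_on_cst.
  have sid : smooth_on O (fun p : V => p) by exact: smooth_on_id.
  by apply: smooth_on_mul => //; apply: smooth_on_pow => //; exact: sc.
have aT i p : analytic_at (T i) p.
  have ac c : analytic_at (fun q : V => (q *m c : 'rV[R]_1) ord0 ord0) p.
    exact: (analytic_at_linear (crd ord0 \o @mulmxr R 1 m 1 c)).
  apply: analytic_at_sum => a; apply: analytic_at_mul; first exact: analytic_at_cst.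
  by apply: analytic_at_mul; apply: analytic_at_pow; exact: ac.
exists (fun i p => g i p + T i p); split=> [i|i p|].
- exact: smooth_on_add.
- exact: analytic_at_add.
have sTg i := along (sT i); have seg i := along (se i).
have oT i : ord dxy k (fun z => T i (gamma z)).
  have := ord_subr oD D0 (sh i) (smooth_on_subr oD (sh i) (sTg i)) (oh i) (ord_leS (Ht i)).
  by apply: ordE => z _; rewrite opprB addrC subrK.
have sTe i := smooth_on_scale oD (sTg i) (seg i).
pose S z := \sum_i T i (gamma z) *: e i (gamma z).
have sS : smooth_on D S by exact: smooth_on_sum.
pose A : 'M[R]_(d, m) := \matrix_i e i 0.
have mulA (v : 'rV[R]_d) : v *m A = \sum_i v ord0 i *: e i 0.
  by rewrite mulmx_sum_row; apply: eq_bigr => i _; rewrite rowK.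
(* [B] is a projection with kernel [L0]. *)
pose B : 'M[R]_m := 1%:M - Lam *m A.
have BL v : v \in L0 -> v *m B = 0.
  by move=> vL; rewrite mulmxBr mulmx1 mulmxA mulA spanL // subrr.
have sE' := smooth_on_subr oD sE sS.
have o1 : ord dxy k.+1 (fun z => (E z - S z) *m B).
  have := ord_subr oD D0 (smooth_mulB oD B sE) (smooth_mulB oD B sS)
    (err_annihilated k0 sg ag oE BL) (ord_annihilated BL sTg oT).
  by apply: ordE => z _; exact: esym (mulmxBl _ _ _).
(* The matrix of coordinates of the [e i] is the identity at 0. Replacing it by the identity costs
   [T i] times a function vanishing at 0, of order k + 1. *)
have o2 j : ord dxy k.+1 (fun z => ((E z - S z) *m Lam) ord0 j).
  have seL i : smooth_on D (fun z => (e i (gamma z) *m Lam) ord0 j - (i == j)%:R).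
    apply: smooth_on_subr => //; last exact: smooth_on_cst.
    by apply: smooth_on_crd => //; exact: (smooth_mulB oD).
  have sTL i := smooth_on_mul oD (sTg i) (seL i).
  have oTL : ord dxy k.+1 (fun z => \sum_i T i (gamma z) *
       ((e i (gamma z) *m Lam) ord0 j - (i == j)%:R)).
    apply: (ord_sum oD D0) => // i.
    apply: (@ord_mul _ _ _ oD D0 _ _ k 1) => //; first by rewrite addn1.
    by split=> [|v _]; [rewrite gamma0 eLam subrr|exact: Logic.I].
  have := ord_subr oD D0 (smooth_on_subr oD (sh j) (sTg j)) (smooth_on_sum _ oD sTL)
    (Ht j) oTL.
  apply: ordE => z _; rewrite mulmxBl mxE [X in _ = _ + X]mxE -/(h j z).
  rewrite -addrA -opprD; congr (_ - _); rewrite /S mulmx_suml summxE.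
  rewrite (eq_bigr (fun i => T i (gamma z) * (e i (gamma z) *m Lam) ord0 j
      - T i (gamma z) * (i == j)%:R)); last by move=> i _; rewrite mulrBr.
  rewrite sumrB [X in _ + (_ - X)](bigD1 j) //= eqxx mulr1 [X in _ + (_ - (_ + X))]big1 ?addr0.
    rewrite addrC subrK; apply: eq_bigr => i _.
    by rewrite -scalemxAl [RHS]mxE.
  by move=> i ij; rewrite (negbTE ij) mulr0.
have sE'L j : smooth_on D (fun z => ((E z - S z) *m Lam) ord0 j).
  by apply: smooth_on_crd => //; exact: (smooth_mulB oD).
have sE'e j : smooth_on D (fun z => ((E z - S z) *m Lam) ord0 j *: e j 0).
  by apply: smooth_on_scale => //; exact: smooth_on_cst.
have o3 : ord dxy k.+1 (fun z => \sum_j ((E z - S z) *m Lam) ord0 j *: e j 0).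
  apply: (ord_sum oD D0) => // j; apply: (ord_scalel oD D0) => //; exact: smooth_on_cst.
have := ord_add oD D0 (smooth_mulB oD B sE') (smooth_on_sum _ oD sE'e) o1 o3.
(* The identity is [B + Lam *m A], so the two parts just bounded add up to the whole error. *)
apply: ordE => z _; rewrite -mulA /B mulmxBr mulmx1 mulmxA subrK.
rewrite /E /err /S /correct -addrA -opprD; congr (_ - _).
rewrite -addrA -big_split /=; congr (_ + _); apply: eq_bigr => i _.
by rewrite scalerDl.
Qed.

Lemma corrections k : exists g : 'I_d -> V -> R, [/\ forall i, smooth_on O (g i),
    forall i p, analytic_at (g i) p & ord dxy k (err gamma (correct g))].
Proof.
(* The induction starts at order 1, the least for which the bracket hypothesis is available. There X
   itself serves, since d_x gamma(0) = X(0). *)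
case: k => [|k].
  exists (fun _ _ => 0); split=> // [i|i p]; first exact: smooth_on_cst.
  exact: analytic_at_cst.
elim: k => [|k [g [sg ag og]]]; last exact: correction_step og.
exists (fun _ _ => 0); split=> [i|i p|]; first exact: smooth_on_cst.
  exact: analytic_at_cst.
split=> [|v _ //]; rewrite /err /correct big1 ?addr0; last by move=> i _; rewrite scale0r.
by rewrite (axis D0) subrr.
Qed.

End Correction.

(** * Inclusion in the hypersurface *)

Section Tangency.
Context {R : realType} {V : normedModType R}.
Implicit Types (phi f : V -> R).

(* Going down from [p] along [- v], one meets the zero set of [phi] at distance
   at most [phi p / c], and [f] vanishes there. *)
Lemma zero_on_line phi f (v p : V) (s0 c M : R) : 0 < s0 -> 0 < c ->
  (forall s, 0 <= s <= s0 -> [/\ differentiable phi (p - s *: v),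
     differentiable f (p - s *: v), c <= 'D_v phi (p - s *: v),
     `|'D_v f (p - s *: v)| <= M & phi (p - s *: v) = 0 -> f (p - s *: v) = 0]) ->
  0 <= phi p <= c * s0 -> `|f p| <= M / c * phi p.
Proof.
move=> s00 c0 H /andP[p0 pc].
have shift s t : p - s *: v + t *: v = p - (s - t) *: v.
  by rewrite scalerBl opprB addrA addrAC.
have M0 : 0 <= M.
  have [_ _ _ + _] := H 0 (introT andP (conj (lexx 0) (ltW s00))).
  exact: le_trans.
have cont : {within `[0, s0], continuous (fun s : R => phi (p + s *: (- v)))}.
  apply: derivable_within_continuous => s; rewrite in_itv /= => ss.
  suff [//] : is_derive s 1 (fun s : R => phi (p + s *: (- v))) ('D_(- v) phi (p + s *: (- v))).
  apply: derive_line; apply: diff_derivable; rewrite scalerN.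
  by have [] := H s ss.
have mvt (h : V -> R) s : 0 < s -> s <= s0 ->
    (forall s, 0 <= s <= s0 -> differentiable h (p - s *: v)) ->
    exists2 t, 0 <= t <= s0 & h p - h (p - s *: v) = s * 'D_v h (p - t *: v).
  move=> sp ss dh; have [t ts|t /andP[t0 ts] E] := @mvt_line _ _ h (p - s *: v) v s sp.
    by rewrite shift; apply: dh; lra.
  exists (s - t); first by lra.
  by rewrite -shift -E subrK.
have end0 : phi (p - s0 *: v) <= 0.
  have [t ts E] := mvt phi s0 s00 (lexx s0) (fun s ss => let: And5 d _ _ _ _ := H s ss in d).
  have [_ _ cD _ _] := H t ts.
  have : s0 * c <= s0 * 'D_v phi (p - t *: v) by apply: ler_wpM2l => //; exact: ltW.
  rewrite -E; lra.
have bnd : Num.min (phi (p + 0 *: (- v))) (phi (p + s0 *: (- v))) <= 0 <=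
    Num.max (phi (p + 0 *: (- v))) (phi (p + s0 *: (- v))).
  by rewrite scale0r addr0 scalerN ge_min end0 orbT le_max p0.
have [s] := IVT (ltW s00) cont bnd.
rewrite in_itv /= scalerN => /andP[s1 s2] z.
have ss : 0 <= s <= s0 by rewrite s1.
have [_ _ _ _ /(_ z) fz] := H s ss.
have [s_eq|sn] := eqVneq s 0.
  by move: fz; rewrite s_eq scale0r subr0 => ->; rewrite normr0 mulr_ge0 // divr_ge0 // ltW.
have sp : 0 < s by rewrite lt_neqAle eq_sym sn.
have [t ts E] := mvt phi s sp s2 (fun s ss => let: And5 d _ _ _ _ := H s ss in d).
have [t' ts' E'] := mvt f s sp s2 (fun s ss => let: And5 _ d _ _ _ := H s ss in d).
have [_ _ cD _ _] := H t ts; have [_ _ _ DM _] := H t' ts'.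
move: E E'; rewrite z fz !subr0 => E ->.
have sc : s * c <= phi p by rewrite E; apply: ler_wpM2l.
rewrite normrM ger0_norm // mulrAC ler_pdivlMr // mulrAC mulrC.
apply: (@le_trans _ _ (M * (s * c))); last exact: ler_wpM2l.
by apply: ler_wpM2r => //; rewrite mulr_ge0 // ltW.
Qed.

(** Since phi increases along [v] at a rate at least a / 2 near 0, every nearby point reaches the
    zero set along a short segment, on which [f] varies at a rate at most [M]. Negative values of
    phi are treated with - phi and - v. *)
Lemma tangency_bound (O : set V) phi f (v : V) : open O -> O 0 ->
  smooth_on O phi -> smooth_on O f -> phi 0 = 0 -> 0 < 'D_v phi 0 ->
  (\forall p \near (0 : V), phi p = 0 -> f p = 0) ->
  exists2 C, 0 <= C & \forall p \near (0 : V), `|f p| <= C * `|phi p|.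
Proof.
move=> oO O0 sphi sf phi0 a0 nz.
pose a := 'D_v phi 0; pose M := `|'D_v f 0| + 1.
have cDphi : {for 0, continuous ('D_v phi)}.
  by apply: differentiable_continuous; exact: smooth_on_diff (smooth_on_derive v sphi) O0.
have cDf : {for 0, continuous ('D_v f)}.
  by apply: differentiable_continuous; exact: smooth_on_diff (smooth_on_derive v sf) O0.
have cphi : {for 0, continuous phi}.
  by apply: differentiable_continuous; exact: smooth_on_diff sphi O0.
have a2 : 0 < a / 2 by rewrite divr_gt0.
have n1 : \forall p \near (0 : V), `|a - 'D_v phi p| <= a / 2.
  by move/cvgrPdist_le: cDphi; exact.
have n2 : \forall p \near (0 : V), `|'D_v f 0 - 'D_v f p| <= 1.
  by move/cvgrPdist_le: cDf; exact.
have nO : \forall p \near (0 : V), O p by exact: open_nbhs_nbhs.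
have [de /= de0 Hde] := (nbhs_ballP _ _).1 (filterI nO (filterI nz (filterI n1 n2))).
(* A segment of parameter length [s0] from a point of norm less than de / 2 stays in the ball of
   radius [de]. *)
pose s0 := de / 2 / (`|v| + 1).
have s00 : 0 < s0 by rewrite !divr_gt0.
exists (M / (a / 2)); first by rewrite divr_ge0 ?addr_ge0 // ltW.
have n3 : \forall p \near (0 : V), `|phi p| <= a / 2 * s0.
  move/cvgrPdist_le: cphi => /(_ _ (mulr_gt0 a2 s00)).
  by apply: filterS => p; rewrite phi0 sub0r normrN.
have n4 : \forall p \near (0 : V), `|p| < de / 2 by apply: nbhs0_lt; rewrite divr_gt0.
apply: filterS2 n3 n4 => p pphi pde.
have inball (w : V) s : `|w| = `|v| -> 0 <= s <= s0 -> ball (0 : V) de (p - s *: w).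
  move=> wv /andP[s1 s2]; rewrite -ball_normE /ball_ /= sub0r normrN.
  apply: (le_lt_trans (ler_normB _ _)); rewrite normrZ wv ger0_norm //.
  have : s * `|v| <= s0 * (`|v| + 1) by apply: ler_pM => //; rewrite lerDl.
  by rewrite divfK ?gt_eqF //; lra.
have props q : ball (0 : V) de q -> [/\ differentiable phi q, differentiable f q,
    a / 2 <= 'D_v phi q, `|'D_v f q| <= M & phi q = 0 -> f q = 0].
  move=> /Hde [Oq [zq [/= d1 d2]]]; split=> //.
  - exact: smooth_on_diff sphi Oq.
  - exact: smooth_on_diff sf Oq.
  - by move: d1; rewrite ler_norml => /andP[_]; lra.
  - rewrite /M; have := ler_normB ('D_v f 0) ('D_v f 0 - 'D_v f q).
    by rewrite opprB addrC subrK; lra.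
have [p0|p0] := leP 0 (phi p).
  rewrite (ger0_norm p0); apply: (zero_on_line (v := v) (s0 := s0)) => //.
    by move=> s ss; apply: props; exact: inball.
  by rewrite p0 /=; move: pphi; rewrite ger0_norm.
rewrite (ltr0_norm p0); apply: (zero_on_line (phi := - phi) (v := - v) (s0 := s0)) => //.
  move=> s ss; have [d1 d2 d3 d4 d5] := props _ (inball (- v) s (normrN v) ss).
  split=> //.
  - exact: differentiableN.
  - rewrite deriveN; last exact: diff_derivable.
    rewrite [X in _ <= - X]deriveE // linearN opprK -deriveE //.
  - by rewrite deriveE // linearN normrN -deriveE.
  - by move=> /eqP; rewrite oppr_eq0 => /eqP.
by rewrite oppr_ge0 (ltW p0) /=; move: pphi; rewrite ltr0_norm.
Qed.

End Tangency.

(** * Orders of vanishing and power series along rays *)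

Section Rays.
Context {R : realType}.
Notation W := (R * R)%type.

Lemma dirE (w : W) : w = w.1 *: (vx : W) + w.2 *: (vy : W).
Proof.
by case: w => a b; congr (_, _);
  rewrite -[RHS]/(_ * _ + _ * _) mulr0 mulr1 ?addr0 ?add0r.
Qed.

Lemma near_ray (z : W) (P : set W) : (\forall q \near (0 : W), P q) ->
  exists2 t0 : R, 0 < t0 & forall t, 0 <= t <= t0 -> P (t *: z).
Proof.
move=> /nbhs_ballP[de /= de0 H]; exists (de / 2 / (`|z| + 1)).
  by rewrite !divr_gt0 // ltr_wpDl.
move=> t /andP[t1 t2]; apply: H; rewrite -ball_normE /ball_ /= sub0r normrN.
rewrite normrZ ger0_norm //; apply: (@le_lt_trans _ _ (t * (`|z| + 1))).
  by apply: ler_wpM2l => //; rewrite lerDl.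
by rewrite -ltr_pdivlMr // (le_lt_trans t2) // ltr_pM2r ?invr_gt0 //; lra.
Qed.

Lemma derive_dirE (f : W -> R) z q : differentiable f q ->
  'D_z f q = z.1 * 'D_vx f q + z.2 * 'D_vy f q.
Proof.
move=> df; rewrite !deriveE //.
transitivity ('d f q (z.1 *: (vx : W) + z.2 *: (vy : W))); first by rewrite -dirE.
by rewrite linearD !linearZ.
Qed.

(** Induction by the mean value theorem: the derivative along [z] combines the derivatives in x and
    y, both of order one less. *)
Lemma ray_bound (D : set W) k (h : W -> R) : open D -> D 0 ->
  smooth_on D h -> ord dxy k h -> forall z : W, exists C t0 : R,
  0 < t0 /\ forall t, 0 <= t <= t0 -> `|h (t *: z)| <= C * t ^+ k.
Proof.
move=> oD D0 + + z.
have small (P : set W) := @near_ray z P.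
have nD : \forall q \near (0 : W), D q by exact: open_nbhs_nbhs.
elim: k h => [|k IH] h sh oh.
  have ch : {for 0, continuous h}.
    by apply: differentiable_continuous; exact: smooth_on_diff sh D0.
  move/cvgrPdist_le: ch => /(_ _ ltr01) /small[t0 t00 H].
  exists (`|h 0| + 1), t0; split=> // t tt; rewrite mulr1.
  have := ler_normB (h 0) (h 0 - h (t *: z)); rewrite opprB addrC subrK.
  by have := H t tt; rewrite /=; lra.
case: oh => h0 oh.
have [C1 [t1 [t10 H1]]] := IH _ (smooth_on_derive vx sh) (oh vx (or_introl erefl)).
have [C2 [t2 [t20 H2]]] := IH _ (smooth_on_derive vy sh) (oh vy (or_intror erefl)).
have [t3 t30 H3] := small _ nD.
pose t0 := Num.min t1 (Num.min t2 t3).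
exists (`|z.1| * C1 + `|z.2| * C2), t0; split; first by rewrite !lt_min t10 t20.
move=> t /andP[t1' t0']; rewrite le_eqVlt in t1'.
have {}t0' : [/\ t <= t1, t <= t2 & t <= t3].
  by move: t0'; rewrite !le_min => /and3P[].
case: t0' => tt1 tt2 tt3.
case/orP: t1' => [/eqP <-|tp]; first by rewrite scale0r h0 normr0 exprS mul0r mulr0.
have [s /andP[s1 s2]|s /andP[s1 s2] E] := @mvt_line _ _ h 0 z t tp.
  by rewrite add0r; apply: smooth_on_diff sh _; apply: H3; rewrite s1 (le_trans s2).
move: E; rewrite !add0r h0 subr0 => ->.
have st1 : 0 <= s <= t1 by rewrite ltW //= (le_trans (ltW s2)).
have st2 : 0 <= s <= t2 by rewrite ltW //= (le_trans (ltW s2)).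
have Ds : D (s *: z) by apply: H3; rewrite ltW //= (le_trans (ltW s2)).
have dh := smooth_on_diff sh Ds.
rewrite (derive_dirE z dh).
rewrite normrM ger0_norm; last exact: ltW.
have kt : s ^+ k <= t ^+ k by apply: lerXn2r; rewrite ?nnegrE ltW.
rewrite exprS mulrCA; apply: ler_wpM2l; first exact: ltW.
apply: (le_trans (ler_normD _ _)); rewrite !normrM mulrDl -!mulrA.
have C10 : 0 <= C1.
  have := H1 t1; rewrite lexx ltW // => /(_ isT) /(le_trans (normr_ge0 _)).
  by rewrite pmulr_lge0 // exprn_gt0.
have C20 : 0 <= C2.
  have := H2 t2; rewrite lexx ltW // => /(_ isT) /(le_trans (normr_ge0 _)).
  by rewrite pmulr_lge0 // exprn_gt0.
apply: lerD; apply: ler_wpM2l => //.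
  by apply: (le_trans (H1 s st1)); exact: ler_wpM2l.
by apply: (le_trans (H2 s st2)); exact: ler_wpM2l.
Qed.

(** If the coefficients before [c n] vanish, then c_n t^n = r(t) + O(t^(n+1)), and flatness at order
    n + 1 forces c_n = 0. The [t0] may depend on k; convergence at t = 1 carries the conclusion from
    0 to 1. *)
Lemma power_series_flat (c : nat -> R) (r : R -> R) :
  (forall t, `|t| <= 1 -> series (fun n => c n * t ^+ n) @ \oo --> r t) ->
  (forall k : nat, exists C t0 : R, 0 < t0 /\
     forall t, 0 <= t <= t0 -> `|r t| <= C * t ^+ k) ->
  r 1 = 0.
Proof.
move=> cr flat.
have [M HM] : exists M, forall n, `|c n| <= M.
  have c1 : cvgn (series c).
    apply/cvg_ex; exists (r 1); have := cr 1; rewrite normr1 => /(_ (lexx 1)).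
    by under eq_fun do rewrite expr1n mulr1.
  have := cvg_series_cvg_0 c1 => c0.
  have /cvg_seq_bounded/bounded_fun_has_ubound[M HM] : cvgn (fun n => `|c n|).
    by apply/cvg_ex; exists `|0 : R|; exact: cvg_norm.
  by exists M => n; apply: HM; exists n.
have M0 : 0 <= M by exact: le_trans (HM 0%N).
suff c0 n : c n = 0.
  apply: cvg_unique (cr 1 _) _ => //; first by rewrite normr1.
  by apply: cvg_near_cst; near=> n; rewrite /series /= big1 // => i _; rewrite c0 mul0r.
have [N] := ubnP n; elim: N n => // N IH n; rewrite ltnS => nN.
have cn i : (i < n)%N -> c i = 0 by move=> ni; apply: IH; exact: leq_trans nN.
have [C [t0 [t00 HC]]] := flat n.+1.
(* Convergence at 1 bounds the coefficients by [M]; for t at most 1 / 2 the geometric series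
   contributes the factor 2. *)
have tail t : 0 <= t <= 1 / 2 -> `|r t - c n * t ^+ n| <= 2 * M * t ^+ n.+1.
  move=> /andP[t1 t2].
  have t1' : `|t| <= 1 by rewrite ger0_norm //; lra.
  have : (fun K => series (fun n => c n * t ^+ n) (K + n.+1)%N - c n * t ^+ n) @ \oo
      --> r t - c n * t ^+ n.
    by apply: cvgB; [rewrite (cvg_shiftn n.+1); exact: cr|exact: cvg_cst].
  move=> /cvg_norm_le; apply => K; rewrite /series /= addnC.
  rewrite (big_cat_nat _ (n := n.+1)) ?leq_addr //= big_nat_recr //= big1_seq; last first.
    by move=> i; rewrite mem_index_iota => /= iN; rewrite cn ?mul0r.
  rewrite add0r addrAC subrr add0r.
  rewrite [X in `|X|](_ : _ = \sum_(0 <= i < K) c (i + n.+1)%N * t ^+ (i + n.+1)).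
    2: by rewrite -{1}[n.+1]add0n big_addn addKn.
  apply: (le_trans (ler_norm_sum _ _ _)).
  apply: (@le_trans _ _ (\sum_(0 <= i < K) M * t ^+ n.+1 * (1 / 2) ^+ i)).
    apply: ler_sum => i _; rewrite normrM addnC exprD normrM mulrA.
    rewrite [`|t ^+ n.+1|]ger0_norm ?exprn_ge0 // [`|t ^+ i|]ger0_norm ?exprn_ge0 //.
    apply: ler_pM; rewrite ?mulr_ge0 ?exprn_ge0 //.
      by apply: ler_wpM2r; rewrite ?exprn_ge0.
    by apply: lerXn2r; rewrite ?nnegrE //; lra.
  rewrite -mulr_sumr [leRHS](_ : _ = M * t ^+ n.+1 * 2); last by ring.
  apply: ler_wpM2l; first by rewrite mulr_ge0 // exprn_ge0.
  have geo : \sum_(0 <= i < K) (1 / 2 : R) ^+ i = (1 - (1 / 2) ^+ K) * 2.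
    elim: K => [|K IHK]; first by rewrite big_geq // expr0; lra.
    by rewrite big_nat_recr //= IHK exprS; lra.
  by rewrite geo; have : 0 <= (1 / 2 : R) ^+ K by [rewrite exprn_ge0]; lra.
apply/eqP; rewrite -normr_le0; apply/ler_addgt0Pr => ep ep0; rewrite add0r.
pose B := `|C| + 2 * M + 1.
(* [B] collects the constants so that |c_n| <= B t for all small t > 0; taking t at most ep / B
   gives |c_n| <= ep. *)
have B0 : 0 < B by rewrite /B; have := normr_ge0 C; lra.
pose t := Num.min (Num.min t0 (1 / 2)) (ep / B).
have half0 : (0 : R) < 1 / 2 by lra.
have t_gt0 : 0 < t by rewrite !lt_min t00 half0 divr_gt0.
have tt0 : t <= t0 by rewrite !ge_min lexx.
have th : t <= 1 / 2 by rewrite !ge_min lexx orbT.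
have te : t <= ep / B by rewrite !ge_min lexx orbT.
have H1 := tail t (introT andP (conj (ltW t_gt0) th)).
have H2 := HC t (introT andP (conj (ltW t_gt0) tt0)).
have tn : 0 < t ^+ n by rewrite exprn_gt0.
have : `|c n| * t ^+ n <= B * t * t ^+ n.
  have := ler_normB (r t) (r t - c n * t ^+ n).
  rewrite opprB addrC subrK normrM [`|t ^+ n|]ger0_norm ?(ltW tn) //.
  have : C * t ^+ n.+1 <= `|C| * t ^+ n.+1.
    by apply: ler_wpM2r; [rewrite exprn_ge0 // ltW|exact: ler_norm].
  have -> : B * t * t ^+ n = `|C| * t ^+ n.+1 + 2 * M * t ^+ n.+1 + t ^+ n.+1.
    by rewrite /B exprS; ring.
  have : 0 <= t ^+ n.+1 by rewrite exprn_ge0 // ltW.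
  lra.
rewrite ler_pM2r // => /le_trans; apply.
by rewrite mulrC -ler_pdivlMr.
Unshelve. all: by end_near. Qed.

Lemma dual_family m n (u : 'I_n -> 'rV[R]_m) :
  (forall a : 'I_n -> R, \sum_i a i *: u i = 0 -> forall i, a i = 0) ->
  exists Lam : 'M[R]_(m, n),
    forall i j, (u i *m Lam) ord0 j = (i == j)%:R.
Proof.
move=> free_u; pose A : 'M[R]_(n, m) := \matrix_i u i.
have fA : row_free A.
  apply: inj_row_free => v vA; apply/rowP => i; rewrite mxE.
  apply: (free_u (fun i => v ord0 i)); rewrite -[RHS]vA mulmx_sum_row.
  by apply: eq_bigr => j _; rewrite rowK.
exists (pinvmx A) => i j.
have -> : u i *m pinvmx A = row i (A *m pinvmx A) by rewrite row_mul rowK.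
by rewrite mulmxVp // !mxE.
Qed.

End Rays.

(** * Covariant derivatives on the axis *)

Section Jets.
Context {R : realType} {m : nat}.
Notation V := 'rV[R]_m.
Notation W := (R * R)%type.

Lemma smooth_smooth_on (O : set V) (G : V -> V) : smooth G -> smooth_on O G.
Proof.
move=> sG n.
suff H vs : Cn n O (foldr (fun v Y => 'D_v Y) G vs) by exact: (H [::]).
elim: n vs => [|n IH] vs; first by split=> // p _; exact: sG.
by split=> [p _|v]; [exact: sG|exact: (IH (v :: vs))].
Qed.

Variable (Gamma : V -> V -> V -> V).
Hypothesis hGamma : symmetric_connection Gamma.

(** Linearity is given in the second argument; symmetry transfers it to the first. *)
Lemma connection_expand p A B : Gamma p A B =
  \sum_i \sum_j (A ord0 i * B ord0 j) *: Gamma p (delta_mx ord0 i) (delta_mx ord0 j).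
Proof.
have [lG sym _] := hGamma.
have lin u v : Gamma p u v = \sum_j v ord0 j *: Gamma p u (delta_mx ord0 j).
  pose l : {linear V -> V} := HB.pack (Gamma p u)
    (GRing.isLinear.Build R V V _ (Gamma p u) (lG p u)).
  rewrite -[LHS]/(l v) {1}[v]row_sum_delta linear_sum.
  by apply: eq_bigr => j _; rewrite linearZ.
rewrite sym lin; apply: eq_bigr => i _.
rewrite sym lin scaler_sumr; apply: eq_bigr => j _.
by rewrite scalerA.
Qed.

Lemma smooth_connection (U : normedModType R) (O : set U) (c A B : U -> V) :
  open O -> smooth_on O c -> smooth_on O A ->
  smooth_on O B -> smooth_on O (fun p => Gamma (c p) (A p) (B p)).
Proof.
move=> oO sc sA sB; have [_ _ sG] := hGamma.
apply: (@smooth_on_eq _ _ _ _ (fun p => \sum_i \sum_j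
  (A p ord0 i * B p ord0 j) *: Gamma (c p) (delta_mx ord0 i) (delta_mx ord0 j))) => //.
  by move=> p _; rewrite -connection_expand.
apply: smooth_on_sum => // i; apply: smooth_on_sum => // j.
apply: smooth_on_scale => //.
  by apply: (smooth_on_mul oO); exact: smooth_on_crd.
apply: (@smooth_on_comp _ _ _ _ _ setT c
  (fun p => Gamma p (delta_mx ord0 i) (delta_mx ord0 j))) => //.
exact: smooth_smooth_on.
Qed.

Lemma smooth_nabla_pow (O : set V) X Y k : open O -> smooth_on O X -> smooth_on O Y ->
  smooth_on O (nabla_pow Gamma k X Y).
Proof.
move=> oO sX sY; elim: k => //= k IH; apply: smooth_on_add => //.
  exact: (smooth_derive_field oO sX IH).
by apply: smooth_connection => //; exact: smooth_on_id.
Qed.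

(** On the axis gamma is an integral curve of X, so differentiating a field along it in x amounts to
    applying [nabla] by X. The identity is proved at all points of the axis because the next
    derivative needs it near the point. *)
Lemma cov_dx_along (O : set V) (D : set W) gamma X k x : open O -> open D ->
  smooth_on D gamma -> (forall z, D z -> O (gamma z)) -> smooth_on O X ->
  (forall x, D (x, 0) -> 'D_vx gamma (x, 0) = X (gamma (x, 0))) -> D (x, 0) ->
  iter k (cov_dx Gamma gamma) (dx gamma) (x, 0) = nabla_pow Gamma k X X (gamma (x, 0)).
Proof.
move=> oO oD sg gO sX axis; elim: k x => [|k IH] x Dx; first exact: axis.
have sN := smooth_nabla_pow k oO sX sX.
have axis' : dx gamma (x, 0) = X (gamma (x, 0)) by exact: axis.
have step : dx (iter k (cov_dx Gamma gamma) (dx gamma)) (x, 0) =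
    'D_(X (gamma (x, 0))) (nabla_pow Gamma k X X) (gamma (x, 0)).
  apply: etrans (derive_on_axis oD (g := fun z => nabla_pow Gamma k X X (gamma z)) IH Dx) _.
  apply: etrans (derive_along sg gO _ sN Dx) _.
  rewrite axis // [RHS]deriveE //.
  exact: smooth_on_diff sN (gO _ Dx).
by rewrite iterS /cov_dx axis' step IH.
Qed.

End Jets.

(** * Flatness of phi along the disc *)

Section Flat.
Context {R : realType}.
Notation W := (R * R)%type.

(** Each use of the mean value theorem gains one power of t, until the term B t^k stops the gain.
    The bound t0 <= 1 lets s^k be replaced by t^j for j <= k. *)
Lemma ray_gronwall (u : W -> R) (z : W) (A B C0 t0 : R) k : t0 <= 1 -> 0 <= A -> 0 <= B ->
  u 0 = 0 -> (forall t, 0 <= t <= t0 -> [/\ differentiable u (t *: z),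
    `|u (t *: z)| <= C0 & `|'D_z u (t *: z)| <= A * `|u (t *: z)| + B * t ^+ k]) ->
  exists C, forall t, 0 <= t <= t0 -> `|u (t *: z)| <= C * t ^+ k.
Proof.
move=> t01 A0 B0 u0 H.
suff S j : (j <= k)%N -> exists C, forall t, 0 <= t <= t0 -> `|u (t *: z)| <= C * t ^+ j.
  exact: S.
elim: j => [_|j IH jk].
  by exists C0 => t tt; rewrite expr0 mulr1; have [] := H t tt.
have [C HC] := IH (ltnW jk).
exists (A * `|C| + B) => t /andP[t1 t2].
move: t1; rewrite le_eqVlt => /orP[/eqP <-|tp].
  by rewrite scale0r u0 normr0 exprS mul0r mulr0.
have [s ss|s /andP[s1 s2] E] := @mvt_line _ _ u 0 z t tp.
  by rewrite add0r; have [] // := H s; lra.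
move: E; rewrite !add0r u0 subr0 => ->.
have st : 0 <= s <= t0 by lra.
have [_ _ D] := H s st.
rewrite normrM ger0_norm ?(ltW tp) // exprS mulrCA ler_wpM2l ?(ltW tp) //.
apply: (le_trans D); rewrite mulrDl.
have sj : s ^+ j <= t ^+ j by apply: lerXn2r; rewrite ?nnegrE; lra.
have sk : s ^+ k <= t ^+ j.
  apply: le_trans sj; apply: ler_wiXn2l => //; try lra; exact: ltnW.
apply: lerD; last exact: ler_wpM2l.
rewrite -mulrA; apply: ler_wpM2l => //; apply: (le_trans (HC s st)).
apply: (@le_trans _ _ (`|C| * s ^+ j)); last exact: ler_wpM2l.
by apply: ler_wpM2r; [rewrite exprn_ge0 //; lra|exact: ler_norm].
Qed.

Context {m : nat}.
Notation V := 'rV[R]_m.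
Variables (O : set V) (D : set W) (gamma : W -> V) (J : V -> 'M[R]_m).
Hypotheses (oO : open O) (oD : open D) (D0 : D 0).
Hypotheses (sgamma : smooth_on D gamma) (gamma0 : gamma 0 = 0)
  (gammaO : forall z, D z -> O (gamma z)).
Hypothesis (sJ : forall i, smooth_on O (fun p => row i (J p))).
Hypothesis (CR : forall z, D z -> 'D_vy gamma z = 'D_vx gamma z *m J (gamma z)).

(** A derivative of phi along the disc is dphi(Z) or dphi(JZ), which [tangency_bound] compares with
    phi, plus dphi of the error, which [ray_bound] makes O(t^k). [ray_gronwall] concludes. *)
Lemma flat_along_rays (phi : V -> R) (v : V) (Z : V -> V) k z :
  smooth_on O phi -> phi 0 = 0 -> 0 < 'D_v phi 0 -> smooth_on O Z ->
  ord dxy k (err gamma Z) ->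
  (forall b, \forall p \near (0 : V), phi p = 0 -> 'd phi p (fld J Z b p) = 0) ->
  exists C t0 : R, 0 < t0 /\ forall t, 0 <= t <= t0 -> `|phi (gamma (t *: z))| <= C * t ^+ k.
Proof.
move=> sphi phi0 vphi sZ oE tang; pose u q := phi (gamma q).
have O0 : O 0 by rewrite -gamma0; exact: gammaO.
have su : smooth_on D u by exact: (smooth_along oD sgamma gammaO).
have cg : gamma q @[q --> (0 : W)] --> (0 : V).
  apply: cvg_trans (differentiable_continuous (smooth_on_diff sgamma D0)) _.
  by rewrite -[X in _ `=>` nbhs X]gamma0.
have bound b : exists C B t0 : R, [/\ 0 <= C, 0 <= B, 0 < t0 & forall t, 0 <= t <= t0 ->
    `|'D_(dir b) u (t *: z)| <= C * `|u (t *: z)| + B * t ^+ k].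
  have sf := smooth_fld oO sJ sZ b.
  have sdf := smooth_diff_field oO sf sphi.
  have [C C0 nC] := tangency_bound oO O0 sphi sdf phi0 vphi (tang b).
  have sd := smooth_derr oD sgamma gammaO sJ sZ b.
  have od := ord_derr oD D0 sgamma gammaO sJ sZ oE b.
  have sh := smooth_diff_along oD sgamma gammaO sphi sd.
  have oh := ord_diff_along oD D0 sgamma gammaO sphi sd od.
  have [B [t1 [t10 HB]]] := ray_bound oD D0 sh oh z.
  have nD : \forall q \near (0 : W), D q by exact: open_nbhs_nbhs.
  have nC' : \forall q \near (0 : W), `|'d phi (gamma q) (fld J Z b (gamma q))| <= C * `|u q|.
    exact: (cg _ nC).
  have [t2 t20 H2] := near_ray z (filterI nD nC').
  exists C, `|B|, (Num.min t1 t2); split=> // [|t /andP[tp]].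
    by rewrite lt_min t10.
  rewrite le_min => /andP[tt1 tt2].
  have [Dq Cq] := H2 t (introT andP (conj tp tt2)).
  have := HB t (introT andP (conj tp tt1)).
  have -> : 'D_(dir b) u (t *: z) = 'd phi (gamma (t *: z)) (fld J Z b (gamma (t *: z)))
       + 'd phi (gamma (t *: z)) (derr gamma J Z b (t *: z)).
    apply: etrans (derive_along sgamma gammaO _ sphi Dq) _.
    by rewrite (derive_dir CR Z b Dq) linearD.
  move=> Bq; apply: (le_trans (ler_normD _ _)); apply: lerD => //.
  apply: (le_trans Bq); apply: ler_wpM2r; [exact: exprn_ge0|exact: ler_norm].
have [C1 [B1 [t1 [C10 B10 t10 H1]]]] := bound false.
have [C2 [B2 [t2 [C20 B20 t20 H2]]]] := bound true.
have [C3 [t3 [t30 H3]]] := ray_bound (k := 0) oD D0 su Logic.I z.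
have nD : \forall q \near (0 : W), D q by exact: open_nbhs_nbhs.
have [t4 t40 H4] := near_ray z nD.
pose t0 := Num.min (Num.min t1 t2) (Num.min (Num.min t3 t4) 1).
have t00 : 0 < t0 by rewrite !lt_min t10 t20 t30 t40 ltr01.
suff [C HC] : exists C, forall t, 0 <= t <= t0 -> `|u (t *: z)| <= C * t ^+ k.
  by exists C, t0.
apply: (@ray_gronwall u z (`|z.1| * C1 + `|z.2| * C2) (`|z.1| * B1 + `|z.2| * B2) C3) => //.
- by rewrite !ge_min lexx !orbT.
- by rewrite addr_ge0 // mulr_ge0.
- by rewrite addr_ge0 // mulr_ge0.
- by rewrite /u gamma0.
move=> t /andP[tp]; rewrite !le_min => /andP[/andP[tt1 tt2] /andP[/andP[tt3 tt4] _]].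
have Dq := H4 t (introT andP (conj tp tt4)).
have du := smooth_on_diff su Dq.
split=> //; first by have := H3 t (introT andP (conj tp tt3)); rewrite expr0 mulr1.
rewrite (derive_dirE z du); apply: (le_trans (ler_normD _ _)); rewrite !normrM.
have b1 := ler_wpM2l (normr_ge0 z.1) (H1 t (introT andP (conj tp tt1))).
have b2 := ler_wpM2l (normr_ge0 z.2) (H2 t (introT andP (conj tp tt2))).
apply: (le_trans (lerD b1 b2)); rewrite le_eqVlt; apply/orP; left; apply/eqP; ring.
Qed.

End Flat.

Section Disc.
Context {R : realType} {m : nat}.
Notation V := 'rV[R]_m.
Notation W := (R * R)%type.

Lemma disc_normlt (eta : R) (z : W) : 0 < eta -> disc eta z -> `|z| < eta.
Proof.
move=> eta0; rewrite /disc /= => H.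
have sq (a b : R) : a ^+ 2 + b ^+ 2 < eta ^+ 2 -> `|a| < eta.
  move=> ab; rewrite -(ltr_pXn2r (n := 2)) ?nnegrE ?(ltW eta0) //.
  by rewrite real_normK ?num_real //; apply: le_lt_trans ab; rewrite lerDl sqr_ge0.
by rewrite prod_normE gt_max (sq _ _ H) (sq z.2 z.1) // addrC.
Qed.

(** The equation is known for the vector (1, 0); J^2 = - 1 gives it for (0, 1), and the differential
    is linear. *)
Lemma smooth_holomorphic (J : V -> 'M[R]_m) (eta : R) (gamma : W -> V) : 0 < eta ->
  (forall p, J p *m J p = - 1%:M) -> smooth_on [set z : W | `|z| < eta] gamma ->
  (forall z, `|z| < eta -> 'D_vy gamma z = 'D_vx gamma z *m J (gamma z)) ->
  holomorphic_disc J eta gamma.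
Proof.
move=> eta0 JJ sg CR z /(disc_normlt eta0) Dz.
have dg := smooth_on_diff sg Dz; split=> //.
- move=> v; have sd := smooth_on_diff (smooth_on_derive v sg) Dz.
  have cd := differentiable_continuous sd.
  have E : {near z, 'D_v gamma =1 (fun z' => 'd gamma z' v)}.
    have : \forall q \near z, `|q| < eta.
      exact: (open_nbhs_nbhs (conj (@open_normlt R W eta) Dz)).
    by apply: filterS => q Dq; rewrite deriveE //; exact: smooth_on_diff sg Dq.
  have H : (fun z' => 'd gamma z' v) z' @[z' --> z] --> 'D_v gamma z.
    by apply: cvg_trans cd; apply: near_eq_cvg; apply: filterS E => q ->.
  exact: (eq_ind _ (fun y => (fun z' => 'd gamma z' v) z' @[z' --> z] --> y) H _ (deriveE v dg)).
- move=> v; have dE (w : W) : 'd gamma z w = w.1 *: 'D_vx gamma z + w.2 *: 'D_vy gamma z.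
    rewrite !deriveE //; transitivity ('d gamma z (w.1 *: (vx : W) + w.2 *: (vy : W))).
      by rewrite -dirE.
    by rewrite linearD !linearZ.
  rewrite !dE CR //= mulmxDl -!scalemxAl -mulmxA JJ mulmxN mulmx1 scalerN scaleNr.
  by rewrite addrC.
Qed.

Lemma smooth_x_smooth (eta : R) (gamma : W -> V) : 0 < eta ->
  smooth_on [set z : W | `|z| < eta] gamma -> x_smooth eta gamma.
Proof.
move=> eta0 sg k z /(disc_normlt eta0) Dz; apply: diff_derivable.
have : smooth_on [set z : W | `|z| < eta] (iter k dx gamma).
  by elim: k => //= k IH; exact: smooth_on_derive.
by move=> /smooth_on_diff; apply.
Qed.

End Disc.

Section Sections.
Context {R : realType} {m : nat}.
Notation V := 'rV[R]_m.
Variables (U : set V) (phi : V -> R) (J : V -> 'M[R]_m) (L : V -> {vspace V}).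
Variables (X : V -> V) (d : nat) (e : 'I_d -> V -> V).
Hypothesis sectionX : section_near0 U phi L X.
Hypothesis basis_e : \forall q \near (0 : V), (forall i, analytic_field_at (e i) q) /\
  (hypersurface U phi q -> basis_of (L q) [tuple e i q | i < d]).

Lemma section_correct g : (forall i p, analytic_at (g i) p) ->
  section_near0 U phi L (correct X e g).
Proof.
move=> ag; rewrite /section_near0; apply: filterS2 sectionX basis_e => p [aX LX] [ae Le].
split=> [j|Mp].
  rewrite (_ : (fun q => _) = fun q => X q ord0 j + \sum_i g i q * e i q ord0 j).
    apply: analytic_at_add; first exact: aX.
    by apply: analytic_at_sum => i; apply: analytic_at_mul; [exact: ag|exact: ae].
  apply/funext => q; rewrite /correct mxE summxE; congr (_ + _).
  by apply: eq_bigr => i _; rewrite mxE.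
apply: memvD; first exact: LX.
apply: memv_suml => i _; apply: memvZ; apply: basis_mem (Le Mp) _.
by apply/mapP; exists i => //; rewrite mem_enum.
Qed.

End Sections.

(** * The disc inside the hypersurface *)

Section Hypersurface.
Context {R : realType} {m : nat}.
Notation V := 'rV[R]_m.
Notation W := (R * R)%type.

Lemma smooth_radius (I : finType) (f : I -> V -> R) : (forall i, analytic_at (f i) 0) ->
  exists2 r : R, 0 < r & forall i, smooth_on [set p : V | `|p| < r] (f i).
Proof.
move=> /analytic_list_family[P [r [r0 H]]]; exists r => // i.
exact: power_series_smooth (analytic_list_power_series (H i)).
Qed.

Lemma smooth_radius_field (I : finType) (f : I -> V -> V) :
  (forall i, analytic_field_at (f i) 0) ->
  exists2 r : R, 0 < r & forall i, smooth_on [set p : V | `|p| < r] (f i).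
Proof.
move=> H; have [r r0 sr] := @smooth_radius (I * 'I_m)%type
  (fun ij q => f ij.1 q ord0 ij.2) (fun ij => H ij.1 ij.2).
exists r => // i; apply: smooth_on_rV; first exact: open_normlt.
by move=> j; exact: (sr (i, j)).
Qed.

(** Apply the conjugate x - y J to the relation x u + y J u = 0: it becomes (x^2 + y^2) u = 0. *)
Lemma complex_independent (u : V) (J : 'M[R]_m) : J *m J = - 1%:M -> u != 0 ->
  forall a : 'I_2 -> R, \sum_i a i *: (if i == ord0 then u else u *m J) = 0 ->
  forall i, a i = 0.
Proof.
move=> JJ u0 a; rewrite !big_ord_recl big_ord0 addr0 /= => E.
set x := a ord0 in E; set y := a (lift ord0 ord0) in E.
have E2 : (x ^+ 2 + y ^+ 2) *: u = 0.
  transitivity (x *: (x *: u + y *: (u *m J)) - y *: ((x *: u + y *: (u *m J)) *m J)).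
    rewrite mulmxDl -!scalemxAl -mulmxA JJ mulmxN mulmx1.
    by apply/rowP => j; rewrite !mxE; ring.
  by rewrite E mul0mx !scaler0 subrr.
move/eqP: E2; rewrite scaler_eq0 (negPf u0) orbF => /eqP xy.
have x0 : x = 0 by nra.
have y0 : y = 0 by nra.
move=> i; case: (unliftP ord0 i) => [j|] -> //.
by rewrite [j]ord1.
Qed.

Lemma basis_dual (L0 : {vspace V}) d (e : 'I_d -> V) :
  basis_of L0 [tuple e i | i < d] -> exists Lam : 'M[R]_(m, d),
    (forall i j, (e i *m Lam) ord0 j = (i == j)%:R) /\
    (forall v, v \in L0 -> \sum_i (v *m Lam) ord0 i *: e i = v).
Proof.
move=> bas; have [a Ha|Lam HLam] := @dual_family R m d e.
  move/freeP: (basis_free bas); apply.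
  by rewrite -[RHS]Ha; apply: eq_bigr => i _; rewrite -tnth_nth tnth_mktuple.
exists Lam; split=> // v vL.
have E : v = \sum_i coord [tuple e i | i < d] i v *: e i.
  rewrite {1}(coord_basis bas vL); apply: eq_bigr => i _.
  by rewrite -tnth_nth tnth_mktuple.
rewrite [RHS]E; apply: eq_bigr => i _; congr (_ *: _).
rewrite {1}E mulmx_suml summxE (bigD1 i) //= -scalemxAl mxE HLam eqxx mulr1.
by rewrite big1 ?addr0 // => j ji; rewrite -scalemxAl mxE HLam (negPf ji) mulr0.
Qed.

Variables (U : set V) (phi : V -> R) (J : V -> 'M[R]_m) (L : V -> {vspace V}).
Hypotheses (hM : analytic_defining_function U phi) (hM0 : hypersurface U phi 0)
  (hJ : analytic_almost_complex J) (hL : complex_analytic_subbundle U phi J L).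
Hypothesis hprop : forall (k : nat) (X : V -> V),
  (1 <= k)%N -> section_near0 U phi L X -> commutes_at_order J X k 0 ->
  forall w : seq bool, size w = k.+1 -> word_bracket J X w 0 \in L 0.

Lemma disc_in_hypersurface X rho : section_near0 U phi L X -> X 0 != 0 -> 0 < rho ->
  exists (eta : R) (gamma : W -> V),
  [/\ 0 < eta, smooth_on [set z : W | `|z| < eta] gamma, gamma 0 = 0 &
    forall z, `|z| < eta -> [/\ `|gamma z| < rho,
      'D_vy gamma z = 'D_vx gamma z *m J (gamma z),
      z.2 = 0 -> 'D_vx gamma z = X (gamma z) & hypersurface U phi (gamma z)]].
Proof.
move=> hX X0 rho0.
have [oU aphi dphi] := hM; have [JJ aJ] := hJ; have [U0 phi0] := hM0.
have [_ LJ [d [e ne]]] := hL hM0.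
have [ae /(_ hM0) be] := nbhs_singleton ne.
have [aX /(_ hM0) XL] := nbhs_singleton hX.
have [r1 r10 s1] := @smooth_radius_field unit (fun=> X) (fun=> aX).
have aJrow i : analytic_field_at (fun p => row i (J p)) 0.
  move=> j; rewrite (_ : (fun q => _) = fun q => J q i j); first exact: aJ.
  by apply/funext => q; rewrite mxE.
have [r2 r20 s2] := smooth_radius_field aJrow.
have [r3 r30 s3] := @smooth_radius unit (fun=> phi) (fun=> aphi _ U0).
have [r4 r40 s4] := smooth_radius_field ae.
have /nbhs_ballP[r5 /= r50 s5] : nbhs (0 : V) U by exact: open_nbhs_nbhs.
pose r := Num.min rho (Num.min (Num.min r1 r2) (Num.min (Num.min r3 r4) r5)).
have r0 : 0 < r by rewrite !lt_min rho0 r10 r20 r30 r40.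
have [rr rr1 rr2 rr3 [rr4 rr5]] : [/\ r <= rho, r <= r1, r <= r2, r <= r3 & r <= r4 /\ r <= r5].
  by rewrite !ge_min !lexx !orbT.
have [eta [gamma [eta0 sg g0 Hg]]] := analytic_disc aX (fun i j => aJ i j 0) (aphi _ U0) r0.
exists eta, gamma; split=> //.
pose D := [set z : W | `|z| < eta]; pose O := [set p : V | `|p| < r].
have oD : open D by exact: open_normlt.
have oO : open O by exact: open_normlt.
have D0 : D 0 by rewrite /D /= normr0.
have O0 : O 0 by rewrite /O /= normr0.
have subO r' : r <= r' -> O `<=` [set p : V | `|p| < r'].
  by move=> rr' p /lt_le_trans; apply.
have gO z : D z -> O (gamma z) by move=> /Hg[].
have OU : O `<=` U.
  move=> p Op; apply: s5; rewrite -ball_normE /ball_ /= sub0r normrN.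
  exact: lt_le_trans Op rr5.
have sX := smooth_on_sub (subO _ rr1) (s1 tt).
have sJ i := smooth_on_sub (subO _ rr2) (s2 i).
have sphi := smooth_on_sub (subO _ rr3) (s3 tt).
have se i := smooth_on_sub (subO _ rr4) (s4 i).
have CR z : D z -> 'D_vy gamma z = 'D_vx gamma z *m J (gamma z) by move=> /Hg[].
have axis x : D (x, 0) -> 'D_vx gamma (x, 0) = X (gamma (x, 0)).
  by move=> /Hg[_ _ + _]; apply.
have [Lam [eLam spanL]] := basis_dual be.
(* The columns of [C] are linear forms dual to X(0) and JX(0): they restrict to first-order
   coordinates on the disc, and exist because X(0) is not zero. *)
have [C HC] := dual_family (complex_independent (JJ 0) X0).
have colE (u : V) j : (u *m col j C) ord0 ord0 = (u *m C) ord0 j.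
  by rewrite !mxE; apply: eq_bigr => i _; rewrite mxE.
pose i1 : 'I_2 := lift ord0 ord0.
have c1x : (X 0 *m col ord0 C) ord0 ord0 = 1.
  by rewrite colE; have := HC ord0 ord0; rewrite !eqxx.
have c1y : (X 0 *m J 0 *m col ord0 C) ord0 ord0 = 0.
  by rewrite colE; exact: (HC i1 ord0).
have c2y : (X 0 *m J 0 *m col i1 C) ord0 ord0 = 1.
  by rewrite colE; exact: (HC i1 i1).
have eL i : e i 0 \in L 0.
  by apply: (basis_mem be); apply/mapP; exists i => //; rewrite mem_enum.
have bracketL k g : (1 <= k)%N -> (forall i p, analytic_at (g i) p) ->
    commutes_at_order J (correct X e g) k 0 ->
    forall w, size w = k.+1 -> word_bracket J (correct X e g) w 0 \in L 0.
  by move=> k1 ag; apply: hprop => //; exact: (section_correct hX ne).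
have corr := corrections oO oD D0 sg g0 gO sJ CR sX se axis eL eLam spanL LJ
  c1x c1y c2y bracketL.
have [v v0] : exists v, 0 < 'D_v phi 0.
  have [v dv] := dphi 0 hM0; have dp := smooth_on_diff sphi O0.
  have [pv|nv|z] := ltrgtP 0 ('d phi 0 v).
  - by exists v; rewrite deriveE.
  - by exists (- v); rewrite deriveE // linearN oppr_gt0.
  - by rewrite -z eqxx in dv.
move=> z Dz; have [zr zCR zaxis [c Hc]] := Hg z Dz; split=> //.
  exact: lt_le_trans rr.
split; first exact/OU/gO.
(* The point z is the end t = 1 of its ray. A new section, adapted to the order k, is used for each
   k. *)
rewrite -[z]scale1r; apply: (power_series_flat Hc) => k.
have [g [sgi agi og]] := corr k.
have sZ := smooth_correct oO sX se sgi.
apply: (flat_along_rays oO oD D0 sg g0 gO sJ CR z sphi phi0 v0 sZ og) => b.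
have nU : \forall p \near (0 : V), U p by exact: open_nbhs_nbhs.
apply: filterS2 nU (section_correct hX ne agi) => p Up [_ Lp] pp.
have Mp : hypersurface U phi p by [].
have [LTp LJp _] := hL Mp.
have ZL := Lp Mp.
(* JZ is tangent to [M] because the fibre is J-invariant and consists of tangent vectors. *)
by case: b; [have [] := LTp _ (LJp _ ZL)|have [] := LTp _ ZL].
Qed.

End Hypersurface.

Unset Implicit Arguments.

Theorem theorem1p6 (R : realType) (n : nat)
    (U : set 'rV[R]_(2 * n)) (phi : 'rV[R]_(2 * n) -> R)
    (J : 'rV[R]_(2 * n) -> 'M[R]_(2 * n))
    (Gamma : 'rV[R]_(2 * n) -> 'rV[R]_(2 * n) -> 'rV[R]_(2 * n) ->
             'rV[R]_(2 * n))
    (L : 'rV[R]_(2 * n) -> {vspace 'rV[R]_(2 * n)})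
    (hM : analytic_defining_function U phi)
    (hM0 : hypersurface U phi 0)
    (hJ : analytic_almost_complex J)
    (hGamma : symmetric_connection Gamma)
    (hL : complex_analytic_subbundle U phi J L)
    (hprop : forall (k : nat) (X : 'rV[R]_(2 * n) -> 'rV[R]_(2 * n)),
       (1 <= k)%N -> section_near0 U phi L X -> commutes_at_order J X k 0 ->
       forall w : seq bool, size w = k.+1 -> word_bracket J X w 0 \in L 0) :
  forall X : 'rV[R]_(2 * n) -> 'rV[R]_(2 * n), section_near0 U phi L X ->
  exists (eps : R) (gamma : R * R -> 'rV[R]_(2 * n)),
    [/\ 0 < eps,
        holomorphic_disc J eps gamma,
        gamma (0, 0) = 0,
        x_smooth eps gamma /\
        (forall k : nat, (1 <= k)%N ->
           cov_partial_x Gamma k gamma (0, 0) = nabla_pow Gamma k.-1 X X 0) &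
        forall z, disc eps z -> hypersurface U phi (gamma z)].
Proof.
move=> X hX.
have [aX _] := nbhs_singleton hX; have [JJ _] := hJ.
have [r r0 sX] := @smooth_radius_field R (2 * n) unit (fun=> X) (fun=> aX).
have {}sX := sX tt.
pose O := [set p : 'rV[R]_(2 * n) | `|p| < r].
have oO : open O by exact: open_normlt.
have [eta [gamma [eta0 sg g0 Hg]]] : exists (eta : R) (gamma : R * R -> 'rV[R]_(2 * n)),
  [/\ 0 < eta, smooth_on [set z : R * R | `|z| < eta] gamma, gamma 0 = 0 &
    forall z : R * R, `|z| < eta -> [/\ `|gamma z| < r,
      'D_vy gamma z = 'D_vx gamma z *m J (gamma z),
      z.2 = 0 -> 'D_vx gamma z = X (gamma z) & hypersurface U phi (gamma z)]].
  (* When X(0) = 0 the constant disc satisfies d_x gamma = X(gamma) everywhere, so that the common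
     argument on covariant derivatives below covers it too. *)
  have [X0|X0] := eqVneq (X 0) 0.
    exists 1, (fun=> 0); split=> // [|z _]; first exact: smooth_on_cst.
    by rewrite normr0 !derive_cst mul0mx X0.
  exact: (disc_in_hypersurface hM hM0 hJ hL hprop hX X0 r0).
pose D := [set z : R * R | `|z| < eta].
have oD : open D by exact: open_normlt.
have D0 : D (0, 0) by rewrite /D /= -[(0, 0)]/(0 : R * R) normr0.
exists eta, gamma; split=> //.
- by apply: smooth_holomorphic => // z /Hg[].
- split=> [|k _]; first exact: smooth_x_smooth.
  rewrite -[X in nabla_pow _ _ _ _ X]g0.
  apply: (cov_dx_along hGamma k.-1 oO oD sg _ sX _ D0); first by move=> z /Hg[].
  by move=> x /Hg[_ _ + _]; apply.
- by move=> z /(disc_normlt eta0)/Hg[].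
Qed.
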